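(* Let $\Omega_{0,\infty}=\mathbb{R}^2\setminus\{0\}$. Let $v=(v_1,v_2)\in C^2(\Omega_{0,\infty})$ be a flow solving the steady Euler equations $$v\cdot\nabla v+\nabla p=0\ \text{ and }\ \mathrm{div}\,v=0\ \text{ in }\Omega_{0,\infty}$$ (for some pressure $p$), and such that $|v|>0$ in $\Omega_{0,\infty}$ and $\liminf_{|x|\to+\infty}|v(x)|>0$. Assume moreover that $$v(x)\cdot e_r(x)=o\Big(\frac{1}{|x|}\Big)\ \text{ as }|x|\to+\infty\ \text{ and }\ \int_{C_\varepsilon}|v\cdot e_r|\to0\ \text{ as }\varepsilon\to0^+.$$ Then $v$ is a circular flow. Furthermore, there is a $C^2((0,+\infty))$ function $V$ with constant strict sign (that is, $V>0$ on all of $(0,+\infty)$ or $V<0$ on all of $(0,+\infty)$) such that $v(x)=V(|x|)\,e_\theta(x)$ for all $x\in\Omega_{0,\infty}$.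
   Context: $|\cdot|$ is the Euclidean norm in $\mathbb{R}^2$; $C_r=\{x\in\mathbb{R}^2:|x|=r\}$, and integrals over $C_r$ are with respect to arc length. For $x=(x_1,x_2)\neq0$, $e_r(x)=x/|x|$ and $e_\theta(x)=(-x_2/|x|,x_1/|x|)$. Solutions $(v,p)$ of the Euler equations are understood in the classical sense: $v$ and $p$ are (at least) of class $C^1$ in the open domain and the equations hold at every point. A flow $v$ is called circular if $v(x)$ is parallel to $e_\theta(x)$ at every point $x$ of the domain, i.e. $v\cdot e_r=0$ there. *)

(* Defs.v *)
From Stdlib Require Import Reals.
From Coquelicot Require Import Coquelicot.
Open Scope R_scope.

(** Points and vectors of the plane are pairs of (Stdlib) reals. *)

Definition dot (u w : R * R) : R := fst u * fst w + snd u * snd w.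

Definition enorm (u : R * R) : R := sqrt (fst u ^ 2 + snd u ^ 2).

(** Only meaningful for [x <> (0, 0)]. *)
Definition e_r (x : R * R) : R * R := (fst x / enorm x, snd x / enorm x).

Definition e_theta (x : R * R) : R * R := (- snd x / enorm x, fst x / enorm x).

Definition punctured_plane (x : R * R) : Prop := x <> (0, 0).

Definition comp1 (v : R * R -> R * R) (x : R * R) : R := fst (v x).
Definition comp2 (v : R * R -> R * R) (x : R * R) : R := snd (v x).

Definition d1 (f : R * R -> R) (x : R * R) : R :=
  Derive (fun s => f (s, snd x)) (fst x).
Definition d2 (f : R * R -> R) (x : R * R) : R :=
  Derive (fun s => f (fst x, s)) (snd x).

(** [ex_diff_n g n a b] says that [g] and its iterated partial derivatives up to
    order [n] exist and are (jointly) continuous at [(a, b)]; required at every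
    point of an open set [D], this is the class C^n on [D]. *)
Definition class_C (n : nat) (D : R * R -> Prop) (f : R * R -> R) : Prop :=
  forall x, D x -> ex_diff_n (fun a b => f (a, b)) n (fst x) (snd x).

Definition class_C_vec (n : nat) (D : R * R -> Prop) (v : R * R -> R * R)
  : Prop :=
  class_C n D (comp1 v) /\ class_C n D (comp2 v).

Definition class_C_pos (n : nat) (V : R -> R) : Prop :=
  forall r, 0 < r ->
    (forall k, (k <= n)%nat -> ex_derive_n V k r) /\
    continuous (Derive_n V n) r.

Definition div (v : R * R -> R * R) (x : R * R) : R :=
  d1 (comp1 v) x + d2 (comp2 v) x.

Definition grad (f : R * R -> R) (x : R * R) : R * R := (d1 f x, d2 f x).

(** [v . grad v]: each component of [v] is differentiated along [v]. *)
Definition convection (v : R * R -> R * R) (x : R * R) : R * R :=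
  (dot (v x) (grad (comp1 v) x), dot (v x) (grad (comp2 v) x)).

Definition steady_euler (D : R * R -> Prop) (v : R * R -> R * R)
  (p : R * R -> R) : Prop :=
  class_C_vec 1 D v /\ class_C 1 D p /\
  forall x, D x ->
    plus (convection v x) (grad p x) = (0, 0) /\ div v x = 0.

Definition circular (D : R * R -> Prop) (v : R * R -> R * R) : Prop :=
  forall x, D x -> dot (v x) (e_r x) = 0.

(** The filter "[|x| -> +oo]" on the plane. *)
Definition at_infinity (P : R * R -> Prop) : Prop :=
  exists A : R, forall x, A < enorm x -> P x.

(** [liminf_{|x| -> +oo} f x], as the supremum over [A] of the infimum of [f]
    on [{|x| > A}]. *)
Definition liminf_infinity (f : R * R -> R) : Rbar :=
  Rbar_lub (fun l => exists A : R,
    l = Glb_Rbar (fun y => exists x, A < enorm x /\ y = f x)).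

(** Arc-length integral over the circle of radius [r > 0] centred at 0. *)
Definition circle_integral (f : R * R -> R) (r : R) : R :=
  RInt (fun t => f (r * cos t, r * sin t) * r) 0 (2 * PI).

(* Main.v *)
Require Import Defs.
From Stdlib Require Import Reals.
From Coquelicot Require Import Coquelicot.
From Stdlib Require Import Lra Lia Psatz ClassicalEpsilon Ranalysis5.
Open Scope R_scope.

(** Since the flux of [v] through small circles tends to zero, [v] has a stream
    function [u] on the punctured plane, [v = (- d2 u, d1 u)] up to a sign, that
    increases radially at infinity. As [u] has no critical point, its maximum and
    minimum on the circle of radius [r] increase strictly with [r], and [u] is
    smaller near the origin than at any given point.

    The vorticity [w = lap u] satisfies [v . grad w = 0], so [w b(u) du] is a closed
    form for every function [b]. With [b] a bump around a value [t], its potential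
    is constant on [{u > t + d}] and on [{u < t - d}], because a component where it
    took another value would contain an extremum of [u]. The jump between these two
    constants is close to [w] at any point of [{u = t}], up to the mass of [b]; hence
    [w] is a locally Lipschitz function of [u].

    Moving planes: the difference of [u] and its reflection in a line
    [{x1 = lam}], [lam > 0], then solves a linear elliptic inequality. It is positive
    far away because [x . v -> 0] while [|v|] is bounded below, and near the image of
    the origin because [u] is small there. The Hopf lemma, used at the rightmost
    interior zero and on the line, lets [lam] decrease to [0]. So [d1 u >= 0]
    on the line [{x1 = 0}], and in all rotated frames, that is [x . v = 0]. *)

(** * Calculus in the plane *)

(** The obstacle in passing from transport to a function of [u] is that transport gives constancy
    only along each streamline, while a level set of [u] may a priori have several components.
    Tracing level curves is avoided: the jump of the potential between the regions above and below a
    level is a single number, and it can be measured across any component.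

    A local Lipschitz bound is enough, since it only has to dominate the difference of the
    vorticities at a point and at its mirror image by a multiple of the difference of [u]. The bound
    may degenerate at the puncture and at infinity, so the possible contact points of the moving
    plane are first confined to a compact annulus.

    The Hopf lemma is arranged to require positivity only to the right of the point. At the
    rightmost zero this holds by the choice of the point, on the mirror line by strictness, so one
    statement serves both as strong maximum principle and as boundary lemma. Equality in the end
    comes from using each frame together with its rotation by a half turn, which give opposite
    inequalities. *)

Notation diff2 := differentiable_pt_lim.

Definition nz (x y : R) : Prop := 0 < x ^ 2 + y ^ 2.

Definition nrm (x y : R) : R := sqrt (x ^ 2 + y ^ 2).

Lemma is_derive_path (f : R -> R -> R) (p q : R -> R) (t a b l m : R) :
  diff2 f (p t) (q t) a b -> is_derive p t l -> is_derive q t m ->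
  is_derive (fun s => f (p s) (q s)) t (a * l + b * m).
Proof.
  intros Hf Hp Hq. apply is_derive_Reals.
  apply (derivable_pt_lim_comp_2d f p q); auto; now apply is_derive_Reals.
Qed.

Lemma continuous_path (f : R -> R -> R) (p q : R -> R) (t : R) :
  continuity_2d_pt f (p t) (q t) -> continuous p t -> continuous q t ->
  continuous (fun s => f (p s) (q s)) t.
Proof.
  intros Hf Hp Hq.
  apply continuity_2d_pt_filterlim in Hf.
  apply (continuous_comp_2 p q f); auto.
Qed.

Lemma diff2_continuity (f : R -> R -> R) (x y a b : R) :
  diff2 f x y a b -> continuity_2d_pt f x y.
Proof.
  intro H. apply differentiable_continuity_pt. now exists a, b.
Qed.

Lemma mvt_ge (f df : R -> R) (a b c : R) :
  a <= b -> (forall t, a <= t <= b -> is_derive f t (df t)) ->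
  (forall t, a <= t <= b -> c <= df t) -> c * (b - a) <= f b - f a.
Proof.
  intros Hab Hd Hc.
  destruct (MVT_gen f a b df) as [t [Ht He]].
  - rewrite Rmin_left, Rmax_right by lra. intros; apply Hd; lra.
  - rewrite Rmin_left, Rmax_right by lra. intros t Ht.
    apply continuity_pt_filterlim. apply (ex_derive_continuous f).
    exists (df t). apply Hd; lra.
  - rewrite Rmin_left, Rmax_right in Ht by lra. rewrite He.
    apply Rmult_le_compat_r; [lra|]. apply Hc; lra.
Qed.

Lemma mvt_abs (f df : R -> R) (a b c : R) :
  (forall t, Rmin a b <= t <= Rmax a b -> is_derive f t (df t)) ->
  (forall t, Rmin a b <= t <= Rmax a b -> Rabs (df t) <= c) ->
  Rabs (f b - f a) <= c * Rabs (b - a).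
Proof.
  intros Hd Hc.
  destruct (MVT_gen f a b df) as [t [Ht He]].
  - intros; apply Hd; lra.
  - intros t Ht. apply continuity_pt_filterlim. apply (ex_derive_continuous f).
    exists (df t). now apply Hd.
  - rewrite He, Rabs_mult. apply Rmult_le_compat_r; [apply Rabs_pos|]. now apply Hc.
Qed.

Lemma derive_zero_const (f : R -> R) (a b : R) :
  (forall t, Rmin a b <= t <= Rmax a b -> is_derive f t 0) -> f b = f a.
Proof.
  intros Hd.
  assert (H := mvt_abs f (fun _ => 0) a b 0 Hd).
  rewrite Rmult_0_l in H.
  assert (Rabs (f b - f a) <= 0) by (apply H; intros; rewrite Rabs_R0; lra).
  apply Rminus_diag_uniq. apply Rabs_eq_0.
  apply Rle_antisym; [assumption | apply Rabs_pos].
Qed.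

Lemma diff2_of_partials (f P Q : R -> R -> R) (x y : R) :
  locally_2d (fun u v => is_derive (fun s => f s v) u (P u v) /\
                         is_derive (fun s => f u s) v (Q u v)) x y ->
  continuity_2d_pt P x y -> continuity_2d_pt Q x y ->
  diff2 f x y (P x y) (Q x y).
Proof.
  intros [d0 Hd] HP HQ eps.
  assert (He2 : 0 < eps / 2) by (destruct eps; simpl; lra).
  destruct (HP (mkposreal _ He2)) as [d1 H1].
  destruct (HQ (mkposreal _ He2)) as [d2 H2].
  simpl in H1, H2.
  assert (Hm : 0 < Rmin d0 (Rmin d1 d2)).
  { destruct d0, d1, d2; simpl. repeat apply Rmin_glb_lt; assumption. }
  exists (mkposreal _ Hm). simpl. intros u v Hu Hv.
  assert (Hu0 := Rlt_le_trans _ _ _ Hu (Rmin_l _ _)).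
  assert (Hu1 := Rlt_le_trans _ _ _ Hu (Rle_trans _ _ _ (Rmin_r _ _) (Rmin_l _ _))).
  assert (Hu2 := Rlt_le_trans _ _ _ Hu (Rle_trans _ _ _ (Rmin_r _ _) (Rmin_r _ _))).
  assert (Hv0 := Rlt_le_trans _ _ _ Hv (Rmin_l _ _)).
  assert (Hv1 := Rlt_le_trans _ _ _ Hv (Rle_trans _ _ _ (Rmin_r _ _) (Rmin_l _ _))).
  assert (Hv2 := Rlt_le_trans _ _ _ Hv (Rle_trans _ _ _ (Rmin_r _ _) (Rmin_r _ _))).
  assert (Hbt : forall a b t, Rmin a b <= t <= Rmax a b -> Rabs (t - a) <= Rabs (b - a)).
  { intros a b t. unfold Rmin, Rmax. destruct (Rle_dec a b); intros.
    - rewrite !Rabs_pos_eq by lra. lra.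
    - rewrite !Rabs_left1 by lra. lra. }
  assert (A : Rabs ((f u y - P x y * u) - (f x y - P x y * x)) <= eps / 2 * Rabs (u - x)).
  { apply (mvt_abs (fun s => f s y - P x y * s) (fun s => P s y - P x y)).
    - intros t Ht. apply (is_derive_minus (fun s => f s y) (fun s => P x y * s)).
      + apply Hd. specialize (Hbt _ _ _ Ht). lra.
        rewrite Rminus_diag, Rabs_R0. apply cond_pos.
      + auto_derive; [exact I | ring].
    - intros t Ht. apply Rlt_le, H1. specialize (Hbt _ _ _ Ht). lra.
      rewrite Rminus_diag, Rabs_R0. apply cond_pos. }
  assert (B : Rabs ((f u v - Q x y * v) - (f u y - Q x y * y)) <= eps / 2 * Rabs (v - y)).
  { apply (mvt_abs (fun s => f u s - Q x y * s) (fun s => Q u s - Q x y)).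
    - intros t Ht. apply (is_derive_minus (fun s => f u s) (fun s => Q x y * s)).
      + apply Hd. assumption. specialize (Hbt _ _ _ Ht). lra.
      + auto_derive; [exact I | ring].
    - intros t Ht. apply Rlt_le, H2. assumption. specialize (Hbt _ _ _ Ht). lra. }
  replace (f u v - f x y - (P x y * (u - x) + Q x y * (v - y))) with
    ((f u y - P x y * u - (f x y - P x y * x)) + (f u v - Q x y * v - (f u y - Q x y * y))) by ring.
  eapply Rle_trans; [apply Rabs_triang|].
  assert (Rabs (u - x) <= Rmax (Rabs (u - x)) (Rabs (v - y))) by apply Rmax_l.
  assert (Rabs (v - y) <= Rmax (Rabs (u - x)) (Rabs (v - y))) by apply Rmax_r.
  nra.
Qed.

(** Sequential compactness of a square, phrased without sequences. *)
Lemma cluster_point (B : R) (P : nat -> R -> R -> Prop) :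
  (forall n m x y, (n <= m)%nat -> P m x y -> P n x y) ->
  (forall n, exists x y, Rabs x <= B /\ Rabs y <= B /\ P n x y) ->
  exists x y, Rabs x <= B /\ Rabs y <= B /\
    forall n (eps : posreal), exists x' y',
      Rabs (x' - x) < eps /\ Rabs (y' - y) < eps /\ P n x' y'.
Proof.
  intros Hdec Hex. apply NNPP. intro Hno.
  (* The bound [INR n * d <= 1] ties the index to the radius: the uniform lower bound that
     compactness gives on the radii becomes an upper bound on the indices, and [P] is decreasing in
     the index. *)
  assert (Hloc : forall x y, exists d : posreal, Rabs x <= B -> Rabs y <= B ->
     exists n, INR n * d <= 1 /\ forall x' y', Rabs (x' - x) < d -> Rabs (y' - y) < d -> ~ P n x' y').
  { intros x y. destruct (classic (Rabs x <= B /\ Rabs y <= B)) as [[Hx Hy]|H].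
    2:{ exists (mkposreal 1 Rlt_0_1). intros; tauto. }
    apply NNPP. intro Hc. apply Hno. exists x, y. repeat split; auto.
    intros n eps. apply NNPP. intro Hn. apply Hc.
    assert (Hp : 0 < Rmin eps (/ (INR n + 1))).
    { apply Rmin_glb_lt. apply cond_pos. apply Rinv_0_lt_compat. assert (H := pos_INR n). lra. }
    exists (mkposreal _ Hp). intros _ _. exists n. split.
    - simpl. assert (H := pos_INR n).
      apply Rle_trans with (INR n * / (INR n + 1)).
      + apply Rmult_le_compat_l; auto. apply Rmin_r.
      + apply Rmult_le_reg_r with (INR n + 1); [lra|]. field_simplify; lra.
    - simpl. intros x' y' H1 H2 HP. apply Hn. exists x', y'.
      repeat split; auto; eapply Rlt_le_trans; eauto; apply Rmin_l. }
  pose (delta x y := proj1_sig (constructive_indefinite_description _ (Hloc x y))).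
  assert (Hdelta : forall x y, Rabs x <= B -> Rabs y <= B -> exists n, INR n * delta x y <= 1 /\
    forall x' y', Rabs (x' - x) < delta x y -> Rabs (y' - y) < delta x y -> ~ P n x' y').
  { intros x y. unfold delta. apply (proj2_sig (constructive_indefinite_description _ (Hloc x y))). }
  destruct (compactness_value_2d (- B) B (- B) B delta) as [d Hd].
  destruct (archimed_cor1 d (cond_pos d)) as [N [HN HN0]].
  destruct (Hex N) as [x [y [Hx [Hy HP]]]].
  assert (Hb : forall z, Rabs z <= B <-> - B <= z <= B).
  { intro z. split; intro. apply Rabs_le_between; auto. apply Rabs_le_between; auto. }
  apply (Hd x y); try (now apply Hb). intros [u [v [Hu [Hv [Hxu [Hyv Hduv]]]]]].
  destruct (Hdelta u v) as [n [Hn HnP]]; try (now apply Hb).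
  apply (HnP x y); auto.
  apply (Hdec n N); auto.
  apply INR_le. assert (0 < d) by apply cond_pos. assert (0 < INR N) by now apply lt_0_INR.
  assert (1 < d * INR N).
  { apply Rmult_lt_reg_r with (/ INR N). now apply Rinv_0_lt_compat. rewrite Rmult_assoc, Rinv_r; lra. }
  apply Rmult_le_reg_r with (delta u v). lra. nra.
Qed.

Lemma compact_min (K : R -> R -> Prop) (g : R -> R -> R) (B : R) :
  (exists x y, K x y) ->
  (forall x y, K x y -> Rabs x <= B /\ Rabs y <= B) ->
  (forall x y, ~ K x y -> locally_2d (fun u v => ~ K u v) x y) ->
  (forall x y, K x y -> continuity_2d_pt g x y) ->
  exists x y, K x y /\ forall x' y', K x' y' -> g x y <= g x' y'.
Proof.
  intros [a [b Hab]] HB Hcl Hc.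
  pose (E := fun t => exists x y, K x y /\ t = g x y).
  assert (Hinv : forall n, 0 < / (INR n + 1)).
  { intro n. apply Rinv_0_lt_compat. assert (H := pos_INR n). lra. }
  (* Near-minimizers are collected without knowing that [g] is bounded below; the second alternative
     covers the unbounded case, and continuity at the cluster point rules it out. *)
  destruct (cluster_point B (fun n x y => K x y /\
       ((forall x' y', K x' y' -> g x y <= g x' y' + / (INR n + 1)) \/ g x y <= - INR n)))
    as [x [y [Hx [Hy HP]]]].
  - intros n m x y Hnm [HK H]. split; auto. apply le_INR in Hnm.
    assert (H0 := pos_INR n). destruct H as [H|H].
    + left. intros x' y' H'. specialize (H x' y' H').
      assert (/ (INR m + 1) <= / (INR n + 1)) by (apply Rinv_le_contravar; lra). lra.
    + right. lra.
  - intro n. destruct (classic (exists x y, K x y /\ g x y <= - INR n)) as [[x [y [H1 H2]]]|Hn].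
    + exists x, y. destruct (HB x y H1). tauto.
    + destruct (completeness (fun t => E (- t))) as [M [HM1 HM2]].
      * exists (INR n). intros t [x [y [H1 H2]]]. apply Rnot_lt_le. intro Ht.
        apply Hn. exists x, y. split; auto. lra.
      * exists (- g a b). exists a, b. split; auto. ring.
      * assert (Hnot : ~ is_upper_bound (fun t => E (- t)) (M - / (INR n + 1))).
        { intro H. specialize (HM2 _ H). specialize (Hinv n). lra. }
        assert (exists x y, K x y /\ M - / (INR n + 1) < - g x y) as [x [y [H1 H2]]].
        { apply NNPP. intro H. apply Hnot. intros t [x [y [H1 H2]]]. apply Rnot_lt_le. intro Ht.
          apply H. exists x, y. split; auto. lra. }
        exists x, y. destruct (HB x y H1). repeat split; auto. left. intros x' y' H'.
        assert (- g x' y' <= M). { apply HM1. exists x', y'. split; auto. ring. }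
        lra.
  - assert (HK : K x y).
    { apply NNPP. intro H. destruct (Hcl x y H) as [d Hd].
      destruct (HP 0%nat d) as [x' [y' [H1 [H2 [H3 _]]]]]. exact (Hd x' y' H1 H2 H3). }
    exists x, y. split; auto. intros x' y' H'.
    apply le_epsilon. intros eps He.
    assert (He2 : 0 < eps / 2) by lra.
    destruct (Hc x y HK (mkposreal _ He2)) as [d Hd]. simpl in Hd.
    destruct (nfloor_ex (Rabs (g x y) + eps + 2 / eps)) as [n [_ Hn]].
    { assert (0 <= Rabs (g x y)) by apply Rabs_pos.
      assert (0 < 2 / eps) by (apply Rdiv_lt_0_compat; lra). lra. }
    destruct (HP (S n) d) as [p [q [H1 [H2 [H3 H4]]]]].
    rewrite S_INR in H4.
    specialize (Hd p q H1 H2). apply Rabs_lt_between in Hd.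
    assert (0 < 2 / eps) by (apply Rdiv_lt_0_compat; lra).
    assert (0 <= Rabs (g x y)) by apply Rabs_pos.
    assert (- g x y <= Rabs (g x y)) by (rewrite <- Rabs_Ropp; apply Rle_abs).
    destruct H4 as [H4|H4].
    + specialize (H4 x' y' H').
      assert (/ (INR n + 1 + 1) <= / (2 / eps)) by (apply Rinv_le_contravar; lra).
      replace (/ (2 / eps)) with (eps / 2) in H6 by (field; lra). lra.
    + lra.
Qed.

(** * Polar coordinates and potentials on the punctured plane *)

Lemma nrm_ge0 (x y : R) : 0 <= nrm x y.
Proof. apply sqrt_pos. Qed.

Lemma nrm_sqr (x y : R) : nrm x y ^ 2 = x ^ 2 + y ^ 2.
Proof. apply pow2_sqrt. nra. Qed.

Lemma nz_nrm (x y : R) : nz x y <-> 0 < nrm x y.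
Proof.
  unfold nz. rewrite <- nrm_sqr. assert (H := nrm_ge0 x y). split; nra.
Qed.

Lemma nrm_abs_l (x y : R) : Rabs x <= nrm x y.
Proof.
  rewrite <- (Rabs_pos_eq (nrm x y)) by apply nrm_ge0.
  apply Rsqr_le_abs_0.
  unfold Rsqr. assert (H := nrm_sqr x y). nra.
Qed.

Lemma nrm_abs_r (x y : R) : Rabs y <= nrm x y.
Proof.
  rewrite <- (Rabs_pos_eq (nrm x y)) by apply nrm_ge0.
  apply Rsqr_le_abs_0.
  unfold Rsqr. assert (H := nrm_sqr x y). nra.
Qed.

Lemma nrm_le_sum (x y : R) : nrm x y <= Rabs x + Rabs y.
Proof.
  rewrite <- (sqrt_pow2 (Rabs x + Rabs y)).
  - apply sqrt_le_1_alt. rewrite <- (pow2_abs x), <- (pow2_abs y).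
    assert (H := Rabs_pos x). assert (H' := Rabs_pos y). nra.
  - assert (H := Rabs_pos x). assert (H' := Rabs_pos y). lra.
Qed.

Lemma nrm_triangle (x y a b : R) : nrm (x + a) (y + b) <= nrm x y + nrm a b.
Proof.
  assert (H1 := nrm_ge0 x y). assert (H2 := nrm_ge0 a b).
  assert (H3 := nrm_ge0 (x + a) (y + b)).
  assert (E1 := nrm_sqr x y). assert (E2 := nrm_sqr a b).
  assert (E3 := nrm_sqr (x + a) (y + b)).
  apply Rsqr_incr_0; try lra. unfold Rsqr.
  assert (x * a + y * b <= nrm x y * nrm a b).
  { apply Rle_trans with (Rabs (x * a + y * b)); [apply Rle_abs|].
    rewrite <- (Rabs_pos_eq (nrm x y * nrm a b)) by nra.
    apply Rsqr_le_abs_0. unfold Rsqr.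
    replace (nrm x y * nrm a b * (nrm x y * nrm a b)) with (nrm x y ^ 2 * nrm a b ^ 2) by ring.
    rewrite E1, E2. assert (0 <= (x * b - y * a) ^ 2) by apply pow2_ge_0. nra. }
  nra.
Qed.

Lemma nrm_near (x y a b : R) : Rabs (nrm a b - nrm x y) <= Rabs (a - x) + Rabs (b - y).
Proof.
  assert (H1 := nrm_triangle x y (a - x) (b - y)).
  assert (H2 := nrm_triangle a b (x - a) (y - b)).
  replace (x + (a - x)) with a in H1 by ring. replace (y + (b - y)) with b in H1 by ring.
  replace (a + (x - a)) with x in H2 by ring. replace (b + (y - b)) with y in H2 by ring.
  assert (H3 := nrm_le_sum (a - x) (b - y)).
  assert (H4 := nrm_le_sum (x - a) (y - b)).
  rewrite (Rabs_minus_sym x a), (Rabs_minus_sym y b) in H4.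
  apply Rabs_le. lra.
Qed.

Lemma nrm_continuity (x y : R) : continuity_2d_pt nrm x y.
Proof.
  intros eps. assert (He : 0 < eps / 2) by (destruct eps; simpl; lra).
  exists (mkposreal _ He). simpl. intros u v Hu Hv.
  assert (H := nrm_near x y u v). lra.
Qed.

Lemma nrm_polar (r t : R) : 0 <= r -> nrm (r * cos t) (r * sin t) = r.
Proof.
  intro Hr. rewrite <- (sqrt_pow2 r Hr). unfold nrm. f_equal.
  rewrite (sqrt_pow2 r Hr).
  assert (H := sin2_cos2 t). unfold Rsqr in H. nra.
Qed.

Lemma nrm_zero_r (x : R) : nrm x 0 = Rabs x.
Proof.
  unfold nrm. rewrite <- (sqrt_Rsqr_abs x). f_equal. unfold Rsqr. ring.
Qed.

(** Using [Rabs y] keeps the angle in [[0, PI]]. Two points with the same ordinate thus get angles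
    in one half circle, and their difference is at most [PI]. *)
Lemma polar_upper (x y : R) :
  nz x y -> exists t, 0 <= t <= PI /\ x = nrm x y * cos t /\ Rabs y = nrm x y * sin t.
Proof.
  intro H. assert (Hn := proj1 (nz_nrm x y) H).
  assert (E := nrm_sqr x y). assert (Hx := nrm_abs_l x y).
  apply Rabs_le_between in Hx.
  assert (Hq : -1 <= x / nrm x y <= 1).
  { split; apply Rmult_le_reg_r with (nrm x y); auto; unfold Rdiv;
      rewrite Rmult_assoc, Rinv_l by lra; lra. }
  exists (acos (x / nrm x y)). split; [apply acos_bound|]. split.
  - rewrite cos_acos by auto. field. lra.
  - rewrite sin_acos by auto.
    rewrite <- (sqrt_pow2 (nrm x y)) at 1 by lra.
    rewrite <- sqrt_mult_alt by nra. rewrite <- (sqrt_Rsqr_abs y). f_equal.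
    unfold Rsqr, Rdiv. transitivity (nrm x y ^ 2 - x ^ 2). nra. field. lra.
Qed.

Lemma polar (x y : R) :
  nz x y -> exists t, - PI <= t <= PI /\ x = nrm x y * cos t /\ y = nrm x y * sin t.
Proof.
  intro H. destruct (polar_upper x y H) as [t [Ht [Hx Hy]]].
  destruct (Rle_dec 0 y) as [H0|H0].
  - exists t. rewrite Rabs_pos_eq in Hy by lra. repeat split; auto; lra.
  - exists (- t). rewrite cos_neg, sin_neg. rewrite Rabs_left in Hy by lra.
    repeat split; auto; lra.
Qed.

Lemma nz_polar (r t : R) : 0 < r -> nz (r * cos t) (r * sin t).
Proof. intro H. apply nz_nrm. rewrite nrm_polar; lra. Qed.

Lemma nz_locally (x y : R) : nz x y -> locally_2d nz x y.
Proof.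
  intro H. apply nz_nrm in H.
  assert (He : 0 < nrm x y / 2) by lra.
  exists (mkposreal _ He). simpl. intros u v Hu Hv. apply nz_nrm.
  assert (H1 := nrm_near x y u v). apply Rabs_le_between in H1. lra.
Qed.

Lemma is_derive_cos_scal (r t : R) : is_derive (fun s => r * cos s) t (- (r * sin t)).
Proof. auto_derive; [exact I | ring]. Qed.

Lemma is_derive_sin_scal (r t : R) : is_derive (fun s => r * sin s) t (r * cos t).
Proof. auto_derive; [exact I | ring]. Qed.

Lemma is_derive_arc (f : R -> R -> R) (r t a b : R) :
  diff2 f (r * cos t) (r * sin t) a b ->
  is_derive (fun s => f (r * cos s) (r * sin s)) t (r * cos t * b - r * sin t * a).
Proof.
  intro H.
  replace (r * cos t * b - r * sin t * a) with (a * (- (r * sin t)) + b * (r * cos t)) by ring.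
  apply is_derive_path; auto. apply is_derive_cos_scal. apply is_derive_sin_scal.
Qed.

(** Every point of this set is reached from [(0, c)] by a horizontal then a
    vertical segment that avoid the origin. *)
Definition slit (c x y : R) : Prop := x <> 0 \/ 0 < c * y.

Lemma slit_nz (c x y : R) : slit c x y -> nz x y.
Proof. unfold nz. intros [H|H]; [assert (0 < x * x) by nra|assert (y <> 0) by nra]; nra. Qed.

Lemma slit_segment (c x y t : R) :
  c <> 0 -> slit c x y -> Rmin c y <= t <= Rmax c y -> slit c x t.
Proof.
  intros Hc [H|H] Ht; [now left|right].
  revert Ht. unfold Rmin, Rmax. destruct (Rle_dec c y); nra.
Qed.

Lemma slit_locally (c x y : R) : slit c x y -> locally_2d (slit c) x y.
Proof.
  intros [H|H].
  - assert (He : 0 < Rabs x) by now apply Rabs_pos_lt.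
    exists (mkposreal _ He). simpl. intros u v Hu Hv. left. intros ->.
    replace (0 - x) with (- x) in Hu by ring. rewrite Rabs_Ropp in Hu. lra.
  - assert (He : 0 < Rabs y) by (apply Rabs_pos_lt; nra).
    exists (mkposreal _ He). simpl. intros u v Hu Hv. right.
    assert (y <> 0) by nra. destruct (Rlt_dec 0 y).
    + rewrite (Rabs_pos_eq y) in Hv by lra. apply Rabs_lt_between in Hv. nra.
    + rewrite (Rabs_left y) in Hv by lra. apply Rabs_lt_between in Hv. nra.
Qed.

(** Integrate [P] along the height [c], then [Q] vertically. Differentiating the second integral
    under the integral sign in [x] produces the integral of [D], the common mixed derivative, that
    is [P x y - P x c]. *)
Lemma slit_potential (P Q D : R -> R -> R) (c : R) :
  c <> 0 ->
  (forall x y, nz x y -> is_derive (fun t => P x t) y (D x y)) ->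
  (forall x y, nz x y -> is_derive (fun s => Q s y) x (D x y)) ->
  (forall x y, nz x y -> continuity_2d_pt P x y) ->
  (forall x y, nz x y -> continuity_2d_pt Q x y) ->
  (forall x y, nz x y -> continuity_2d_pt D x y) ->
  exists h, forall x y, slit c x y -> diff2 h x y (P x y) (Q x y).
Proof.
  intros Hc HPy HQx cP cQ cD.
  assert (cPh : forall x y, nz x y -> continuous (fun s => P s y) x).
  { intros x y H. apply (continuous_path P (fun s => s) (fun _ => y)); auto.
    apply continuous_id. apply continuous_const. }
  assert (cQv : forall x y, nz x y -> continuous (fun s => Q x s) y).
  { intros x y H. apply (continuous_path Q (fun _ => x) (fun s => s)); auto.
    apply continuous_const. apply continuous_id. }
  assert (cDv : forall x y, nz x y -> continuous (fun s => D x s) y).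
  { intros x y H. apply (continuous_path D (fun _ => x) (fun s => s)); auto.
    apply continuous_const. apply continuous_id. }
  assert (Hhor : forall x, nz x c) by (intro x; unfold nz; nra).
  assert (Hint : forall x y, slit c x y -> ex_RInt (fun t => Q x t) c y).
  { intros x y H. apply (ex_RInt_continuous (fun t => Q x t)). intros z Hz.
    apply cQv. apply (slit_nz c). now apply (slit_segment c x y). }
  exists (fun x y => RInt (fun t => P t c) 0 x + RInt (fun t => Q x t) c y).
  intros x y H.
  apply diff2_of_partials; [|apply cP|apply cQ]; try now apply (slit_nz c).
  apply locally_2d_impl with (2 := slit_locally c x y H).
  apply locally_2d_forall. clear x y H. intros x y H. split.
  - assert (E : RInt (fun t => Derive (fun z => Q z t) x) c y = P x y - P x c).
    { rewrite (RInt_ext _ (fun t => D x t)).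
      - apply is_RInt_unique. apply (is_RInt_derive (fun t => P x t) (fun t => D x t)).
        + intros t Ht. apply HPy. apply (slit_nz c). now apply (slit_segment c x y).
        + intros t Ht. apply cDv. apply (slit_nz c). now apply (slit_segment c x y).
      - intros t Ht. apply is_derive_unique. apply HQx. apply (slit_nz c).
        apply (slit_segment c x y); auto. lra. }
    replace (P x y) with (P x c + RInt (fun t => Derive (fun z => Q z t) x) c y) by (rewrite E; ring).
    apply (is_derive_plus (fun s => RInt (fun t => P t c) 0 s) (fun s => RInt (fun t => Q s t) c y)).
    + apply (is_derive_RInt (fun t => P t c) (fun s => RInt (fun t => P t c) 0 s) 0).
      * apply filter_forall. intro b. apply (RInt_correct (fun t => P t c)).
        apply (ex_RInt_continuous (fun t => P t c)). intros z _. now apply cPh.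
      * now apply cPh.
    + destruct (slit_locally c x y H) as [d Hd].
      assert (Hl : locally x (fun x' => slit c x' y)).
      { exists d. intros x' Hx'. apply Hd; auto. rewrite Rminus_diag, Rabs_R0. apply cond_pos. }
      apply (is_derive_RInt_param (fun s t => Q s t) c y x).
      * revert Hl. apply filter_imp. intros x' Hx' t Ht. exists (D x' t).
        apply HQx. apply (slit_nz c). now apply (slit_segment c x' y).
      * intros t Ht. assert (Hs : nz x t) by (apply (slit_nz c); now apply (slit_segment c x y)).
        apply continuity_2d_pt_ext_loc with D; [|now apply cD].
        apply locally_2d_impl with (2 := nz_locally _ _ Hs).
        apply locally_2d_forall. intros u v Huv. symmetry. now apply is_derive_unique, HQx.
      * revert Hl. apply filter_imp. intros x' Hx'. now apply Hint.
  - replace (Q x y) with (0 + Q x y) by ring.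
    apply (is_derive_plus (fun _ => RInt (fun t => P t c) 0 x) (fun s => RInt (fun t => Q x t) c s)).
    + apply @is_derive_const.
    + apply (is_derive_RInt (fun t => Q x t) (fun s => RInt (fun t => Q x t) c s) c).
      * destruct (slit_locally c x y H) as [d Hd].
        exists d. intros y' Hy'. apply (RInt_correct (fun t => Q x t)). apply Hint. apply Hd; auto.
        rewrite Rminus_diag, Rabs_R0. apply cond_pos.
      * apply cQv. now apply (slit_nz c).
Qed.

Lemma zero_gradient_segment (f : R -> R -> R) (x y a b : R) :
  (forall s, 0 <= s <= 1 -> diff2 f (x + s * (a - x)) (y + s * (b - y)) 0 0) ->
  f a b = f x y.
Proof.
  intro H.
  assert (E := derive_zero_const (fun s => f (x + s * (a - x)) (y + s * (b - y))) 0 1).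
  cbv beta in E.
  replace (x + 1 * (a - x)) with a in E by ring. replace (y + 1 * (b - y)) with b in E by ring.
  replace (x + 0 * (a - x)) with x in E by ring. replace (y + 0 * (b - y)) with y in E by ring.
  apply E. rewrite Rmin_left, Rmax_right by lra. intros s Hs.
  replace 0 with (0 * (a - x) + 0 * (b - y)) by ring.
  apply (is_derive_path f (fun s => x + s * (a - x)) (fun s => y + s * (b - y))); auto.
  - auto_derive; [exact I | ring].
  - auto_derive; [exact I | ring].
Qed.

Lemma diff2_minus (f g : R -> R -> R) (x y a b c d : R) :
  diff2 f x y a b -> diff2 g x y c d ->
  diff2 (fun u v => f u v - g u v) x y (a - c) (b - d).
Proof.
  intros Hf Hg. apply filterdiff_differentiable_pt_lim.
  apply filterdiff_differentiable_pt_lim in Hf. apply filterdiff_differentiable_pt_lim in Hg.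
  assert (H := filterdiff_minus_fct _ _ _ _ Hf Hg).
  eapply filterdiff_ext_lin; [exact H|].
  intros [p q]. unfold minus, plus, opp. simpl. ring.
Qed.

Lemma diff2_shift (f : R -> R -> R) (x y a b k : R) :
  diff2 f x y a b -> diff2 (fun u v => f u v + k) x y a b.
Proof.
  intros H eps. destruct (H eps) as [d Hd]. exists d. intros u v Hu Hv.
  replace (f u v + k - (f x y + k)) with (f u v - f x y) by ring. now apply Hd.
Qed.

Definition circulation (P Q : R -> R -> R) (r : R) : R :=
  RInt (fun t => r * cos t * Q (r * cos t) (r * sin t) -
                 r * sin t * P (r * cos t) (r * sin t)) 0 (2 * PI).

Lemma potential_arc (h P Q : R -> R -> R) (r a b : R) :
  (forall t, Rmin a b <= t <= Rmax a b ->
     diff2 h (r * cos t) (r * sin t) (P (r * cos t) (r * sin t)) (Q (r * cos t) (r * sin t)) /\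
     continuity_2d_pt P (r * cos t) (r * sin t) /\ continuity_2d_pt Q (r * cos t) (r * sin t)) ->
  is_RInt (fun t => r * cos t * Q (r * cos t) (r * sin t) -
                    r * sin t * P (r * cos t) (r * sin t)) a b
    (h (r * cos b) (r * sin b) - h (r * cos a) (r * sin a)).
Proof.
  intro H.
  assert (Cc : forall t, continuous (fun s => r * cos s) t).
  { intro t. apply (ex_derive_continuous (fun s => r * cos s)). eexists. apply is_derive_cos_scal. }
  assert (Cs : forall t, continuous (fun s => r * sin s) t).
  { intro t. apply (ex_derive_continuous (fun s => r * sin s)). eexists. apply is_derive_sin_scal. }
  apply (is_RInt_derive (fun t => h (r * cos t) (r * sin t))).
  - intros t Ht. apply is_derive_arc. now apply H.
  - intros t Ht. destruct (H t Ht) as [_ [HP HQ]].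
    apply (continuous_minus (fun s => r * cos s * Q (r * cos s) (r * sin s))
                            (fun s => r * sin s * P (r * cos s) (r * sin s))).
    + apply (continuous_mult (fun s => r * cos s)); auto.
      now apply (continuous_path Q (fun s => r * cos s) (fun s => r * sin s)).
    + apply (continuous_mult (fun s => r * sin s)); auto.
      now apply (continuous_path P (fun s => r * cos s) (fun s => r * sin s)).
Qed.

(** The slit planes for [c = 1] and [c = -1] cover the punctured plane and overlap where [x <> 0].
    On each half of the overlap the two potentials differ by a constant. The circulation is the
    difference of these constants, whatever the radius; small circulations thus force it to be zero,
    and the potentials glue after a shift. *)
Lemma potential (P Q D : R -> R -> R) :
  (forall x y, nz x y -> is_derive (fun t => P x t) y (D x y)) ->
  (forall x y, nz x y -> is_derive (fun s => Q s y) x (D x y)) ->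
  (forall x y, nz x y -> continuity_2d_pt P x y) ->
  (forall x y, nz x y -> continuity_2d_pt Q x y) ->
  (forall x y, nz x y -> continuity_2d_pt D x y) ->
  (forall eps, 0 < eps -> exists r, 0 < r /\ Rabs (circulation P Q r) <= eps) ->
  exists h, forall x y, nz x y -> diff2 h x y (P x y) (Q x y).
Proof.
  intros HPy HQx cP cQ cD Hcirc.
  assert (N1 : 1 <> 0) by lra. assert (N2 : -1 <> 0) by lra.
  destruct (slit_potential P Q D 1 N1 HPy HQx cP cQ cD) as [hp Hp].
  destruct (slit_potential P Q D (-1) N2 HPy HQx cP cQ cD) as [hm Hm].
  pose (k := fun x y => hp x y - hm x y).
  assert (Hk : forall x y, x <> 0 -> diff2 k x y 0 0).
  { intros x y H. rewrite <- (Rminus_diag (P x y)) at 1. rewrite <- (Rminus_diag (Q x y)).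
    apply diff2_minus; [apply Hp | apply Hm]; now left. }
  assert (Hkc : forall s x y, 0 < s * x -> s <> 0 -> k x y = k s 0).
  { intros s x y H Hs. apply zero_gradient_segment. intros t Ht. apply Hk.
    intro E. assert (0 < s * s) by nra.
    assert (s * (s + t * (x - s)) = 0) by (rewrite E; ring).
    replace (s * (s + t * (x - s))) with ((1 - t) * (s * s) + t * (s * x)) in H1 by ring.
    destruct (Req_dec t 0) as [->|]; nra. }
  assert (PI0 := PI_RGT_0).
  assert (Hr : forall r, 0 < r -> circulation P Q r = k (-1) 0 - k 1 0).
  { intros r Hr0. unfold circulation. apply is_RInt_unique.
    (* The upper half circle lies in the domain of [hp] and the lower one in that of [hm]. *)
    replace (k (-1) 0 - k 1 0) with
      (plus (hp (r * cos PI) (r * sin PI) - hp (r * cos 0) (r * sin 0))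
            (hm (r * cos (2 * PI)) (r * sin (2 * PI)) - hm (r * cos PI) (r * sin PI))).
    - apply (is_RInt_Chasles (V := R_NormedModule)) with PI; apply potential_arc; intros t Ht;
        assert (Hn := nz_polar r t Hr0); repeat split; auto.
      + apply Hp. rewrite Rmin_left, Rmax_right in Ht by lra.
        destruct (Req_dec (cos t) 0) as [Hc|Hc]; [right|left; apply Rmult_integral_contrapositive_currified; [apply Rgt_not_eq; exact Hr0|exact Hc]].
        assert (0 <= sin t) by (apply sin_ge_0; lra). unfold nz in Hn. rewrite Hc in Hn.
        destruct (Req_dec (sin t) 0) as [Hs|Hs]; [rewrite Hs in Hn; lra|].
        assert (0 < r * sin t) by (apply Rmult_lt_0_compat; lra). lra.
      + apply Hm. rewrite Rmin_left, Rmax_right in Ht by lra.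
        destruct (Req_dec (cos t) 0) as [Hc|Hc]; [right|left; apply Rmult_integral_contrapositive_currified; [apply Rgt_not_eq; exact Hr0|exact Hc]].
        assert (sin t <= 0) by (apply sin_le_0; lra). unfold nz in Hn. rewrite Hc in Hn.
        destruct (Req_dec (sin t) 0) as [Hs|Hs]; [rewrite Hs in Hn; lra|].
        assert (0 < r * - sin t) by (apply Rmult_lt_0_compat; lra). lra.
    - rewrite cos_PI, sin_PI, cos_0, sin_0, cos_2PI, sin_2PI.
      replace (r * -1) with (-r) by ring. rewrite Rmult_1_r, Rmult_0_r.
      rewrite <- (Hkc (-1) (-r) 0), <- (Hkc 1 r 0) by lra.
      unfold k, plus. simpl. ring. }
  assert (E : k (-1) 0 = k 1 0).
  { apply Rminus_diag_uniq. apply Rabs_eq_0. apply Rle_antisym; [|apply Rabs_pos].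
    apply le_epsilon. intros eps He. destruct (Hcirc eps He) as [r [Hr0 Hr1]].
    rewrite (Hr r Hr0) in Hr1. lra. }
  pose (h := fun x y => if excluded_middle_informative (slit 1 x y) then hp x y else hm x y + k 1 0).
  assert (Hh : forall x y, slit (-1) x y -> h x y = hm x y + k 1 0).
  { intros x y Hs. unfold h. destruct (excluded_middle_informative (slit 1 x y)) as [H1|H1]; auto.
    assert (Hx : x <> 0) by (destruct Hs; [auto | destruct H1; [auto|lra]]).
    assert (k x y = k 1 0).
    { destruct (Rlt_dec 0 x). apply Hkc; lra. rewrite <- E. apply Hkc; lra. }
    unfold k in *. lra. }
  exists h. intros x y Hn. destruct (classic (slit 1 x y)) as [Hs|Hs].
  - apply differentiable_pt_lim_ext with hp; [|now apply Hp].
    apply locally_2d_impl with (2 := slit_locally _ _ _ Hs).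
    apply locally_2d_forall. intros u v Huv. unfold h.
    destruct (excluded_middle_informative (slit 1 u v)); tauto.
  - assert (Hs' : slit (-1) x y).
    { destruct (Req_dec x 0) as [->|]; [right|left; auto]. apply Rnot_le_lt. intro H.
      apply Hs. right. unfold nz in Hn. nra. }
    apply differentiable_pt_lim_ext with (fun u v => hm u v + k 1 0);
      [|now apply diff2_shift, Hm].
    apply locally_2d_impl with (2 := slit_locally _ _ _ Hs').
    apply locally_2d_forall. intros u v Huv. symmetry. now apply Hh.
Qed.

(** * Level sets of the stream function *)

Lemma is_derive_ge_right (f : R -> R) (x l c : R) :
  is_derive f x l ->
  (exists d, 0 < d /\ forall t, 0 < t < d -> c * t <= f (x + t) - f x) -> c <= l.
Proof.
  intros Hf [d [Hd H]]. apply is_derive_Reals in Hf.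
  apply le_epsilon. intros eps He.
  destruct (Hf eps He) as [[e He0] Hl]. simpl in Hl.
  assert (Hm : 0 < Rmin d e) by now apply Rmin_glb_lt.
  assert (H1 := Rmin_l d e). assert (H2 := Rmin_r d e).
  pose (t := Rmin d e / 2). assert (Ht : 0 < t < Rmin d e) by (unfold t; lra).
  assert (Hl' := Hl t). assert (Ha : t <> 0) by lra.
  specialize (Hl' Ha). rewrite Rabs_pos_eq in Hl' by lra.
  assert (Hte : t < e) by lra. specialize (Hl' Hte).
  apply Rabs_lt_between in Hl'.
  assert (Htd : 0 < t < d) by lra. specialize (H t Htd).
  assert (c <= (f (x + t) - f x) / t).
  { apply Rmult_le_reg_r with t; [lra|]. unfold Rdiv. rewrite Rmult_assoc, Rinv_l; lra. }
  lra.
Qed.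

Lemma is_derive_local_min (f : R -> R) (x l : R) :
  is_derive f x l -> locally x (fun t => f x <= f t) -> l = 0.
Proof.
  intros Hf [d Hd]. assert (Hp := cond_pos d).
  apply Rle_antisym.
  - assert (Hg : is_derive (fun t => f (2 * x - t)) x (- l)).
    { assert (Hf' : is_derive f (2 * x - x) l) by (replace (2 * x - x) with x by ring; exact Hf).
      replace (- l) with (scal (-1) l) by (unfold scal; simpl; unfold mult; simpl; ring).
      apply (is_derive_comp f (fun t => 2 * x - t)); auto.
      auto_derive; [exact I | ring]. }
    assert (0 <= - l); [|lra].
    apply (is_derive_ge_right _ x (- l) 0 Hg). exists d. split; auto. intros t Ht.
    replace (2 * x - x) with x by ring.
    assert (f x <= f (2 * x - (x + t))); [|lra]. apply Hd.
    change (Rabs (2 * x - (x + t) - x) < d).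
    replace (2 * x - (x + t) - x) with (- t) by ring.
    rewrite Rabs_Ropp, Rabs_pos_eq; lra.
  - apply (is_derive_ge_right f x l 0 Hf). exists d. split; auto. intros t Ht.
    assert (f x <= f (x + t)); [|lra]. apply Hd.
    change (Rabs (x + t - x) < d). replace (x + t - x) with t by ring. rewrite Rabs_pos_eq; lra.
Qed.

Lemma diff2_fst (f : R -> R -> R) (x y a b : R) :
  diff2 f x y a b -> is_derive (fun s => f s y) x a.
Proof.
  intro H. replace a with (a * 1 + b * 0) by ring.
  apply (is_derive_path f (fun s => s) (fun _ => y)); auto.
  apply @is_derive_id. apply @is_derive_const.
Qed.

Lemma diff2_snd (f : R -> R -> R) (x y a b : R) :
  diff2 f x y a b -> is_derive (fun s => f x s) y b.
Proof.
  intro H. replace b with (a * 0 + b * 1) by ring.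
  apply (is_derive_path f (fun _ => x) (fun s => s)); auto.
  apply @is_derive_const. apply @is_derive_id.
Qed.

Lemma diff2_local_min (f : R -> R -> R) (x y a b : R) :
  diff2 f x y a b -> locally_2d (fun u v => f x y <= f u v) x y -> a = 0 /\ b = 0.
Proof.
  intros H [d Hd]. split.
  - apply (is_derive_local_min (fun s => f s y) x); [now apply (diff2_fst f x y a b)|].
    exists d. intros t Ht. apply Hd; auto. rewrite Rminus_diag, Rabs_R0. apply cond_pos.
  - apply (is_derive_local_min (fun s => f x s) y); [now apply (diff2_snd f x y a b)|].
    exists d. intros t Ht. apply Hd; auto. rewrite Rminus_diag, Rabs_R0. apply cond_pos.
Qed.

Lemma diff2_opp (f : R -> R -> R) (x y a b : R) :
  diff2 f x y a b -> diff2 (fun u v => - f u v) x y (- a) (- b).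
Proof.
  intros H eps. destruct (H eps) as [d Hd]. exists d. intros u v Hu Hv.
  replace (- f u v - - f x y - (- a * (u - x) + - b * (v - y)))
    with (- (f u v - f x y - (a * (u - x) + b * (v - y)))) by ring.
  rewrite Rabs_Ropp. now apply Hd.
Qed.

(** The sign of [su] is normalized by [s_radial]; [su11 + su22] is the vorticity,
    and [s_transport] says that it is constant along streamlines. *)
Record stream : Type := Stream {
  su : R -> R -> R;
  su1 : R -> R -> R;
  su2 : R -> R -> R;
  su11 : R -> R -> R;
  su12 : R -> R -> R;
  su22 : R -> R -> R;
  sw1 : R -> R -> R;
  sw2 : R -> R -> R;
  s_diff : forall x y, nz x y -> diff2 su x y (su1 x y) (su2 x y);
  s_diff1 : forall x y, nz x y -> diff2 su1 x y (su11 x y) (su12 x y);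
  s_diff2 : forall x y, nz x y -> diff2 su2 x y (su12 x y) (su22 x y);
  s_diffw : forall x y, nz x y ->
    diff2 (fun a b => su11 a b + su22 a b) x y (sw1 x y) (sw2 x y);
  s_cont11 : forall x y, nz x y -> continuity_2d_pt su11 x y;
  s_cont12 : forall x y, nz x y -> continuity_2d_pt su12 x y;
  s_cont22 : forall x y, nz x y -> continuity_2d_pt su22 x y;
  s_contw1 : forall x y, nz x y -> continuity_2d_pt sw1 x y;
  s_contw2 : forall x y, nz x y -> continuity_2d_pt sw2 x y;
  s_transport : forall x y, nz x y -> su1 x y * sw2 x y = su2 x y * sw1 x y;
  s_nonstag : forall x y, nz x y -> su1 x y <> 0 \/ su2 x y <> 0;
  s_radial : exists eta R0, 0 < eta /\ 0 < R0 /\ forall x y, R0 <= nrm x y ->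
    eta * nrm x y <= x * su1 x y + y * su2 x y;
  s_tangential : forall eps, 0 < eps -> exists R0, 0 < R0 /\ forall x y, R0 <= nrm x y ->
    Rabs (x * su2 x y - y * su1 x y) <= eps;
  s_origin : forall eps d, 0 < eps -> 0 < d -> exists r, 0 < r < d /\
    forall x y x' y', nrm x y = r -> nrm x' y' = r -> Rabs (su x y - su x' y') <= eps
}.

Definition vort (s : stream) (x y : R) : R := su11 s x y + su22 s x y.

Definition annulus (r1 r2 x y : R) : Prop := r1 <= nrm x y <= r2.

Lemma annulus_closed (r1 r2 x y : R) :
  ~ annulus r1 r2 x y -> locally_2d (fun u v => ~ annulus r1 r2 u v) x y.
Proof.
  unfold annulus. intro H.
  assert (H' : nrm x y < r1 \/ r2 < nrm x y) by lra.
  destruct H' as [H'|H'].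
  - assert (He : 0 < r1 - nrm x y) by lra.
    destruct (nrm_continuity x y (mkposreal _ He)) as [d Hd]. exists d. simpl in Hd.
    intros u v Hu Hv. specialize (Hd u v Hu Hv). apply Rabs_lt_between in Hd. lra.
  - assert (He : 0 < nrm x y - r2) by lra.
    destruct (nrm_continuity x y (mkposreal _ He)) as [d Hd]. exists d. simpl in Hd.
    intros u v Hu Hv. specialize (Hd u v Hu Hv). apply Rabs_lt_between in Hd. lra.
Qed.

Lemma annulus_min (g : R -> R -> R) (r1 r2 : R) :
  0 < r1 <= r2 -> (forall x y, nz x y -> continuity_2d_pt g x y) ->
  exists x y, annulus r1 r2 x y /\ forall x' y', annulus r1 r2 x' y' -> g x y <= g x' y'.
Proof.
  intros Hr Hg. apply compact_min with r2.
  - exists r1, 0. unfold annulus. rewrite nrm_zero_r, Rabs_pos_eq; lra.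
  - intros x y [_ H]. assert (H1 := nrm_abs_l x y). assert (H2 := nrm_abs_r x y). lra.
  - apply annulus_closed.
  - intros x y [H _]. apply Hg, nz_nrm. lra.
Qed.

Lemma annulus_interior (r1 r2 x y : R) :
  r1 < nrm x y < r2 -> locally_2d (annulus r1 r2) x y.
Proof.
  intro H. assert (He : 0 < Rmin (nrm x y - r1) (r2 - nrm x y)) by (apply Rmin_glb_lt; lra).
  destruct (nrm_continuity x y (mkposreal _ He)) as [d Hd]. exists d. simpl in Hd.
  intros u v Hu Hv. specialize (Hd u v Hu Hv). apply Rabs_lt_between in Hd.
  assert (H1 := Rmin_l (nrm x y - r1) (r2 - nrm x y)).
  assert (H2 := Rmin_r (nrm x y - r1) (r2 - nrm x y)). unfold annulus. lra.
Qed.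

Lemma su_continuity (s : stream) (x y : R) : nz x y -> continuity_2d_pt (su s) x y.
Proof. intro H. eapply diff2_continuity. now apply s_diff. Qed.

Lemma vort_continuity (s : stream) (x y : R) : nz x y -> continuity_2d_pt (vort s) x y.
Proof. intro H. eapply diff2_continuity. now apply s_diffw. Qed.

Lemma su_no_local_min (s : stream) (x y : R) :
  nz x y -> ~ locally_2d (fun a b => su s x y <= su s a b) x y.
Proof.
  intros H Hm. destruct (diff2_local_min _ _ _ _ _ (s_diff s x y H) Hm).
  destruct (s_nonstag s x y H); auto.
Qed.

Lemma su_no_local_max (s : stream) (x y : R) :
  nz x y -> ~ locally_2d (fun a b => su s a b <= su s x y) x y.
Proof.
  intros H Hm. destruct (diff2_local_min _ _ _ _ _ (diff2_opp _ _ _ _ _ (s_diff s x y H))).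
  - revert Hm. apply locally_2d_impl. apply locally_2d_forall. intros; lra.
  - destruct (s_nonstag s x y H); lra.
Qed.

Lemma is_derive_ray (f : R -> R -> R) (r t a b : R) :
  diff2 f (r * cos t) (r * sin t) a b ->
  is_derive (fun q => f (q * cos t) (q * sin t)) r (a * cos t + b * sin t).
Proof.
  intro H. apply (is_derive_path f (fun q => q * cos t) (fun q => q * sin t)); auto.
  - auto_derive; [exact I | ring].
  - auto_derive; [exact I | ring].
Qed.

Lemma su_radial_growth (s : stream) :
  exists eta R0, 0 < eta /\ 0 < R0 /\ forall r r' t, R0 <= r <= r' ->
    eta * (r' - r) <= su s (r' * cos t) (r' * sin t) - su s (r * cos t) (r * sin t).
Proof.
  destruct (s_radial s) as [eta [R0 [He [HR H]]]]. exists eta, R0. repeat split; auto.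
  intros r r' t Hr.
  apply (mvt_ge (fun q => su s (q * cos t) (q * sin t))
    (fun q => su1 s (q * cos t) (q * sin t) * cos t + su2 s (q * cos t) (q * sin t) * sin t)); [lra| |].
  - intros q Hq. apply is_derive_ray. apply s_diff, nz_polar. lra.
  - intros q Hq. specialize (H (q * cos t) (q * sin t)). rewrite nrm_polar in H by lra.
    apply Rmult_le_reg_r with q; [lra|].
    eapply Rle_trans; [apply H; lra|]. lra.
Qed.

Lemma su_to_infinity (s : stream) (A : R) :
  exists R0, 0 < R0 /\ forall x y, R0 <= nrm x y -> A < su s x y.
Proof.
  destruct (su_radial_growth s) as [eta [R0 [He [HR H]]]].
  destruct (annulus_min (su s) R0 R0) as [a [b [_ Hm]]]; [lra|apply su_continuity|].
  exists (R0 + (Rabs (A - su s a b) + 1) / eta).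
  assert (Hp : 0 < (Rabs (A - su s a b) + 1) / eta).
  { apply Rdiv_lt_0_compat; auto. assert (Hq := Rabs_pos (A - su s a b)). lra. }
  split; [lra|]. intros x y Hxy.
  destruct (polar x y) as [t [_ [Hx Hy]]]; [apply nz_nrm; lra|].
  specialize (H R0 (nrm x y) t). rewrite <- Hx, <- Hy in H.
  assert (Hm' : su s a b <= su s (R0 * cos t) (R0 * sin t)).
  { apply Hm. unfold annulus. rewrite nrm_polar; lra. }
  assert (eta * ((Rabs (A - su s a b) + 1) / eta) <= eta * (nrm x y - R0)) by (apply Rmult_le_compat_l; lra).
  replace (eta * ((Rabs (A - su s a b) + 1) / eta)) with (Rabs (A - su s a b) + 1) in H0 by (field; lra).
  assert (Hq := Rle_abs (A - su s a b)). lra.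
Qed.

(** The minimum over an annulus cannot be interior, for lack of critical points, nor on a large
    outer circle, because [su] tends to infinity. It is therefore on the inner circle, and strict,
    as otherwise [(x, y)] would itself be an interior minimum. *)
Lemma su_smaller_inside (s : stream) (x y r : R) :
  0 < r < nrm x y -> exists a b, nrm a b = r /\ su s a b < su s x y.
Proof.
  intros Hr. destruct (su_to_infinity s (su s x y)) as [R0 [HR0 HR]].
  pose (R1 := Rmax R0 (nrm x y + 1)).
  assert (H1 : R0 <= R1) by apply Rmax_l. assert (H2 : nrm x y + 1 <= R1) by apply Rmax_r.
  destruct (annulus_min (su s) r R1) as [a [b [[Ha Hb] Hm]]]; [lra|apply su_continuity|].
  assert (Hle : su s a b <= su s x y) by (apply Hm; unfold annulus; lra).
  assert (Hint : forall c d, su s c d <= su s a b -> r < nrm c d < R1 -> False).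
  { intros c d Hcd H. apply (su_no_local_min s c d); [apply nz_nrm; lra|].
    apply locally_2d_impl with (2 := annulus_interior _ _ _ _ H).
    apply locally_2d_forall. intros u v Huv. specialize (Hm u v Huv). lra. }
  assert (Hb1 : nrm a b < R1).
  { apply Rnot_le_lt. intro H. specialize (HR a b). lra. }
  exists a, b. split.
  - apply Rle_antisym; auto. apply Rnot_lt_le. intro H. apply (Hint a b); lra.
  - apply Rnot_le_lt. intro H. apply (Hint x y); lra.
Qed.

(** The maximum over an annulus could sit on the inner circle. To exclude this, the inner circle is
    one of small oscillation given by [s_origin]: it contains a point below [su s p q], so all of it
    stays below [su s x y]. *)
Lemma su_larger_outside (s : stream) (x y r : R) :
  nz x y -> nrm x y < r -> exists a b, nrm a b = r /\ su s x y < su s a b.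
Proof.
  intros Hn Hr. apply nz_nrm in Hn.
  destruct (su_smaller_inside s x y (nrm x y / 2)) as [p [q [Hpq Hlt]]]; [lra|].
  destruct (s_origin s ((su s x y - su s p q) / 2) (nrm x y / 2)) as [e [He Hosc]]; [lra|lra|].
  destruct (su_smaller_inside s p q e) as [p' [q' [Hpq' Hlt']]]; [lra|].
  destruct (annulus_min (fun a b => - su s a b) e r) as [a [b [[Ha Hb] Hm]]]; [lra| |].
  { intros c d Hcd. now apply continuity_2d_pt_opp, su_continuity. }
  assert (Hle : su s x y <= su s a b).
  { assert (- su s a b <= - su s x y) by (apply Hm; unfold annulus; lra). lra. }
  assert (Hint : forall c d, su s a b <= su s c d -> e < nrm c d < r -> False).
  { intros c d Hcd H. apply (su_no_local_max s c d); [apply nz_nrm; lra|].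
    apply locally_2d_impl with (2 := annulus_interior _ _ _ _ H).
    apply locally_2d_forall. intros u v Huv. specialize (Hm u v Huv). simpl in Hm. lra. }
  assert (Ha1 : e < nrm a b).
  { apply Rnot_le_lt. intro H. assert (E : nrm a b = e) by lra.
    specialize (Hosc a b p' q' E Hpq'). apply Rabs_le_between in Hosc. lra. }
  exists a, b. split.
  - apply Rle_antisym; auto. apply Rnot_lt_le. intro H. apply (Hint a b); lra.
  - apply Rnot_le_lt. intro H. apply (Hint x y); lra.
Qed.

(** The bound holds on one circle of small oscillation, and [su_larger_outside] carries it to the
    punctured disc inside. No limit of [su] at the origin is involved. *)
Lemma su_near_origin (s : stream) (x y : R) :
  nz x y -> exists d c, 0 < d /\ 0 < c /\
    forall a b, nz a b -> nrm a b < d -> su s a b < su s x y - c.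
Proof.
  intros Hn. apply nz_nrm in Hn.
  destruct (su_smaller_inside s x y (nrm x y / 2)) as [p [q [Hpq Hlt]]]; [lra|].
  destruct (s_origin s ((su s x y - su s p q) / 2) (nrm x y / 2)) as [e [He Hosc]]; [lra|lra|].
  destruct (su_smaller_inside s p q e) as [p' [q' [Hpq' Hlt']]]; [lra|].
  exists e, ((su s x y - su s p q) / 2). repeat split; try lra.
  intros a b Hab Hlab. destruct (su_larger_outside s a b e Hab Hlab) as [a' [b' [E H]]].
  specialize (Hosc a' b' p' q' E Hpq'). apply Rabs_le_between in Hosc. lra.
Qed.

(** * The vorticity is a function of the stream function *)

Lemma is_derive_pos_part_sqr (y : R) :
  is_derive (fun a => Rmax 0 a ^ 2) y (2 * Rmax 0 y).
Proof.
  apply is_derive_Reals. intros eps He. exists (mkposreal _ He). simpl. intros h Hh0 Hh.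
  assert (Hb : Rabs (Rmax 0 (y + h) ^ 2 - Rmax 0 y ^ 2 - 2 * Rmax 0 y * h) <= h ^ 2).
  { apply Rabs_le. unfold Rmax.
    destruct (Rle_dec 0 (y + h)), (Rle_dec 0 y); nra. }
  replace ((Rmax 0 (y + h) * (Rmax 0 (y + h) * 1) - Rmax 0 y * (Rmax 0 y * 1)) / h - 2 * Rmax 0 y)
    with ((Rmax 0 (y + h) ^ 2 - Rmax 0 y ^ 2 - 2 * Rmax 0 y * h) / h) by (field; auto).
  unfold Rdiv. rewrite Rabs_mult, Rabs_inv.
  assert (0 < Rabs h) by now apply Rabs_pos_lt.
  apply Rle_lt_trans with (h ^ 2 * / Rabs h).
  - apply Rmult_le_compat_r; auto. apply Rlt_le, Rinv_0_lt_compat; auto.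
  - rewrite <- pow2_abs. simpl. rewrite Rmult_1_r, Rmult_assoc, Rinv_r; lra.
Qed.

(** Squaring the positive part makes this function of class C^1, which is what differentiating the
    form [vort * bump(su) d su] requires. It vanishes for [|a - t| >= d]. *)
Definition bump (t d a : R) : R := Rmax 0 (d ^ 2 - (a - t) ^ 2) ^ 2.

Definition bump' (t d a : R) : R := 2 * Rmax 0 (d ^ 2 - (a - t) ^ 2) * (- 2 * (a - t)).

Lemma is_derive_bump (t d a : R) : is_derive (bump t d) a (bump' t d a).
Proof.
  unfold bump, bump'.
  replace (2 * Rmax 0 (d ^ 2 - (a - t) ^ 2) * (-2 * (a - t))) with
    (scal (- 2 * (a - t)) (2 * Rmax 0 (d ^ 2 - (a - t) ^ 2)))
    by (unfold scal; simpl; unfold mult; simpl; ring).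
  apply (is_derive_comp (fun b => Rmax 0 b ^ 2) (fun a => d ^ 2 - (a - t) ^ 2)).
  - apply is_derive_pos_part_sqr.
  - auto_derive; [exact I | ring].
Qed.

Lemma bump_ge0 (t d a : R) : 0 <= bump t d a.
Proof. unfold bump. nra. Qed.

Lemma bump_out (t d a : R) : 0 <= d -> d <= Rabs (a - t) -> bump t d a = 0.
Proof.
  intros Hd Ha. unfold bump. rewrite Rmax_left; [ring|].
  rewrite <- (pow2_abs (a - t)). nra.
Qed.

Lemma bump_primitive (t d : R) :
  0 < d -> exists P, (forall a, is_derive P a (bump t d a)) /\ P (t - 2 * d) < P (t + 2 * d).
Proof.
  intro Hd. assert (Hc : forall a, continuous (bump t d) a).
  { intro a. apply (ex_derive_continuous (bump t d)). eexists. apply is_derive_bump. }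
  exists (fun a => RInt (bump t d) 0 a).
  assert (HP : forall a, is_derive (fun a => RInt (bump t d) 0 a) a (bump t d a)).
  { intro a. apply (is_derive_RInt (bump t d) (fun a => RInt (bump t d) 0 a) 0); auto.
    apply filter_forall. intro b. apply (RInt_correct (bump t d)).
    apply (ex_RInt_continuous (bump t d)). intros; apply Hc. }
  split; auto.
  pose (P := fun a => RInt (bump t d) 0 a). change (P (t - 2 * d) < P (t + 2 * d)).
  assert (H1 : 0 * (t - d / 2 - (t - 2 * d)) <= P (t - d / 2) - P (t - 2 * d)).
  { apply (mvt_ge P (bump t d)); [lra| |]; intros; auto. apply bump_ge0. }
  assert (H2 : 0 * (t + 2 * d - (t + d / 2)) <= P (t + 2 * d) - P (t + d / 2)).
  { apply (mvt_ge P (bump t d)); [lra| |]; intros; auto. apply bump_ge0. }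
  (* On the middle half [|a - t| <= d / 2] the positive part is at least [3 d^2 / 4]. *)
  assert (H3 : (d ^ 2 / 2) ^ 2 * (t + d / 2 - (t - d / 2)) <= P (t + d / 2) - P (t - d / 2)).
  { apply (mvt_ge P (bump t d)); [lra| |]; intros a Ha; auto. unfold bump.
    assert ((a - t) ^ 2 <= d ^ 2 / 4) by nra.
    assert (Hm := Rmax_r 0 (d ^ 2 - (a - t) ^ 2)).
    apply pow_incr. split; nra. }
  assert (0 < (d ^ 2 / 2) ^ 2 * d) by (apply Rmult_lt_0_compat; [apply pow_lt; nra|lra]).
  lra.
Qed.

Lemma locally_2d_ge_of_continuity (f : R -> R -> R) (x y c : R) :
  continuity_2d_pt f x y -> c < f x y -> locally_2d (fun a b => c < f a b) x y.
Proof.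
  intros Hf Hc. assert (He : 0 < f x y - c) by lra.
  destruct (Hf (mkposreal _ He)) as [d Hd]. exists d. simpl in Hd. intros u v Hu Hv.
  specialize (Hd u v Hu Hv). apply Rabs_lt_between in Hd. lra.
Qed.

(** On the segments of direction [grad su (x0, y0)] based near [(x0, y0)], [su]
    increases at speed at least [c], hence takes every value near [su s x y]. *)
Lemma gradient_box (s : stream) (x0 y0 : R) (Pr : R -> R -> Prop) :
  nz x0 y0 -> locally_2d Pr x0 y0 ->
  exists e1 e2 q c d, 0 < q /\ 0 < c /\ 0 < d /\
    forall x y, Rabs (x - x0) < d -> Rabs (y - y0) < d ->
      (forall k, Rabs k <= q -> nz (x + k * e1) (y + k * e2) /\ Pr (x + k * e1) (y + k * e2) /\
         c <= su1 s (x + k * e1) (y + k * e2) * e1 + su2 s (x + k * e1) (y + k * e2) * e2) /\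
      (forall v, Rabs (v - su s x y) <= c * q -> exists k, Rabs k <= q /\
         c * Rabs k <= Rabs (v - su s x y) /\ su s (x + k * e1) (y + k * e2) = v /\
         (su s x y <= v -> 0 <= k) /\ (v <= su s x y -> k <= 0)).
Proof.
  intros Hn HPr.
  pose (e1 := su1 s x0 y0). pose (e2 := su2 s x0 y0).
  (* At the base point the derivative of [su] along its own gradient is [e1^2 + e2^2]; by continuity
     half of it survives nearby. *)
  pose (c := (e1 ^ 2 + e2 ^ 2) / 2).
  assert (Hc : 0 < c).
  { unfold c. destruct (s_nonstag s x0 y0 Hn) as [H|H]; fold e1 in H || fold e2 in H; nra. }
  assert (Hcont : continuity_2d_pt (fun a b => su1 s a b * e1 + su2 s a b * e2) x0 y0).
  { apply continuity_2d_pt_plus; apply continuity_2d_pt_mult; try apply continuity_2d_pt_const.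
    - eapply diff2_continuity, s_diff1; auto.
    - eapply diff2_continuity, s_diff2; auto. }
  assert (Hl := locally_2d_ge_of_continuity _ x0 y0 c Hcont).
  assert (Hl' : c < su1 s x0 y0 * e1 + su2 s x0 y0 * e2) by (fold e1 e2; unfold c; unfold c in Hc; lra).
  specialize (Hl Hl').
  destruct (locally_2d_and _ _ _ _ (nz_locally _ _ Hn) (locally_2d_and _ _ _ _ HPr Hl)) as [D HD].
  assert (HD0 := cond_pos D).
  (* With [Rabs k <= q] each coordinate moves by less than [D / 2], so segments based within [D / 2]
     of the centre stay in the box of size [D]. *)
  pose (q := D / (2 * (Rabs e1 + Rabs e2 + 1))).
  assert (Ha1 := Rabs_pos e1). assert (Ha2 := Rabs_pos e2).
  assert (Hq : 0 < q) by (unfold q; apply Rdiv_lt_0_compat; lra).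
  assert (Hqe : q * (Rabs e1 + Rabs e2 + 1) = D / 2) by (unfold q; field; lra).
  assert (Hbox : forall x y k, Rabs (x - x0) < D / 2 -> Rabs (y - y0) < D / 2 -> Rabs k <= q ->
    nz (x + k * e1) (y + k * e2) /\ Pr (x + k * e1) (y + k * e2) /\
    c < su1 s (x + k * e1) (y + k * e2) * e1 + su2 s (x + k * e1) (y + k * e2) * e2).
  { intros x y k Hx Hy Hk. apply HD.
    - replace (x + k * e1 - x0) with ((x - x0) + k * e1) by ring.
      eapply Rle_lt_trans; [apply Rabs_triang|]. rewrite Rabs_mult.
      assert (Rabs k * Rabs e1 <= q * Rabs e1) by now apply Rmult_le_compat_r. nra.
    - replace (y + k * e2 - y0) with ((y - y0) + k * e2) by ring.
      eapply Rle_lt_trans; [apply Rabs_triang|]. rewrite Rabs_mult.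
      assert (Rabs k * Rabs e2 <= q * Rabs e2) by now apply Rmult_le_compat_r. nra. }
  exists e1, e2, q, c, (D / 2). split; [auto|]. split; [auto|]. split; [lra|].
  intros x y Hx Hy. split.
  { intros k Hk. destruct (Hbox x y k Hx Hy Hk) as [H1 [H2 H3]]. repeat split; auto. lra. }
  pose (phi := fun k => su s (x + k * e1) (y + k * e2)).
  assert (Hphi : forall k, Rabs k <= q -> is_derive phi k
    (su1 s (x + k * e1) (y + k * e2) * e1 + su2 s (x + k * e1) (y + k * e2) * e2)).
  { intros k Hk. apply (is_derive_path (su s) (fun k => x + k * e1) (fun k => y + k * e2)).
    - apply s_diff. now apply Hbox.
    - auto_derive; [exact I | ring].
    - auto_derive; [exact I | ring]. }
  assert (Hinc : forall k k', - q <= k <= k' -> k' <= q -> c * (k' - k) <= phi k' - phi k).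
  { intros k k' H1 H2. eapply mvt_ge; [lra| |].
    - intros t Ht. apply Hphi. apply Rabs_le. lra.
    - intros t Ht. apply Rlt_le, Hbox; auto. apply Rabs_le. lra. }
  assert (E0 : phi 0 = su s x y) by (unfold phi; f_equal; ring).
  intros v Hv. apply Rabs_le_between in Hv.
  assert (Hk : exists k, - q <= k <= q /\ phi k = v).
  { assert (Hup := Hinc 0 q). assert (Hdn := Hinc (- q) 0).
    (* The values at the two ends are treated apart because the intermediate value theorem asks for
       strict signs there. *)
    destruct (Req_dec (phi q) v) as [E|N1]; [exists q; split; auto; lra|].
    destruct (Req_dec (phi (- q)) v) as [E|N2]; [exists (- q); split; auto; lra|].
    destruct (Ranalysis5.IVT_interv (fun k => phi k - v) (- q) q) as [k [Hk1 Hk2]]; try lra.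
    - intros a Ha. apply continuity_pt_filterlim.
      apply (continuous_minus phi (fun _ => v)); [|apply continuous_const].
      apply (ex_derive_continuous phi). eexists. apply Hphi. now apply Rabs_le.
    - exists k. split; auto. lra. }
  destruct Hk as [k [Hkq Hkv]]. exists k.
  assert (Hs : (0 <= k /\ c * k <= v - su s x y) \/ (k <= 0 /\ c * (- k) <= su s x y - v)).
  { destruct (Rle_dec 0 k).
    - left. assert (H := Hinc 0 k). lra.
    - right. assert (H := Hinc k 0). lra. }
  split; [now apply Rabs_le|]. split; [|split; [exact Hkv|]].
  - destruct Hs as [[H1 H2]|[H1 H2]].
    + rewrite (Rabs_pos_eq k) by auto. eapply Rle_trans; [exact H2|apply Rle_abs].
    + rewrite (Rabs_left1 k) by auto. rewrite Rabs_minus_sym.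
      eapply Rle_trans; [exact H2|apply Rle_abs].
  - split; intro; destruct Hs as [[H1 H2]|[H1 H2]]; auto; nra.
Qed.

(** A segment of a ray followed by a circular arc joins the points, avoids the origin and stays
    between the two radii. *)
Lemma polar_const (h : R -> R -> R) (x y x' y' : R) :
  nz x y -> nz x' y' ->
  (forall a b, Rmin (nrm x y) (nrm x' y') <= nrm a b <= Rmax (nrm x y) (nrm x' y') ->
     diff2 h a b 0 0) ->
  h x' y' = h x y.
Proof.
  intros Hn Hn' H.
  destruct (polar x y Hn) as [t [_ [Ex Ey]]]. destruct (polar x' y' Hn') as [t' [_ [Ex' Ey']]].
  assert (P := proj1 (nz_nrm _ _) Hn). assert (P' := proj1 (nz_nrm _ _) Hn').
  assert (Hm : 0 < Rmin (nrm x y) (nrm x' y')) by (now apply Rmin_glb_lt).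
  transitivity (h (nrm x' y' * cos t) (nrm x' y' * sin t)).
  - replace (h x' y') with (h (nrm x' y' * cos t') (nrm x' y' * sin t'))
      by (now rewrite <- Ex', <- Ey').
    apply (derive_zero_const (fun q => h (nrm x' y' * cos q) (nrm x' y' * sin q))).
    intros q _.
    replace 0 with (nrm x' y' * cos q * 0 - nrm x' y' * sin q * 0) by ring.
    apply is_derive_arc. apply H. rewrite nrm_polar by lra. split; [apply Rmin_r|apply Rmax_r].
  - replace (h x y) with (h (nrm x y * cos t) (nrm x y * sin t))
      by (now rewrite <- Ex, <- Ey).
    apply (derive_zero_const (fun r => h (r * cos t) (r * sin t))).
    intros r Hr. replace 0 with (0 * cos t + 0 * sin t) by ring.
    apply is_derive_ray. apply H. rewrite nrm_polar by lra. exact Hr.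
Qed.

Lemma zero_gradient_locally_const (h : R -> R -> R) (x y : R) :
  locally_2d (fun a b => diff2 h a b 0 0) x y -> locally_2d (fun a b => h a b = h x y) x y.
Proof.
  intros [d Hd]. exists d. intros u v Hu Hv. apply zero_gradient_segment.
  intros k Hk. assert (H1 := Rabs_pos (u - x)). assert (H2 := Rabs_pos (v - y)).
  apply Hd.
  - replace (x + k * (u - x) - x) with (k * (u - x)) by ring.
    rewrite Rabs_mult, (Rabs_pos_eq k) by lra. nra.
  - replace (y + k * (v - y) - y) with (k * (v - y)) by ring.
    rewrite Rabs_mult, (Rabs_pos_eq k) by lra. nra.
Qed.

(** A component of [{A <= g}] on which [h <> C] would contain a local maximum of [g]. *)
Lemma extremal_const (g h : R -> R -> R) (r R0 C A : R) :
  0 < r < R0 ->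
  (forall x y, nz x y -> continuity_2d_pt g x y) ->
  (forall x y, nz x y -> ~ locally_2d (fun a b => g a b <= g x y) x y) ->
  (forall x y, nz x y -> A <= g x y -> locally_2d (fun a b => h a b = h x y) x y) ->
  (forall x y, nz x y -> nrm x y <= r \/ R0 <= nrm x y -> g x y < A \/ h x y = C) ->
  forall x y, nz x y -> A <= g x y -> h x y = C.
Proof.
  intros Hr Hg Hmax Hloc Hout x y Hn HA. apply NNPP. intro HC.
  (* This set is closed because [h] is locally constant on [{A <= g}]. At a point maximizing [g] on
     it, [h] keeps its value nearby, so every higher neighbour would still belong to the set: the
     point is a local maximum of [g]. *)
  destruct (compact_min (fun a b => annulus r R0 a b /\ A <= g a b /\ h a b <> C)
    (fun a b => - g a b) R0) as [a [b [[Hab [HAab HCab]] Hm]]].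
  - exists x, y. repeat split; auto; apply Rnot_lt_le; intro H; destruct (Hout x y Hn); auto; lra.
  - intros a b [[_ H] _]. assert (H1 := nrm_abs_l a b). assert (H2 := nrm_abs_r a b). lra.
  - intros a b H. destruct (classic (annulus r R0 a b)) as [Hab|Hab].
    2:{ apply locally_2d_impl with (2 := annulus_closed _ _ _ _ Hab).
        apply locally_2d_forall. tauto. }
    assert (Hnab : nz a b) by (apply nz_nrm; unfold annulus in Hab; lra).
    destruct (Rlt_dec (g a b) A) as [HA'|HA'].
    + assert (Hl : - A < - g a b) by lra.
      apply locally_2d_impl with
        (2 := locally_2d_ge_of_continuity _ a b (- A) (continuity_2d_pt_opp _ _ _ (Hg a b Hnab)) Hl).
      apply locally_2d_forall. intros u v Huv [_ [H' _]]. lra.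
    + assert (HCab : h a b = C) by (apply NNPP; intro; apply H; split; [auto|split; [lra|auto]]).
      apply locally_2d_impl with (2 := Hloc a b Hnab ltac:(lra)).
      apply locally_2d_forall. intros u v Huv [_ [_ H']]. congruence.
  - intros a b [H _]. apply continuity_2d_pt_opp, Hg, nz_nrm. unfold annulus in H. lra.
  - assert (Hnab : nz a b) by (apply nz_nrm; unfold annulus in Hab; lra).
    assert (Hin : r < nrm a b < R0).
    { destruct Hab. split; apply Rnot_le_lt; intro H'; destruct (Hout a b Hnab); auto; lra. }
    apply (Hmax a b Hnab).
    apply locally_2d_impl with
      (2 := locally_2d_and _ _ _ _ (annulus_interior _ _ _ _ Hin) (Hloc a b Hnab HAab)).
    apply locally_2d_forall. intros u v [Huv Hh]. apply Rnot_lt_le. intro Hlt.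
    assert (- g a b <= - g u v); [|lra].
    apply Hm. repeat split; auto; [apply Huv|apply Huv|lra|congruence].
Qed.

Lemma diff2_mult (f g : R -> R -> R) (x y a b c d : R) :
  diff2 f x y a b -> diff2 g x y c d ->
  diff2 (fun u v => f u v * g u v) x y (a * g x y + f x y * c) (b * g x y + f x y * d).
Proof.
  intros Hf Hg.
  assert (Hm : diff2 Rmult (f x y) (g x y) (g x y) (f x y)).
  { apply (diff2_of_partials Rmult (fun _ v => v) (fun u _ => u)).
    - apply locally_2d_forall. intros u v. split; (auto_derive; [exact I | ring]).
    - apply continuity_2d_pt_id2.
    - apply continuity_2d_pt_id1. }
  replace (a * g x y + f x y * c) with (g x y * a + f x y * c) by ring.
  replace (b * g x y + f x y * d) with (g x y * b + f x y * d) by ring.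
  exact (differentiable_pt_lim_comp Rmult f g x y _ _ _ _ _ _ Hm Hf Hg).
Qed.

Lemma diff2_comp1 (P : R -> R) (f : R -> R -> R) (x y a b p : R) :
  is_derive P (f x y) p -> diff2 f x y a b -> diff2 (fun u v => P (f u v)) x y (p * a) (p * b).
Proof.
  intros HP Hf. apply is_derive_Reals in HP.
  assert (HP' := differentiable_pt_lim_proj1_0 P (f x y) 0 p HP).
  replace (p * a) with (p * a + 0 * 0) by ring. replace (p * b) with (p * b + 0 * 0) by ring.
  apply (differentiable_pt_lim_comp (fun u _ => P u) f (fun _ _ => 0) x y p 0 a b 0 0); auto.
  intros eps. exists eps. intros u v _ _.
  replace (0 - 0 - (0 * (u - x) + 0 * (v - y))) with 0 by ring. rewrite Rabs_R0.
  apply Rmult_le_pos; [apply Rlt_le, cond_pos|]. eapply Rle_trans; [apply Rabs_pos|apply Rmax_l].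
Qed.

(** The form [vort * bump(su) d su] is closed by [s_transport], and exact because
    it vanishes on large circles. *)
Lemma cutoff_bernoulli (s : stream) (t d : R) :
  0 < d -> exists h, forall x y, nz x y ->
    diff2 h x y (vort s x y * bump t d (su s x y) * su1 s x y)
                (vort s x y * bump t d (su s x y) * su2 s x y).
Proof.
  intro Hd.
  assert (Hw : forall x y, nz x y -> diff2 (vort s) x y (sw1 s x y) (sw2 s x y)) by apply s_diffw.
  assert (Hb : forall x y, nz x y -> diff2 (fun x y => bump t d (su s x y)) x y
    (bump' t d (su s x y) * su1 s x y) (bump' t d (su s x y) * su2 s x y)).
  { intros x y H. apply diff2_comp1; [apply is_derive_bump | now apply s_diff]. }
  assert (HP : forall x y, nz x y -> diff2 (fun x y => vort s x y * bump t d (su s x y) * su1 s x y) x y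
    _ _) by (intros x y H; exact (diff2_mult _ _ _ _ _ _ _ _
      (diff2_mult _ _ _ _ _ _ _ _ (Hw x y H) (Hb x y H)) (s_diff1 s x y H))).
  assert (HQ : forall x y, nz x y -> diff2 (fun x y => vort s x y * bump t d (su s x y) * su2 s x y) x y
    _ _) by (intros x y H; exact (diff2_mult _ _ _ _ _ _ _ _
      (diff2_mult _ _ _ _ _ _ _ _ (Hw x y H) (Hb x y H)) (s_diff2 s x y H))).
  cbv beta in HP, HQ.
  eapply (potential _ _ (fun x y =>
    (sw2 s x y * bump t d (su s x y) + vort s x y * (bump' t d (su s x y) * su2 s x y)) * su1 s x y +
    vort s x y * bump t d (su s x y) * su12 s x y)).
  - intros x y H. exact (diff2_snd _ _ _ _ _ (HP x y H)).
  - intros x y H.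
    replace ((sw2 s x y * bump t d (su s x y) + vort s x y * (bump' t d (su s x y) * su2 s x y)) * su1 s x y +
      vort s x y * bump t d (su s x y) * su12 s x y) with
      ((sw1 s x y * bump t d (su s x y) + vort s x y * (bump' t d (su s x y) * su1 s x y)) * su2 s x y +
      vort s x y * bump t d (su s x y) * su12 s x y).
    + exact (diff2_fst _ _ _ _ _ (HQ x y H)).
    + assert (E := s_transport s x y H).
      replace ((sw2 s x y * bump t d (su s x y) + vort s x y * (bump' t d (su s x y) * su2 s x y)) * su1 s x y)
        with (bump t d (su s x y) * (su1 s x y * sw2 s x y) + vort s x y * (bump' t d (su s x y) * su2 s x y) * su1 s x y) by ring.
      rewrite E. ring.
  - intros x y H. exact (diff2_continuity _ _ _ _ _ (HP x y H)).
  - intros x y H. exact (diff2_continuity _ _ _ _ _ (HQ x y H)).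
  - intros x y H.
    assert (cw := vort_continuity s x y H). assert (cu := su_continuity s x y H).
    assert (c1 := diff2_continuity _ _ _ _ _ (s_diff1 s x y H)).
    assert (c2 := diff2_continuity _ _ _ _ _ (s_diff2 s x y H)).
    assert (c12 := s_cont12 s x y H). assert (cw2 := s_contw2 s x y H).
    assert (cb := diff2_continuity _ _ _ _ _ (Hb x y H)).
    assert (cb' : continuity_2d_pt (fun x y => bump' t d (su s x y)) x y).
    { apply continuity_1d_2d_pt_comp; auto. unfold bump'.
      apply continuity_pt_filterlim.
      apply (continuous_mult (fun a => 2 * Rmax 0 (d ^ 2 - (a - t) ^ 2)) (fun a => - 2 * (a - t))).
      - apply (continuous_mult (fun _ => 2) (fun a => Rmax 0 (d ^ 2 - (a - t) ^ 2)));
          [apply continuous_const|].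
        apply (continuous_comp (fun a => d ^ 2 - (a - t) ^ 2) (fun b => Rmax 0 b)).
        + apply (ex_derive_continuous (fun a => d ^ 2 - (a - t) ^ 2)). auto_derive. exact I.
        + apply (continuous_ext (fun b => (b + Rabs b) / 2)).
          * intro b. unfold Rmax. destruct (Rle_dec 0 b).
            rewrite Rabs_pos_eq; lra. rewrite Rabs_left; lra.
          * apply (continuous_mult (fun b => b + Rabs b) (fun _ => / 2)); [|apply continuous_const].
            apply (continuous_plus (fun b => b) Rabs); [apply continuous_id|apply continuous_Rabs].
      - apply (ex_derive_continuous (fun a => - 2 * (a - t))). auto_derive. exact I. }
    assert (cb2 := continuity_2d_pt_mult _ _ _ _ cb' c2).
    assert (A1 := continuity_2d_pt_mult _ _ _ _ cw2 cb).
    assert (A2 := continuity_2d_pt_mult _ _ _ _ cw cb2).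
    assert (A3 := continuity_2d_pt_mult _ _ _ _ (continuity_2d_pt_plus _ _ _ _ A1 A2) c1).
    assert (A4 := continuity_2d_pt_mult _ _ _ _ (continuity_2d_pt_mult _ _ _ _ cw cb) c12).
    exact (continuity_2d_pt_plus _ _ _ _ A3 A4).
  - intros eps He. destruct (su_to_infinity s (t + d)) as [R0 [HR0 HR]].
    exists R0. split; auto. unfold circulation.
    rewrite (RInt_ext _ (fun _ => 0)).
    + rewrite RInt_const. unfold scal. simpl. unfold mult. simpl.
      rewrite Rmult_0_r, Rabs_R0. lra.
    + intros q _. specialize (HR (R0 * cos q) (R0 * sin q)). rewrite nrm_polar in HR by lra.
      rewrite bump_out; [|lra|rewrite Rabs_pos_eq; lra].
      match goal with |- @eq _ ?l ?r => change (@eq R l r) end. ring.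
Qed.

(** Crossing the level [t] near [(x0, y0)], the potential jumps by about
    [vort s x0 y0] times the mass of the bump; [sg] selects the upper or the lower
    estimate. *)
Lemma vort_jump (s : stream) (x0 y0 t a sg : R) :
  nz x0 y0 -> su s x0 y0 = t -> 0 < sg * (vort s x0 y0 - a) ->
  exists q, 0 < q /\ forall d h P c0 c1, 0 < d < q ->
    (forall x y, nz x y -> diff2 h x y (vort s x y * bump t d (su s x y) * su1 s x y)
                                       (vort s x y * bump t d (su s x y) * su2 s x y)) ->
    (forall b, is_derive P b (bump t d b)) ->
    (forall x y, nz x y -> t + 2 * d <= su s x y -> h x y = c1) ->
    (forall x y, nz x y -> su s x y <= t - 2 * d -> h x y = c0) ->
    0 <= sg * (c1 - c0 - a * (P (t + 2 * d) - P (t - 2 * d))).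
Proof.
  intros Hn Et Ha.
  assert (Hl : locally_2d (fun x y => 0 < sg * (vort s x y - a)) x0 y0).
  { apply (locally_2d_ge_of_continuity (fun x y => sg * (vort s x y - a))); auto.
    apply continuity_2d_pt_mult; [apply continuity_2d_pt_const|].
    apply continuity_2d_pt_minus; [now apply vort_continuity|apply continuity_2d_pt_const]. }
  destruct (gradient_box s x0 y0 _ Hn Hl) as [e1 [e2 [q [c [D0 [Hq [Hc [HD0 Hbox]]]]]]]].
  destruct (Hbox x0 y0) as [Hline Hlev]; [rewrite Rminus_diag, Rabs_R0; auto..|].
  assert (Hcq : 0 < c * q) by (now apply Rmult_lt_0_compat).
  (* With [2 * d < c * q] both levels [t + 2 * d] and [t - 2 * d] are attained on the gradient
     segment. *)
  exists (c * q / 2). split; [lra|].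
  intros d h P c0 c1 Hd Hh HP H1 H0. rewrite Et in Hlev.
  destruct (Hlev (t + 2 * d)) as [k1 [Hk1 [_ [E1 [S1 _]]]]].
  { replace (t + 2 * d - t) with (2 * d) by ring. rewrite Rabs_pos_eq; lra. }
  destruct (Hlev (t - 2 * d)) as [k0 [Hk0 [_ [E0 [_ S0]]]]].
  { replace (t - 2 * d - t) with (- (2 * d)) by ring. rewrite Rabs_Ropp, Rabs_pos_eq; lra. }
  assert (Hk0' : k0 <= 0) by (apply S0; lra). assert (Hk1' : 0 <= k1) by (apply S1; lra).
  rewrite <- (H1 (x0 + k1 * e1) (y0 + k1 * e2)) by (try (apply Hline; auto); lra).
  rewrite <- (H0 (x0 + k0 * e1) (y0 + k0 * e2)) by (try (apply Hline; auto); lra).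
  rewrite <- E1. rewrite <- E0.
  (* The derivative of [h - a * P(su)] along the segment is [(vort - a) * bump(su)] times the
     increasing rate of [su], so after multiplication by [sg] it is nonnegative. *)
  pose (G := fun k => sg * (h (x0 + k * e1) (y0 + k * e2) - a * P (su s (x0 + k * e1) (y0 + k * e2)))).
  assert (HG : 0 * (k1 - k0) <= G k1 - G k0).
  { pose (du := fun k => su1 s (x0 + k * e1) (y0 + k * e2) * e1 + su2 s (x0 + k * e1) (y0 + k * e2) * e2).
    apply Rabs_le_between in Hk0. apply Rabs_le_between in Hk1.
    apply (mvt_ge G (fun k => sg * (vort s (x0 + k * e1) (y0 + k * e2) - a) *
       (bump t d (su s (x0 + k * e1) (y0 + k * e2)) * du k))); [lra| |].
    - intros k Hk. assert (Hkq : Rabs k <= q) by (apply Rabs_le; lra).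
      destruct (Hline k Hkq) as [N _].
      assert (L1 : is_derive (fun k => x0 + k * e1) k e1) by (auto_derive; [exact I|ring]).
      assert (L2 : is_derive (fun k => y0 + k * e2) k e2) by (auto_derive; [exact I|ring]).
      assert (D1 := is_derive_path h (fun k => x0 + k * e1) (fun k => y0 + k * e2) k _ _ _ _ (Hh _ _ N) L1 L2).
      assert (D2 := is_derive_path (su s) (fun k => x0 + k * e1) (fun k => y0 + k * e2) k _ _ _ _ (s_diff s _ _ N) L1 L2).
      assert (D3 := is_derive_comp P _ k _ _ (HP _) D2).
      assert (D4 := is_derive_scal _ k sg _ (is_derive_minus _ _ k _ _ D1 (is_derive_scal _ k a _ D3))).
      unfold G. cbv beta in D4.
      eapply (is_derive_ext _ _ k _ (fun _ => eq_refl)).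
      match type of D4 with is_derive _ _ ?l => match goal with |- is_derive _ _ ?l' => replace l' with l end end.
      + exact D4.
      + unfold du, scal, minus, plus, opp, mult. simpl. unfold mult. simpl. ring.
    - intros k Hk. assert (Hkq : Rabs k <= q) by (apply Rabs_le; lra).
      destruct (Hline k Hkq) as [_ [N1 N2]].
      apply Rmult_le_pos; [lra|]. apply Rmult_le_pos; [apply bump_ge0|]. unfold du. lra. }
  unfold G in HG. lra.
Qed.

(** Both points lie on the level [t] and see the same potential, with the same constants above and
    below. If the vorticities were in strict order, the jump would be at least [a] times the mass of
    the bump by one point and at most [b] times it by the other, with [b < a]. *)
Lemma vort_le_on_level (s : stream) (x y x' y' : R) :
  nz x y -> nz x' y' -> su s x y = su s x' y' -> vort s x y <= vort s x' y'.
Proof.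
  intros Hn Hn' E. apply Rnot_lt_le. intro Hlt.
  pose (t := su s x y). pose (w := vort s x y). pose (w' := vort s x' y').
  fold w w' in Hlt.
  pose (a := w - (w - w') / 3). pose (b := w' + (w - w') / 3).
  destruct (vort_jump s x y t a 1) as [q [Hq Hj]]; auto. { unfold a. fold w. lra. }
  destruct (vort_jump s x' y' t b (-1)) as [q' [Hq' Hj']]; auto. { unfold b. fold w'. lra. }
  destruct (su_near_origin s x y Hn) as [r [g [Hr [Hg Hnear]]]]. fold t in Hnear.
  (* Besides the two jump estimates, [d < g] is needed: in the punctured disc of radius [r] one has
     [su < t - g], so the bump vanishes there and [h] is constant. *)
  pose (d := Rmin (Rmin q q') g / 2).
  assert (Hd : 0 < d).
  { unfold d. assert (0 < Rmin (Rmin q q') g) by (repeat apply Rmin_glb_lt; auto). lra. }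
  assert (M1 := Rmin_l (Rmin q q') g). assert (M2 := Rmin_r (Rmin q q') g).
  assert (M3 := Rmin_l q q'). assert (M4 := Rmin_r q q').
  assert (Hd' : d < q /\ d < q' /\ d < g) by (unfold d in *; lra).
  destruct (cutoff_bernoulli s t d Hd) as [h Hh].
  destruct (bump_primitive t d Hd) as [P [HP HPlt]].
  destruct (su_to_infinity s (t + 2 * d)) as [R1 [HR1 HR]].
  assert (Hzero : forall x y, nz x y -> d <= Rabs (su s x y - t) -> diff2 h x y 0 0).
  { intros p p' Hp Hpd. assert (H := Hh p p' Hp). rewrite bump_out in H by (auto; lra).
    rewrite Rmult_0_r, !Rmult_0_l in H. exact H. }
  pose (R0 := Rmax R1 r).
  assert (HR0 : R1 <= R0 /\ r <= R0) by (split; [apply Rmax_l|apply Rmax_r]).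
  assert (Hfar : forall p p', R0 <= nrm p p' -> h p p' = h R0 0).
  { intros p p' Hp. apply polar_const; try (apply nz_nrm; rewrite ?nrm_zero_r, ?Rabs_pos_eq; lra).
    rewrite nrm_zero_r, Rabs_pos_eq by lra. rewrite Rmin_left by auto. intros c c' [Hc _].
    apply Hzero; [apply nz_nrm; lra|]. specialize (HR c c'). rewrite Rabs_pos_eq; lra. }
  assert (Hin : forall p p', nz p p' -> nrm p p' <= r / 2 -> h p p' = h (r / 2) 0).
  { intros p p' Hpn Hp. apply polar_const; auto.
    - apply nz_nrm; rewrite ?nrm_zero_r, ?Rabs_pos_eq; lra.
    - rewrite nrm_zero_r, Rabs_pos_eq by lra. rewrite Rmin_right, Rmax_left by auto. intros c c' Hc.
      apply nz_nrm in Hpn.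
      assert (Hcn : nz c c') by (apply nz_nrm; lra).
      apply Hzero; auto. specialize (Hnear c c' Hcn). rewrite Rabs_left; lra. }
  (* The margin between [t + d] and [t + 2 * d] leaves a neighbourhood on which the bump still
     vanishes, so [h] is locally constant on the closed region. *)
  assert (Hup : forall p p', nz p p' -> t + 2 * d <= su s p p' -> h p p' = h R0 0).
  { apply (extremal_const (su s) h (r / 2) R0); try lra.
    - apply su_continuity.
    - apply su_no_local_max.
    - intros p p' Hp Hu. apply zero_gradient_locally_const.
      apply locally_2d_impl with (2 := locally_2d_and _ _ _ _ (nz_locally _ _ Hp)
        (locally_2d_ge_of_continuity _ _ _ (t + d) (su_continuity s _ _ Hp) ltac:(lra))).
      apply locally_2d_forall. intros c c' [Hc1 Hc2]. apply Hzero; auto. rewrite Rabs_pos_eq; lra.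
    - intros p p' Hp [H|H]; [left|right; auto].
      specialize (Hnear p p' Hp). lra. }
  assert (Hdn : forall p p', nz p p' -> su s p p' <= t - 2 * d -> h p p' = h (r / 2) 0).
  { intros p p' Hp Hu.
    apply (extremal_const (fun c c' => - su s c c') h (r / 2) R0 _ (- (t - 2 * d))); auto; try lra.
    - intros; now apply continuity_2d_pt_opp, su_continuity.
    - intros c c' Hc Hm. apply (su_no_local_min s c c' Hc).
      revert Hm. apply locally_2d_impl. apply locally_2d_forall. intros; lra.
    - intros c c' Hc Hcu. apply zero_gradient_locally_const.
      apply locally_2d_impl with (2 := locally_2d_and _ _ _ _ (nz_locally _ _ Hc)
        (locally_2d_ge_of_continuity _ _ _ (- (t - d))
           (continuity_2d_pt_opp _ _ _ (su_continuity s _ _ Hc)) ltac:(lra))).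
      apply locally_2d_forall. intros z z' [Hz1 Hz2]. apply Hzero; auto. rewrite Rabs_left; lra.
    - intros c c' Hc [H|H]; [right; auto|left]. specialize (HR c c'). lra. }
  assert (J := Hj d h P _ _ ltac:(lra) Hh HP Hup Hdn).
  assert (J' := Hj' d h P _ _ ltac:(lra) Hh HP Hup Hdn).
  assert (0 < (a - b) * (P (t + 2 * d) - P (t - 2 * d))).
  { apply Rmult_lt_0_compat; [unfold a, b|]; lra. }
  lra.
Qed.

Lemma vort_eq_on_level (s : stream) (x y x' y' : R) :
  nz x y -> nz x' y' -> su s x y = su s x' y' -> vort s x y = vort s x' y'.
Proof. intros. apply Rle_antisym; apply vort_le_on_level; auto. Qed.

(** The point [(x', y')] may be far away. Only its level matters: that level is met on the gradient
    segment through [(x, y)], at a parameter at most [|su difference| / c], and [vort] takes there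
    the same value as at [(x', y')]. Along the short segment [vort] is controlled by its bounded
    gradient. *)
Lemma vort_lipschitz_at (s : stream) (x0 y0 : R) :
  nz x0 y0 -> exists d L e, 0 < d /\ 0 <= L /\ 0 < e /\
    forall x y x' y', Rabs (x - x0) < d -> Rabs (y - y0) < d -> nz x' y' ->
      Rabs (su s x' y' - su s x y) <= e ->
      Rabs (vort s x' y' - vort s x y) <= L * Rabs (su s x' y' - su s x y).
Proof.
  intro Hn.
  pose (W1 := Rabs (sw1 s x0 y0) + 1). pose (W2 := Rabs (sw2 s x0 y0) + 1).
  assert (Hbd : forall g, continuity_2d_pt g x0 y0 ->
    locally_2d (fun x y => Rabs (g x y) <= Rabs (g x0 y0) + 1) x0 y0).
  { intros g Hg. destruct (Hg (mkposreal 1 Rlt_0_1)) as [d Hd]. exists d. simpl in Hd.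
    intros u v Hu Hv. specialize (Hd u v Hu Hv).
    replace (g u v) with (g x0 y0 + (g u v - g x0 y0)) by ring.
    eapply Rle_trans; [apply Rabs_triang|]. lra. }
  destruct (gradient_box s x0 y0 _ Hn
    (locally_2d_and _ _ _ _ (Hbd _ (s_contw1 s x0 y0 Hn)) (Hbd _ (s_contw2 s x0 y0 Hn))))
    as [e1 [e2 [q [c [d [Hq [Hc [Hd Hbox]]]]]]]].
  fold W1 W2 in Hbox.
  exists d, ((W1 * Rabs e1 + W2 * Rabs e2) / c), (c * q).
  assert (Hw1 : 0 < W1) by (unfold W1; assert (H := Rabs_pos (sw1 s x0 y0)); lra).
  assert (Hw2 : 0 < W2) by (unfold W2; assert (H := Rabs_pos (sw2 s x0 y0)); lra).
  assert (Ha1 := Rabs_pos e1). assert (Ha2 := Rabs_pos e2).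
  assert (HL : 0 <= W1 * Rabs e1 + W2 * Rabs e2) by nra.
  split; [auto|]. split; [apply Rdiv_le_0_compat; auto|].
  split; [now apply Rmult_lt_0_compat|].
  intros x y x' y' Hx Hy Hn' Hu. destruct (Hbox x y Hx Hy) as [Hline Hlev].
  destruct (Hlev (su s x' y') Hu) as [k [Hk [Hck [Ek _]]]].
  destruct (Hline k Hk) as [Nk _].
  rewrite <- (vort_eq_on_level s _ _ x' y' Nk Hn' Ek).
  assert (Hm : Rabs (vort s (x + k * e1) (y + k * e2) - vort s (x + 0 * e1) (y + 0 * e2)) <=
     (W1 * Rabs e1 + W2 * Rabs e2) * Rabs (k - 0)).
  { apply (mvt_abs (fun k => vort s (x + k * e1) (y + k * e2))
      (fun k => sw1 s (x + k * e1) (y + k * e2) * e1 + sw2 s (x + k * e1) (y + k * e2) * e2)).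
    - intros t Ht.
      assert (Htq : Rabs t <= q).
      { apply Rabs_le. apply Rabs_le_between in Hk. revert Ht. unfold Rmin, Rmax.
        destruct (Rle_dec 0 k); lra. }
      apply (is_derive_path (vort s) (fun k => x + k * e1) (fun k => y + k * e2)).
      + apply s_diffw. now apply Hline.
      + auto_derive; [exact I | ring].
      + auto_derive; [exact I | ring].
    - intros t Ht.
      assert (Htq : Rabs t <= q).
      { apply Rabs_le. apply Rabs_le_between in Hk. revert Ht. unfold Rmin, Rmax.
        destruct (Rle_dec 0 k); lra. }
      destruct (Hline t Htq) as [_ [[B1 B2] _]].
      eapply Rle_trans; [apply Rabs_triang|]. rewrite !Rabs_mult.
      apply Rplus_le_compat; apply Rmult_le_compat_r; auto. }
  replace (x + 0 * e1) with x in Hm by ring. replace (y + 0 * e2) with y in Hm by ring.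
  rewrite Rminus_0_r in Hm. eapply Rle_trans; [exact Hm|].
  unfold Rdiv. rewrite Rmult_assoc. apply Rmult_le_compat_l; auto.
  apply Rmult_le_reg_l with c; auto. rewrite <- Rmult_assoc, Rinv_r, Rmult_1_l by lra. exact Hck.
Qed.

(** A failure for every constant produces bad pairs whose first points accumulate in the annulus.
    The local estimate excludes pairs with close levels, and the bounded oscillation [B] of [vort]
    excludes the others. *)
Lemma vort_lipschitz (s : stream) (r1 r2 : R) :
  0 < r1 <= r2 -> exists L, 0 <= L /\ forall x y x' y', annulus r1 r2 x y -> annulus r1 r2 x' y' ->
    Rabs (vort s x' y' - vort s x y) <= L * Rabs (su s x' y' - su s x y).
Proof.
  intro Hr.
  assert (Hnz : forall x y, annulus r1 r2 x y -> nz x y).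
  { intros x y [H _]. apply nz_nrm. lra. }
  destruct (annulus_min (vort s) r1 r2 Hr (vort_continuity s)) as [a [b [_ Hmin]]].
  destruct (annulus_min (fun x y => - vort s x y) r1 r2 Hr) as [a' [b' [_ Hmax]]].
  { intros. now apply continuity_2d_pt_opp, vort_continuity. }
  pose (B := vort s a' b' - vort s a b).
  assert (HB : forall x y x' y', annulus r1 r2 x y -> annulus r1 r2 x' y' ->
    Rabs (vort s x' y' - vort s x y) <= B).
  { intros x y x' y' H H'. assert (H1 := Hmin _ _ H). assert (H2 := Hmin _ _ H').
    assert (H3 := Hmax _ _ H). assert (H4 := Hmax _ _ H'). simpl in H3, H4.
    apply Rabs_le. unfold B. lra. }
  apply NNPP. intro Hno.
  destruct (cluster_point r2 (fun n x y => annulus r1 r2 x y /\ exists x' y', annulus r1 r2 x' y' /\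
    INR n * Rabs (su s x' y' - su s x y) < Rabs (vort s x' y' - vort s x y))) as [x [y [_ [_ HP]]]].
  - intros n m x y Hnm [H [x' [y' [H' Hlt]]]]. split; auto. exists x', y'. split; auto.
    apply le_INR in Hnm. assert (Hp := Rabs_pos (su s x' y' - su s x y)).
    eapply Rle_lt_trans; [|exact Hlt]. now apply Rmult_le_compat_r.
  - intro n. apply NNPP. intro Hn. apply Hno. exists (INR n). split; [apply pos_INR|].
    intros x y x' y' H H'. apply Rnot_lt_le. intro Hlt. apply Hn. exists x, y.
    assert (H1 := nrm_abs_l x y). assert (H2 := nrm_abs_r x y). assert (H0 := proj2 H).
    split; [lra|]. split; [lra|]. split; auto. exists x', y'. auto.
  - assert (Hxy : annulus r1 r2 x y).
    { apply NNPP. intro H. destruct (annulus_closed _ _ _ _ H) as [d Hd].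
      destruct (HP 0%nat d) as [p [p' [H1 [H2 [H3 _]]]]]. exact (Hd p p' H1 H2 H3). }
    destruct (vort_lipschitz_at s x y (Hnz _ _ Hxy)) as [d [L [e [Hd [HL [He H]]]]]].
    assert (HBp : 0 <= B / e).
    { apply Rdiv_le_0_compat; auto. eapply Rle_trans; [apply Rabs_pos|apply (HB x y x y); auto]. }
    (* An index above [L + B / e] beats both cases: the slope [L] when the levels differ by at most
       [e], and [B / e] when they differ by more. *)
    destruct (nfloor_ex (L + B / e)) as [n [_ Hn]]; [lra|].
    destruct (HP (S n) (mkposreal _ Hd)) as [p [p' [H1 [H2 [Hp [z [z' [Hz Hlt]]]]]]]].
    rewrite S_INR in Hlt. simpl in H1, H2.
    assert (Hab := Rabs_pos (su s z z' - su s p p')).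
    destruct (Rle_dec (Rabs (su s z z' - su s p p')) e) as [Hle|Hgt].
    + specialize (H p p' z z' H1 H2 (Hnz _ _ Hz) Hle). nra.
    + assert (HB' := HB _ _ _ _ Hp Hz). apply Rnot_le_lt in Hgt.
      assert (B / e * e = B) by (field; lra). nra.
Qed.

(** * The Hopf lemma *)

Lemma second_derivative_min (f f1 : R -> R) (x l : R) :
  locally x (fun t => is_derive f t (f1 t)) -> is_derive f1 x l ->
  locally x (fun t => f x <= f t) -> 0 <= l.
Proof.
  intros Hf Hf1 Hm. apply Rnot_lt_le. intro Hl.
  assert (E : f1 x = 0).
  { apply (is_derive_local_min f x); auto. exact (locally_singleton _ _ Hf). }
  destruct (filter_and _ _ Hf Hm) as [d Hd]. assert (Hd0 := cond_pos d).
  apply is_derive_Reals in Hf1. destruct (Hf1 (- l / 2)) as [[e He] H1]; [lra|]. simpl in H1.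
  pose (m := Rmin d e / 2).
  assert (Hm0 : 0 < Rmin d e) by now apply Rmin_glb_lt.
  assert (M1 := Rmin_l d e). assert (M2 := Rmin_r d e).
  assert (Hneg : forall t, 0 < t <= m -> f1 (x + t) < l / 2 * t).
  { intros t Ht. unfold m in Ht. specialize (H1 t). rewrite E in H1.
    rewrite (Rabs_pos_eq t) in H1 by lra.
    assert (Hte : t <> 0) by lra. assert (Hte' : t < e) by lra. specialize (H1 Hte Hte').
    apply Rabs_lt_between in H1. destruct H1 as [_ H1].
    replace (f1 (x + t)) with ((f1 (x + t) - 0) / t * t) by (field; lra).
    apply Rmult_lt_compat_r; lra. }
  assert (Hball : forall t, 0 <= t <= m -> is_derive f (x + t) (f1 (x + t)) /\ f x <= f (x + t)).
  { intros t Ht. apply Hd. change (Rabs (x + t - x) < d). replace (x + t - x) with t by ring.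
    unfold m in Ht. rewrite Rabs_pos_eq; lra. }
  (* The strict drop is taken on the outer half of the interval, away from [x], where [f1] vanishes;
     on the inner half [f] merely does not increase. *)
  assert (Hinc : (- (l / 2 * (m / 2))) * (x + m - (x + m / 2)) <= - f (x + m) - - f (x + m / 2)).
  { apply (mvt_ge (fun t => - f t) (fun t => - f1 t)); [unfold m; lra| |].
    - intros t Ht. apply (is_derive_opp f). replace t with (x + (t - x)) by ring.
      apply Hball. unfold m in *; lra.
    - intros t Ht. assert (Hm' : 0 < m) by (unfold m; lra).
      assert (H := Hneg (t - x) ltac:(lra)).
      replace (x + (t - x)) with t in H by ring. nra. }
  assert (Hdec : 0 * (x + m / 2 - x) <= - f (x + m / 2) - - f x).
  { apply (mvt_ge (fun t => - f t) (fun t => - f1 t)); [unfold m; lra| |].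
    - intros t Ht. apply (is_derive_opp f). replace t with (x + (t - x)) by ring.
      apply Hball. unfold m in *; lra.
    - intros t Ht. assert (Hm' : 0 < m) by (unfold m; lra).
      destruct (Req_dec t x) as [->|Hne]; [rewrite E; lra|].
      assert (H := Hneg (t - x) ltac:(lra)).
      replace (x + (t - x)) with t in H by ring. nra. }
  assert (Hm' : 0 < m) by (unfold m; lra).
  assert (Hxm := proj2 (Hball m ltac:(lra))).
  assert (0 < - (l / 2 * (m / 2)) * (m / 2)).
  { apply Rmult_lt_0_compat; [|lra]. assert (0 < - l * m) by (apply Rmult_lt_0_compat; lra). lra. }
  replace (x + m - (x + m / 2)) with (m / 2) in Hinc by lra. lra.
Qed.

(** Comparison with [mu (p + 4 p^2)], [p = X - Y^2], on [Y^2 <= X <= d]; this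
    region meets [X = 0] only at the origin, so that positivity of [z] for
    [X > 0] bounds [z] from below on the edge [X = d]. *)
Lemma hopf (z z1 z2 z11 z22 : R -> R -> R) (x0 y0 d0 K l : R) :
  0 < d0 -> 0 <= K ->
  (forall x y, x0 <= x < x0 + d0 -> Rabs (y - y0) < d0 -> continuity_2d_pt z x y) ->
  (forall x y, x0 < x < x0 + d0 -> Rabs (y - y0) < d0 ->
     0 < z x y /\ z11 x y + z22 x y <= K * z x y /\
     is_derive (fun t => z t y) x (z1 x y) /\ is_derive (fun t => z1 t y) x (z11 x y) /\
     is_derive (fun t => z x t) y (z2 x y) /\ is_derive (fun t => z2 x t) y (z22 x y)) ->
  z x0 y0 = 0 -> is_derive (fun t => z t y0) x0 l -> 0 < l.
Proof.
  intros Hd0 HK Hc Hz Hz0 Hl.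
  (* The first two bounds keep the parabolic region inside the box; [/ 4] gives [4 p^2 <= p] and
     [16 p <= 4]; the last one gives [2 K d < 1]. *)
  pose (d := Rmin (Rmin (d0 / 2) (d0 ^ 2 / 2)) (Rmin (/ 4) (/ (2 * (K + 1))))).
  assert (Hd : 0 < d).
  { unfold d. repeat apply Rmin_glb_lt; try lra; try nra. apply Rinv_0_lt_compat; lra. }
  assert (M1 := Rmin_l (Rmin (d0 / 2) (d0 ^ 2 / 2)) (Rmin (/ 4) (/ (2 * (K + 1))))).
  assert (M2 := Rmin_r (Rmin (d0 / 2) (d0 ^ 2 / 2)) (Rmin (/ 4) (/ (2 * (K + 1))))).
  assert (M3 := Rmin_l (d0 / 2) (d0 ^ 2 / 2)). assert (M4 := Rmin_r (d0 / 2) (d0 ^ 2 / 2)).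
  assert (M5 := Rmin_l (/ 4) (/ (2 * (K + 1)))). assert (M6 := Rmin_r (/ 4) (/ (2 * (K + 1)))).
  fold d in M1, M2.
  assert (HdK : d * (2 * (K + 1)) <= 1).
  { apply Rle_trans with (/ (2 * (K + 1)) * (2 * (K + 1))).
    - apply Rmult_le_compat_r; lra.
    - rewrite Rinv_l; lra. }
  assert (HY : forall y, (y - y0) ^ 2 <= d -> Rabs (y - y0) < d0).
  { intros y Hy. rewrite <- (Rabs_pos_eq d0) by lra. apply Rsqr_lt_abs_0. unfold Rsqr. nra. }
  pose (p := fun x y => (x - x0) - (y - y0) ^ 2).
  assert (Hpt : forall t, p (x0 + t) y0 = t) by (intro t; unfold p; ring).
  pose (bar := fun x y => p x y + 4 * p x y ^ 2).
  assert (cp : forall x y, continuity_2d_pt p x y).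
  { intros x y. apply continuity_2d_pt_minus.
    - apply continuity_2d_pt_minus; [apply continuity_2d_pt_id1|apply continuity_2d_pt_const].
    - apply (continuity_1d_2d_pt_comp (fun t => (t - y0) ^ 2) (fun _ v => v)); [|apply continuity_2d_pt_id2].
      apply continuity_pt_filterlim. apply (ex_derive_continuous (fun t => (t - y0) ^ 2)).
      auto_derive. exact I. }
  assert (cX : forall x y, continuity_2d_pt (fun x _ => x - x0) x y).
  { intros x y. apply continuity_2d_pt_minus; [apply continuity_2d_pt_id1|apply continuity_2d_pt_const]. }
  assert (cbar : forall x y, continuity_2d_pt bar x y).
  { intros x y. apply (continuity_1d_2d_pt_comp (fun t => t + 4 * t ^ 2) p); auto.
    apply continuity_pt_filterlim. apply (ex_derive_continuous (fun t => t + 4 * t ^ 2)).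
    auto_derive. exact I. }
  assert (Hbd : forall x y, 0 <= p x y -> x - x0 <= d -> Rabs x <= Rabs x0 + Rabs y0 + 1 + d0 /\
     Rabs y <= Rabs x0 + Rabs y0 + 1 + d0).
  { intros x y Hp Hx. assert (A0 := Rabs_pos x0). assert (A1 := Rabs_pos y0).
    unfold p in Hp. assert (Hy := HY y ltac:(lra)). split.
    - replace x with (x0 + (x - x0)) at 1 by ring. eapply Rle_trans; [apply Rabs_triang|].
      assert (Hsq := pow2_ge_0 (y - y0)). rewrite (Rabs_pos_eq (x - x0)) by lra. lra.
    - replace y with (y0 + (y - y0)) at 1 by ring. eapply Rle_trans; [apply Rabs_triang|]. lra. }
  assert (Hop : forall x y, ~ (0 <= p x y) -> locally_2d (fun u v => ~ 0 <= p u v) x y).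
  { intros x y H. apply locally_2d_impl with
      (2 := locally_2d_ge_of_continuity (fun u v => - p u v) x y 0 (continuity_2d_pt_opp _ _ _ (cp x y)) ltac:(lra)).
    apply locally_2d_forall. intros; lra. }
  assert (HoX : forall x y c, c < x - x0 -> locally_2d (fun u v => c < u - x0) x y).
  { intros x y c H. exact (locally_2d_ge_of_continuity (fun u _ => u - x0) x y c (cX x y) H). }
  assert (HoX' : forall x y c, x - x0 < c -> locally_2d (fun u v => u - x0 < c) x y).
  { intros x y c H. apply locally_2d_impl with
      (2 := locally_2d_ge_of_continuity (fun u v => - (u - x0)) x y (- c) (continuity_2d_pt_opp _ _ _ (cX x y)) ltac:(lra)).
    apply locally_2d_forall. intros; lra. }
  assert (Hin : forall x y, 0 <= p x y -> x - x0 <= d -> x0 <= x < x0 + d0 /\ Rabs (y - y0) < d0).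
  { intros x y Hp Hx. unfold p in Hp. assert (Hsq := pow2_ge_0 (y - y0)).
    split; [lra|]. apply HY. lra. }
  destruct (compact_min (fun x y => 0 <= p x y /\ x - x0 = d) z (Rabs x0 + Rabs y0 + 1 + d0))
    as [a [b [[Hpab Hab] Hmu]]].
  { exists (x0 + d), y0. rewrite Hpt. split; lra. }
  { intros x y [H1 H2]. apply Hbd; auto. lra. }
  { intros x y H. destruct (classic (0 <= p x y)) as [Hp|Hp].
    - destruct (Rlt_dec (x - x0) d) as [H'|H'].
      + apply locally_2d_impl with (2 := HoX' x y d H'). apply locally_2d_forall. intros; lra.
      + apply locally_2d_impl with (2 := HoX x y d ltac:(lra)). apply locally_2d_forall. intros; lra.
    - apply locally_2d_impl with (2 := Hop x y Hp). apply locally_2d_forall. tauto. }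
  { intros x y [H1 H2]. destruct (Hin x y H1) as [H3 H4]; [lra|]. now apply Hc. }
  pose (mu := z a b). fold mu in Hmu.
  assert (Hmu0 : 0 < mu). { destruct (Hin a b Hpab) as [H3 H4]; [lra|]. apply Hz; auto. lra. }
  (* A negative minimum of [z - mu * bar] is not on [p = 0], where [bar] vanishes and [z >= 0], nor
     on the edge [X = d], where [z >= mu] and [bar <= 2 d < 1]. It is thus interior, and both second
     derivatives of the difference are nonnegative there. *)
  assert (Hcomp : forall x y, 0 <= p x y -> x - x0 <= d -> mu * bar x y <= z x y).
  { destruct (compact_min (fun x y => 0 <= p x y /\ x - x0 <= d) (fun x y => z x y - mu * bar x y)
       (Rabs x0 + Rabs y0 + 1 + d0)) as [x [y [[Hp Hx] Hmin]]].
    { exists (x0 + d), y0. rewrite Hpt. split; lra. }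
    { intros x y [H1 H2]. apply Hbd; auto. }
    { intros x y H. destruct (classic (0 <= p x y)) as [Hp|Hp].
      - apply locally_2d_impl with (2 := HoX x y d ltac:(lra)). apply locally_2d_forall. intros; lra.
      - apply locally_2d_impl with (2 := Hop x y Hp). apply locally_2d_forall. tauto. }
    { intros x y [H1 H2]. destruct (Hin x y H1 H2). apply continuity_2d_pt_minus; [now apply Hc|].
      apply continuity_2d_pt_mult; [apply continuity_2d_pt_const|auto]. }
    assert (Hge : 0 <= z x y - mu * bar x y).
    2:{ intros x' y' Hp' Hx'. specialize (Hmin x' y' (conj Hp' Hx')). simpl in Hmin. lra. }
    apply Rnot_lt_le. intro Hneg.
    assert (Hz0' : 0 <= z x y).
    { destruct (Hin x y Hp Hx) as [H1 H2]. destruct (Req_dec x x0) as [Ex|Ex].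
      - assert (Ey : y = y0) by (unfold p in Hp; nra). rewrite Ex, Ey, Hz0. lra.
      - apply Rlt_le, Hz; auto. lra. }
    assert (Hp0 : 0 < p x y).
    { destruct (Req_dec (p x y) 0) as [E|]; [|lra]. unfold bar in Hneg. rewrite E in Hneg. lra. }
    assert (Hsq := pow2_ge_0 (y - y0)).
    assert (Hpd : p x y <= d) by (unfold p; lra).
    assert (Hbar : bar x y <= 2 * d).
    { unfold bar. assert (p x y * p x y <= / 4 * p x y) by (apply Rmult_le_compat_r; lra). lra. }
    assert (Hxd : x - x0 < d).
    { destruct (Req_dec (x - x0) d) as [E|]; [|lra]. specialize (Hmu x y (conj Hp E)). nra. }
    assert (Hx0 : x0 < x) by (unfold p in Hp0; lra).
    destruct (Hin x y Hp Hx) as [H1 H2].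
    destruct (Hz x y ltac:(lra) H2) as [Hzp [Hlap [D1 [D11 [D2 D22]]]]].
    assert (Hlm : locally_2d (fun u v => z x y - mu * bar x y <= z u v - mu * bar u v) x y).
    { apply locally_2d_impl with (2 := locally_2d_and _ _ _ _ (HoX' x y d Hxd)
         (locally_2d_ge_of_continuity p x y 0 (cp x y) Hp0)).
      apply locally_2d_forall. intros u v [Hu Hv]. apply Hmin. lra. }
    destruct Hlm as [dm Hdm].
    assert (Q1 : 0 <= z11 x y - mu * 8).
    { apply (second_derivative_min (fun t => z t y - mu * bar t y)
        (fun t => z1 t y - mu * (1 + 8 * p t y)) x).
      - assert (Hlt : locally x (fun t => x0 < t < x0 + d0)).
        { apply (filter_and (fun t => x0 < t) (fun t => t < x0 + d0)).
          - apply open_gt. lra.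
          - apply open_lt. lra. }
        revert Hlt. apply filter_imp. intros t Ht.
        apply (is_derive_minus (fun t => z t y) (fun t => mu * bar t y)).
        + now apply Hz.
        + unfold bar, p. auto_derive; [exact I|ring].
      - apply (is_derive_minus (fun t => z1 t y) (fun t => mu * (1 + 8 * p t y))); auto.
        unfold p. auto_derive; [exact I|ring].
      - exists dm. intros t Ht. apply Hdm; auto. rewrite Rminus_diag, Rabs_R0. apply cond_pos. }
    assert (Q2 : 0 <= z22 x y - mu * (- 2 - 16 * p x y + 32 * (y - y0) ^ 2)).
    { apply (second_derivative_min (fun t => z x t - mu * bar x t)
        (fun t => z2 x t - mu * (- 2 * (t - y0) * (1 + 8 * p x t))) y).
      - assert (Hlt : locally y (fun t => Rabs (t - y0) < d0)).
        { apply (filter_imp (fun t => y0 - d0 < t /\ t < y0 + d0)).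
          - intros t Ht. apply Rabs_lt_between. lra.
          - apply Rabs_lt_between in H2. apply (filter_and (fun t => y0 - d0 < t) (fun t => t < y0 + d0)).
            + apply open_gt. lra.
            + apply open_lt. lra. }
        revert Hlt. apply filter_imp. intros t Ht.
        apply (is_derive_minus (fun t => z x t) (fun t => mu * bar x t)).
        + apply Hz; auto. lra.
        + unfold bar, p. auto_derive; [exact I|ring].
      - apply (is_derive_minus (fun t => z2 x t) (fun t => mu * (- 2 * (t - y0) * (1 + 8 * p x t)))); auto.
        unfold p. auto_derive; [exact I|ring].
      - exists dm. intros t Ht. apply Hdm; auto. rewrite Rminus_diag, Rabs_R0. apply cond_pos. }
    (* The Laplacian of [bar] is [6 - 16 p + 32 Y^2 >= 2], whereas at the minimum
       [z < mu * bar <= 2 d mu] bounds the Laplacian of [z] by [2 K d mu < mu]. *)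
    assert (HKz : K * z x y <= K * (mu * (2 * d))) by (apply Rmult_le_compat_l; nra).
    assert (HS : 0 <= z11 x y + z22 x y - mu * (6 - 16 * p x y + 32 * (y - y0) ^ 2)) by lra.
    assert (mu * 2 <= mu * (6 - 16 * p x y + 32 * (y - y0) ^ 2)) by (apply Rmult_le_compat_l; lra).
    assert (mu * (K * (2 * d)) < mu * 2) by (apply Rmult_lt_compat_l; nra).
    lra. }
  apply Rlt_le_trans with mu; auto.
  apply (is_derive_ge_right (fun t => z t y0) x0 l mu Hl). exists d. split; auto.
  intros t Ht. rewrite Hz0, Rminus_0_r.
  assert (H : mu * bar (x0 + t) y0 <= z (x0 + t) y0) by (apply Hcomp; rewrite ?Hpt; lra).
  assert (E : bar (x0 + t) y0 = t + 4 * t ^ 2) by (unfold bar; rewrite Hpt; ring). rewrite E in H. nra.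
Qed.

(** * Moving planes *)

(** Up to [PI / 3] the slope of [sin] is at least [/ 2]; beyond, monotonicity gives
    [sin a >= PI / 6], which dominates [a / 3]. *)
Lemma sin_ge_third (a : R) : 0 <= a <= PI / 2 -> a / 3 <= sin a.
Proof.
  intros Ha. assert (HPI := PI_RGT_0).
  assert (H : forall b, 0 <= b <= PI / 3 -> / 2 * (b - 0) <= sin b - sin 0).
  { intros b Hb. apply (mvt_ge sin cos); [lra| |].
    - intros t _. auto_derive; [exact I|ring].
    - intros t Ht. replace (/ 2) with (cos (PI / 3)) by (rewrite cos_PI3; lra).
      apply cos_decr_1; lra. }
  rewrite sin_0 in H.
  destruct (Rle_dec a (PI / 3)) as [H1|H1].
  - specialize (H a ltac:(lra)). lra.
  - assert (H2 := H (PI / 3) ltac:(lra)).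
    assert (sin (PI / 3) <= sin a) by (apply sin_incr_1; lra). lra.
Qed.

(** The half-angle formula turns [1 - cos a] into [2 sin(a / 2)^2], hence [2 (a / 6)^2]. This is the
    origin of the factor 6 in the angle bound for reflected points. *)
Lemma one_minus_cos_ge (a : R) : - PI <= a <= PI -> a ^ 2 / 18 <= 1 - cos a.
Proof.
  intros Ha. assert (H : (Rabs a / 2 / 3) ^ 2 <= sin (Rabs a / 2) ^ 2).
  { assert (Hp := Rabs_pos a). assert (Hl : Rabs a <= PI) by (now apply Rabs_le).
    apply pow_incr. split; [lra|]. apply sin_ge_third. lra. }
  assert (E : cos a = 1 - 2 * sin (Rabs a / 2) ^ 2).
  { replace (cos a) with (cos (2 * (Rabs a / 2))).
    - rewrite cos_2a_sin. ring.
    - replace (2 * (Rabs a / 2)) with (Rabs a) by field.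
      unfold Rabs. destruct (Rcase_abs a); auto. apply cos_neg. }
  rewrite E. replace ((Rabs a / 2 / 3) ^ 2) with (Rabs a ^ 2 / 36) in H by field.
  rewrite pow2_abs in H. lra.
Qed.

Lemma su_circle_variation (s : stream) (eps : R) :
  0 < eps -> exists R0, 0 < R0 /\ forall r t t', R0 <= r ->
    Rabs (su s (r * cos t') (r * sin t') - su s (r * cos t) (r * sin t)) <= eps * Rabs (t' - t).
Proof.
  intro He. destruct (s_tangential s eps He) as [R0 [HR H]]. exists R0. split; auto.
  intros r t t' Hr.
  apply (mvt_abs (fun q => su s (r * cos q) (r * sin q)) (fun q =>
    r * cos q * su2 s (r * cos q) (r * sin q) - r * sin q * su1 s (r * cos q) (r * sin q))).
  - intros q _. apply is_derive_arc, s_diff, nz_polar. lra.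
  - intros q _. apply H. rewrite nrm_polar; lra.
Qed.

(** With [r = |(x, y)|], [rho] the norm of the reflected point and [d = x - lam]:
    the radial gain is at least [eta (r - rho) = 4 eta lam d / (r + rho)], while
    the angle between the two points is at most [6 d / rho]. *)
Lemma reflection_far (s : stream) (lam1 : R) :
  0 < lam1 -> exists R0, 0 < R0 /\ forall lam x y, lam1 <= lam -> lam < x ->
    R0 <= nrm (2 * lam - x) y -> su s (2 * lam - x) y < su s x y.
Proof.
  intro Hl1. destruct (su_radial_growth s) as [eta [R1 [Heta [HR1 Hrad]]]].
  (* After clearing denominators the angular loss is at most [3 eta lam rho d] against a radial gain
     of [4 eta lam rho d]. This uses [lam1 <= lam] and [lam1 <= rho], whence the term [lam1] in the
     radius below. *)
  pose (eps := eta * lam1 / 8).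
  assert (Hel : 0 < eta * lam1) by (now apply Rmult_lt_0_compat).
  assert (Heps : 0 < eps) by (unfold eps; lra).
  destruct (su_circle_variation s eps Heps) as [R2 [HR2 Hcirc]].
  exists (R1 + R2 + lam1). split; [lra|]. intros lam x y Hlam Hx Hrho.
  pose (rho := nrm (2 * lam - x) y). pose (r := nrm x y). fold rho in Hrho.
  assert (Er := nrm_sqr x y). assert (Erho := nrm_sqr (2 * lam - x) y).
  fold r in Er. fold rho in Erho.
  assert (Hr0 := nrm_ge0 x y). fold r in Hr0.
  assert (Hdiff : r ^ 2 - rho ^ 2 = 4 * lam * (x - lam)) by (rewrite Er, Erho; ring).
  assert (Hpos : 0 < 4 * lam * (x - lam)) by (apply Rmult_lt_0_compat; lra).
  assert (Hrr : rho < r) by nra.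
  assert (Hrle : r <= rho + 2 * lam).
  { assert (H := nrm_triangle (2 * lam - x) (- y) (- (2 * lam)) 0).
    replace (nrm (2 * lam - x) (- y)) with rho in H by (unfold rho, nrm; f_equal; ring).
    replace (nrm (2 * lam - x + - (2 * lam)) (- y + 0)) with r in H by (unfold r, nrm; f_equal; ring).
    rewrite nrm_zero_r, Rabs_Ropp, Rabs_pos_eq in H by lra. exact H. }
  (* The point and its reflection share the ordinate, so both angles can be taken in the same half
     circle. *)
  assert (Hang : exists t t', x = r * cos t /\ y = r * sin t /\ 2 * lam - x = rho * cos t' /\
            y = rho * sin t' /\ - PI <= t' - t <= PI).
  { destruct (polar_upper x y) as [t [Ht [E1 E2]]]; [apply nz_nrm; fold r; lra|].
    destruct (polar_upper (2 * lam - x) y) as [t' [Ht' [E1' E2']]]; [apply nz_nrm; fold rho; lra|].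
    fold r in E1, E2. fold rho in E1', E2'.
    destruct (Rle_dec 0 y).
    - rewrite Rabs_pos_eq in E2, E2' by auto. exists t, t'. repeat split; auto; lra.
    - rewrite Rabs_left in E2, E2' by lra. exists (- t), (- t').
      rewrite !cos_neg, !sin_neg. repeat split; auto; lra. }
  destruct Hang as [t [t' [Ex [Ey [Ex' [Ey' Ht]]]]]].
  assert (Hcos : r * rho * cos (t' - t) = x * (2 * lam - x) + y ^ 2).
  { rewrite cos_minus.
    transitivity ((r * cos t) * (rho * cos t') + (r * sin t) * (rho * sin t')); [ring|].
    rewrite <- Ex, <- Ey, <- Ex', <- Ey'. ring. }
  assert (Hth := one_minus_cos_ge (t' - t) Ht).
  (* By the law of cosines, [2 r rho (1 - cos)] is the squared distance [4 (x - lam)^2] minus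
     [(r - rho)^2]; the lower bound for [1 - cos] does the rest. *)
  assert (Hth2 : rho * Rabs (t' - t) <= 6 * (x - lam)).
  { assert (r * rho * ((t' - t) ^ 2 / 18) <= r * rho * (1 - cos (t' - t))).
    { apply Rmult_le_compat_l; auto. apply Rmult_le_pos; lra. }
    assert (r * rho * (1 - cos (t' - t)) <= 2 * (x - lam) ^ 2).
    { rewrite Rmult_minus_distr_l, Hcos. assert (0 <= (r - rho) ^ 2) by apply pow2_ge_0. nra. }
    assert (rho * rho * (t' - t) ^ 2 <= r * rho * (t' - t) ^ 2).
    { apply Rmult_le_compat_r; [apply pow2_ge_0|]. apply Rmult_le_compat_r; lra. }
    apply Rsqr_incr_0.
    - unfold Rsqr. replace (rho * Rabs (t' - t) * (rho * Rabs (t' - t))) with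
        (rho * rho * Rabs (t' - t) ^ 2) by ring. rewrite pow2_abs. lra.
    - apply Rmult_le_pos; [lra|apply Rabs_pos].
    - lra. }
  assert (G1 := Hrad rho r t ltac:(lra)).
  assert (G2 := Hcirc rho t t' ltac:(lra)).
  rewrite <- Ex, <- Ey in G1. rewrite <- Ex', <- Ey' in G2.
  apply Rabs_le_between in G2.
  assert (G3 : eps * Rabs (t' - t) < eta * (r - rho)).
  { apply Rmult_lt_reg_l with (rho * (r + rho)); [apply Rmult_lt_0_compat; lra|].
    apply Rle_lt_trans with (eps * (r + rho) * (6 * (x - lam))).
    - replace (rho * (r + rho) * (eps * Rabs (t' - t))) with (eps * (r + rho) * (rho * Rabs (t' - t))) by ring.
      apply Rmult_le_compat_l; auto. apply Rmult_le_pos; lra.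
    - replace (rho * (r + rho) * (eta * (r - rho))) with (rho * eta * (r ^ 2 - rho ^ 2)) by ring.
      rewrite Hdiff.
      replace (rho * eta * (4 * lam * (x - lam))) with (4 * (eta * lam * rho) * (x - lam)) by ring.
      replace (eps * (r + rho) * (6 * (x - lam))) with (6 * (eps * (r + rho)) * (x - lam)) by ring.
      apply Rmult_lt_compat_r; [lra|].
      assert (K0 : eps * (r + rho) <= eps * (2 * rho + 2 * lam)) by (apply Rmult_le_compat_l; lra).
      assert (K1 : eta * lam1 * rho <= eta * lam * rho) by (apply Rmult_le_compat_r; [lra|]; apply Rmult_le_compat_l; lra).
      assert (K2 : eta * lam1 * lam <= eta * lam * rho).
      { replace (eta * lam * rho) with (eta * rho * lam) by ring.
        apply Rmult_le_compat_r; [lra|]. apply Rmult_le_compat_l; lra. }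
      assert (0 < eta * lam * rho) by (repeat apply Rmult_lt_0_compat; lra).
      unfold eps in *. lra. }
  lra.
Qed.

(** When the reflected point approaches the origin, the point itself approaches [(2 m, 0)]. There
    [su] is above [su s (2 * m) 0 - c] by continuity, and near the origin it is below. The radius is
    uniform in [lam] close to [m]. *)
Lemma reflection_near_pole (s : stream) (m : R) :
  0 < m -> exists r0, 0 < r0 /\ forall lam x y, Rabs (lam - m) < r0 -> nz (2 * lam - x) y ->
    nrm (2 * lam - x) y < r0 -> su s (2 * lam - x) y < su s x y.
Proof.
  intro Hm. assert (Hn : nz (2 * m) 0) by (unfold nz; nra).
  destruct (su_near_origin s (2 * m) 0 Hn) as [d [c [Hd [Hc Hnear]]]].
  destruct (su_continuity s (2 * m) 0 Hn (mkposreal c Hc)) as [d' Hd'].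
  assert (Hd0 := cond_pos d'). simpl in Hd'.
  assert (M1 := Rmin_l d (d' / 3)). assert (M2 := Rmin_r d (d' / 3)).
  exists (Rmin d (d' / 3)). split; [apply Rmin_glb_lt; lra|].
  intros lam x y Hlam Hnz Hnrm.
  specialize (Hnear _ _ Hnz ltac:(lra)).
  assert (H1 := nrm_abs_l (2 * lam - x) y). assert (H2 := nrm_abs_r (2 * lam - x) y).
  assert (Hx : Rabs (x - 2 * m) < d').
  { replace (x - 2 * m) with (2 * (lam - m) - (2 * lam - x)) by ring.
    eapply Rle_lt_trans; [apply Rabs_triang|]. rewrite Rabs_Ropp, Rabs_mult, (Rabs_pos_eq 2) by lra. lra. }
  assert (Hy : Rabs (y - 0) < d') by (rewrite Rminus_0_r; lra).
  specialize (Hd' x y Hx Hy). apply Rabs_lt_between in Hd'. lra.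
Qed.

(** If the reflected point is far out, [reflection_far] applies. Otherwise its value is below the
    maximum of [su] on a fixed circle, which every point with [x > lam] exceeds once [lam] is
    large. *)
Lemma reflection_start (s : stream) :
  exists R0, 0 < R0 /\ forall lam x y, R0 <= lam -> lam < x -> nz (2 * lam - x) y ->
    su s (2 * lam - x) y < su s x y.
Proof.
  destruct (reflection_far s 1 Rlt_0_1) as [R1 [HR1 Hfar]].
  destruct (annulus_min (fun x y => - su s x y) R1 R1) as [a [b [_ Hmax]]]; [lra| |].
  { intros. now apply continuity_2d_pt_opp, su_continuity. }
  destruct (su_to_infinity s (su s a b)) as [R2 [HR2 Hinf]].
  exists (1 + R2). split; [lra|]. intros lam x y Hlam Hx Hn.
  destruct (Rle_dec R1 (nrm (2 * lam - x) y)) as [H|H]; [apply Hfar; auto; lra|].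
  destruct (su_larger_outside s (2 * lam - x) y R1 Hn ltac:(lra)) as [p [q [Hpq Hlt]]].
  assert (H1 : - su s a b <= - su s p q) by (apply Hmax; unfold annulus; lra).
  assert (H2 : su s a b < su s x y); [|lra].
  apply Hinf. assert (Hxn := nrm_abs_l x y). assert (Hxa := Rle_abs x). lra.
Qed.

Lemma is_derive_reflect (f : R -> R -> R) (m x y a b : R) :
  diff2 f (2 * m - x) y a b -> is_derive (fun t => f (2 * m - t) y) x (- a).
Proof.
  intro H. replace (- a) with (a * (- 1) + b * 0) by ring.
  apply (is_derive_path f (fun t => 2 * m - t) (fun _ => y)); auto.
  - auto_derive; [exact I|ring].
  - apply @is_derive_const.
Qed.

Lemma continuity_2d_reflect (f : R -> R -> R) (m x y : R) :
  continuity_2d_pt f (2 * m - x) y -> continuity_2d_pt (fun u v => f (2 * m - u) v) x y.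
Proof.
  intros H eps. destruct (H eps) as [d Hd]. exists d. intros u v Hu Hv. apply Hd; auto.
  replace (2 * m - u - (2 * m - x)) with (- (u - x)) by ring. now rewrite Rabs_Ropp.
Qed.

(** The Laplacian of the difference is the difference of the two vorticities, which the Lipschitz
    bound dominates by [L] times the difference itself wherever it is positive. The case [x0 = m] is
    allowed, and the conclusion is then positivity of [2 * su1] on the line. *)
Lemma reflection_hopf (s : stream) (m x0 y0 : R) :
  0 < m <= x0 -> nz (2 * m - x0) y0 -> su s x0 y0 = su s (2 * m - x0) y0 ->
  (forall x y, x0 < x -> nz (2 * m - x) y -> su s (2 * m - x) y < su s x y) ->
  0 < su1 s x0 y0 + su1 s (2 * m - x0) y0.
Proof.
  intros Hm Hn E Hpos.
  assert (Hn0 : nz x0 y0) by (unfold nz; nra).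
  pose (rho := nrm (2 * m - x0) y0).
  assert (Hrho : 0 < rho) by (now apply nz_nrm).
  (* In a box of size [d0] the reflected norm changes by at most [rho / 2], and points to the right
     of the line have norm at least [m]. Hence one annulus, with one Lipschitz constant, contains
     the box and its mirror image. *)
  pose (d0 := Rmin 1 (rho / 4)).
  assert (Hd0 : 0 < d0) by (apply Rmin_glb_lt; lra).
  assert (D1 : d0 <= 1) by apply Rmin_l. assert (D2 : d0 <= rho / 4) by apply Rmin_r.
  pose (r1 := Rmin m (rho / 2)). pose (r2 := nrm x0 y0 + rho + 2).
  assert (Hr1 : 0 < r1) by (apply Rmin_glb_lt; lra).
  assert (R1 : r1 <= m) by apply Rmin_l. assert (R2 : r1 <= rho / 2) by apply Rmin_r.
  assert (Hx0n := nrm_abs_l x0 y0). rewrite Rabs_pos_eq in Hx0n by lra.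
  destruct (vort_lipschitz s r1 r2) as [L [HL Hlip]]; [unfold r2; lra|].
  assert (Hann : forall x y, x0 <= x < x0 + d0 -> Rabs (y - y0) < d0 ->
    annulus r1 r2 x y /\ annulus r1 r2 (2 * m - x) y).
  { intros x y Hx Hy. assert (Hxa : Rabs (x - x0) <= d0) by (apply Rabs_le; lra). split.
    - assert (H := nrm_near x0 y0 x y). apply Rabs_le_between in H.
      assert (H1 := nrm_abs_l x y). rewrite Rabs_pos_eq in H1 by lra.
      unfold annulus, r2. lra.
    - assert (H := nrm_near (2 * m - x0) y0 (2 * m - x) y). apply Rabs_le_between in H.
      replace (2 * m - x - (2 * m - x0)) with (- (x - x0)) in H by ring.
      rewrite Rabs_Ropp in H. fold rho in H. unfold annulus, r2. lra. }
  assert (Hnz : forall x y, annulus r1 r2 x y -> nz x y).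
  { intros x y [H _]. apply nz_nrm. lra. }
  apply (hopf (fun x y => su s x y - su s (2 * m - x) y)
    (fun x y => su1 s x y - - su1 s (2 * m - x) y) (fun x y => su2 s x y - su2 s (2 * m - x) y)
    (fun x y => su11 s x y - - - su11 s (2 * m - x) y) (fun x y => su22 s x y - su22 s (2 * m - x) y)
    x0 y0 d0 L); auto.
  - intros x y Hx Hy. destruct (Hann x y Hx Hy) as [A1 A2].
    apply continuity_2d_pt_minus; [|apply continuity_2d_reflect]; now apply su_continuity, Hnz.
  - intros x y Hx Hy. destruct (Hann x y ltac:(lra) Hy) as [A1 A2].
    assert (N1 := Hnz _ _ A1). assert (N2 := Hnz _ _ A2).
    assert (Hz := Hpos x y ltac:(lra) N2).
    assert (Hl := Hlip _ _ _ _ A2 A1). rewrite (Rabs_pos_eq (su s x y - _)) in Hl by lra.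
    apply Rabs_le_between in Hl. unfold vort in Hl.
    split; [lra|]. split; [lra|]. split; [|split; [|split]].
    + apply (is_derive_minus (fun t => su s t y) (fun t => su s (2 * m - t) y)).
      * eapply diff2_fst, s_diff, N1.
      * eapply is_derive_reflect, s_diff, N2.
    + apply (is_derive_minus (fun t => su1 s t y) (fun t => - su1 s (2 * m - t) y)).
      * eapply diff2_fst, s_diff1, N1.
      * apply (is_derive_opp (fun t => su1 s (2 * m - t) y)).
        eapply is_derive_reflect, s_diff1, N2.
    + apply (is_derive_minus (fun t => su s x t) (fun t => su s (2 * m - x) t)).
      * eapply diff2_snd, s_diff, N1.
      * eapply diff2_snd, s_diff, N2.
    + apply (is_derive_minus (fun t => su2 s x t) (fun t => su2 s (2 * m - x) t)).
      * eapply diff2_snd, s_diff2, N1.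
      * eapply diff2_snd, s_diff2, N2.
  - cbv beta. lra.
  - replace (su1 s x0 y0 + su1 s (2 * m - x0) y0) with (su1 s x0 y0 - - su1 s (2 * m - x0) y0) by ring.
    apply (is_derive_minus (fun t => su s t y0) (fun t => su s (2 * m - t) y0)).
    + eapply diff2_fst, s_diff, Hn0.
    + eapply is_derive_reflect, s_diff, Hn.
Qed.

(** For [lam > 0] the point itself has positive abscissa, so only its reflection has to be kept off
    the origin. *)
Definition reflection_le (s : stream) (lam : R) : Prop :=
  forall x y, lam < x -> nz (2 * lam - x) y -> su s (2 * lam - x) y <= su s x y.

(** Strong maximum principle: the rightmost zero of [su s x y - su s (2 m - x) y]
    would contradict the Hopf lemma. *)
Lemma reflection_strict (s : stream) (m : R) :
  0 < m -> reflection_le s m ->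
  forall x y, m < x -> nz (2 * m - x) y -> su s (2 * m - x) y < su s x y.
Proof.
  intros Hm Hle x1 y1 Hx1 Hn1. apply Rnot_le_lt. intro Hbad.
  destruct (reflection_far s m Hm) as [R0 [HR0 Hfar]].
  destruct (reflection_near_pole s m Hm) as [r0 [Hr0 Hpole]].
  assert (Hpole' := Hpole m). rewrite Rminus_diag, Rabs_R0 in Hpole'.
  (* The far and pole estimates confine reflections of bad points to an annulus, so this set is
     compact and has a rightmost point. *)
  pose (K := fun x y => x1 <= x /\ annulus r0 R0 (2 * m - x) y /\ su s x y <= su s (2 * m - x) y).
  assert (HK : forall x y, x1 <= x -> nz (2 * m - x) y -> su s x y <= su s (2 * m - x) y -> K x y).
  { intros x y Hx Hn Hu. split; auto. split; auto. split; apply Rnot_lt_le; intro H.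
    - specialize (Hpole' x y Hr0 Hn H). lra.
    - specialize (Hfar m x y (Rle_refl m) ltac:(lra) ltac:(lra)). lra. }
  assert (HKn : forall x y, K x y -> nz x y /\ nz (2 * m - x) y).
  { intros x y [H1 [[H2 _] _]]. split; [unfold nz; nra|apply nz_nrm; lra]. }
  destruct (compact_min K (fun x y => - x) (R0 + 2 * m)) as [x0 [y0 [HK0 Hmax]]].
  - exists x1, y1. apply HK; auto. lra.
  - intros x y [_ [[_ H] _]]. assert (H1 := nrm_abs_l (2 * m - x) y).
    assert (H2 := nrm_abs_r (2 * m - x) y). split; [|lra].
    replace x with (2 * m - (2 * m - x)) by ring.
    eapply Rle_trans; [apply Rabs_triang|]. rewrite Rabs_Ropp, (Rabs_pos_eq (2 * m)) by lra. lra.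
  - intros x y H. destruct (Rlt_dec x x1) as [Hx|Hx].
    { apply locally_2d_impl with
        (2 := locally_2d_ge_of_continuity (fun u v => - u) x y (- x1)
           (continuity_2d_pt_opp _ _ _ (continuity_2d_pt_id1 x y)) ltac:(lra)).
      apply locally_2d_forall. intros u v Hu [H1 _]. lra. }
    destruct (classic (annulus r0 R0 (2 * m - x) y)) as [Ha|Ha].
    + assert (Hn : nz (2 * m - x) y) by (apply nz_nrm; destruct Ha; lra).
      assert (Hn' : nz x y) by (unfold nz; nra).
      assert (Hu : 0 < su s x y - su s (2 * m - x) y).
      { apply Rnot_le_lt. intro Hu. apply H. split; [lra|]. split; auto. lra. }
      apply locally_2d_impl with
        (2 := locally_2d_ge_of_continuity (fun u v => su s u v - su s (2 * m - u) v) x y 0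
          (continuity_2d_pt_minus _ _ _ _ (su_continuity s _ _ Hn')
            (continuity_2d_reflect _ _ _ _ (su_continuity s _ _ Hn))) Hu).
      apply locally_2d_forall. intros u v Huv [_ [_ H3]]. lra.
    + destruct (annulus_closed _ _ _ _ Ha) as [d Hd]. exists d. intros u v Hu Hv [_ [H2 _]].
      apply (Hd (2 * m - u) v); auto.
      replace (2 * m - u - (2 * m - x)) with (- (u - x)) by ring. now rewrite Rabs_Ropp.
  - intros x y _. apply continuity_2d_pt_opp, continuity_2d_pt_id1.
  - destruct (HKn x0 y0 HK0) as [N N']. destruct HK0 as [Hx0 [_ Hu0]].
    assert (E : su s x0 y0 = su s (2 * m - x0) y0).
    { apply Rle_antisym; auto. apply Hle; auto. lra. }
    assert (Hh : 0 < su1 s x0 y0 + su1 s (2 * m - x0) y0).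
    { apply reflection_hopf; auto; [lra|]. intros x y Hx Hn. apply Rnot_le_lt. intro H.
      assert (Hx' : - x0 <= - x); [|lra]. apply (Hmax x y), HK; auto. lra. }
    (* An interior zero of a nonnegative difference is a minimum, so its horizontal derivative
       vanishes, against the strict sign given by Hopf. *)
    assert (E0 : su1 s x0 y0 - - su1 s (2 * m - x0) y0 = 0).
    { apply (is_derive_local_min (fun t => su s t y0 - su s (2 * m - t) y0) x0).
      - apply (is_derive_minus (fun t => su s t y0) (fun t => su s (2 * m - t) y0)).
        + eapply diff2_fst, s_diff, N.
        + eapply is_derive_reflect, s_diff, N'.
      - destruct (nz_locally _ _ N') as [d Hd].
        assert (Hd0 := cond_pos d).
        assert (Hp : 0 < Rmin d (x0 - m)) by (apply Rmin_glb_lt; lra).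
        exists (mkposreal _ Hp). intros t Ht. change (Rabs (t - x0) < Rmin d (x0 - m)) in Ht.
        assert (M1 := Rmin_l d (x0 - m)). assert (M2 := Rmin_r d (x0 - m)).
        assert (Ht' := Rlt_le_trans _ _ _ Ht M2). apply Rabs_lt_between in Ht'.
        assert (Hnt : nz (2 * m - t) y0).
        { apply Hd; [|rewrite Rminus_diag, Rabs_R0; auto].
          replace (2 * m - t - (2 * m - x0)) with (- (t - x0)) by ring. rewrite Rabs_Ropp. lra. }
        specialize (Hle t y0 ltac:(lra) Hnt). lra. }
    lra.
Qed.

(** Otherwise violations occur for values of [lam] tending to [m]. They stay bounded, with
    reflections away from the origin, so they accumulate. A limit off the line contradicts
    strictness by continuity; a limit on the line contradicts the Hopf sign of [su1]. *)
Lemma reflection_le_open (s : stream) (m : R) :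
  0 < m -> reflection_le s m ->
  exists d, 0 < d /\ forall lam, m - d < lam <= m -> reflection_le s lam.
Proof.
  intros Hm Hle. assert (Hstrict := reflection_strict s m Hm Hle).
  apply NNPP. intro Hno.
  destruct (reflection_far s (m / 2) ltac:(lra)) as [R0 [HR0 Hfar]].
  destruct (reflection_near_pole s m Hm) as [r0 [Hr0 Hpole]].
  (* The factor [m / 2] keeps every [lam] above [m / 2], so a single radius [R0] serves them all. *)
  destruct (cluster_point (R0 + 2 * m) (fun n x y => exists lam, m - m / 2 * / (INR n + 1) < lam <= m /\
     lam < x /\ nz (2 * lam - x) y /\ su s x y < su s (2 * lam - x) y)) as [x [y [_ [_ HP]]]].
  - intros n k x y Hnk [lam [H1 H2]]. exists lam. split; auto.
    assert (/ (INR k + 1) <= / (INR n + 1)).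
    { apply le_INR in Hnk. assert (H := pos_INR n). apply Rinv_le_contravar; lra. }
    nra.
  - intro n. assert (Hn0 := pos_INR n).
    assert (Hi : 0 < / (INR n + 1)) by (apply Rinv_0_lt_compat; lra).
    assert (Hi1 : / (INR n + 1) <= 1) by (rewrite <- Rinv_1; apply Rinv_le_contravar; lra).
    apply NNPP. intro Hn. apply Hno. exists (m / 2 * / (INR n + 1)). split; [nra|].
    intros lam Hlam x y Hx Hnz. apply Rnot_lt_le. intro Hlt. apply Hn. exists x, y.
    assert (Hlam2 : m / 2 <= lam) by nra.
    assert (Hr : nrm (2 * lam - x) y < R0).
    { apply Rnot_le_lt. intro H. specialize (Hfar lam x y Hlam2 Hx H). lra. }
    assert (H1 := nrm_abs_l (2 * lam - x) y). assert (H2 := nrm_abs_r (2 * lam - x) y).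
    split; [|split; [lra|exists lam; auto]].
    replace x with (2 * lam - (2 * lam - x)) by ring.
    eapply Rle_trans; [apply Rabs_triang|]. rewrite Rabs_Ropp, (Rabs_pos_eq (2 * lam)) by lra. lra.
  - assert (Hseq : forall eps, 0 < eps -> exists lam x' y', m - eps < lam <= m /\
      Rabs (x' - x) < eps /\ Rabs (y' - y) < eps /\ lam < x' /\ nz (2 * lam - x') y' /\
      su s x' y' < su s (2 * lam - x') y').
    { intros eps He. destruct (nfloor_ex (m / 2 / eps)) as [n [_ Hn]].
      { apply Rdiv_le_0_compat; lra. }
      destruct (HP n (mkposreal _ He)) as [x' [y' [H1 [H2 [lam [H3 H4]]]]]].
      exists lam, x', y'. split; [|auto]. assert (Hn0 := pos_INR n).
      assert (m / 2 * / (INR n + 1) < eps); [|lra].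
      apply Rmult_lt_reg_r with (INR n + 1); [lra|]. rewrite Rmult_assoc, Rinv_l, Rmult_1_r by lra.
      apply Rmult_lt_reg_r with (/ eps); [now apply Rinv_0_lt_compat|].
      replace (eps * (INR n + 1) * / eps) with (INR n + 1) by (field; lra). exact Hn. }
    assert (Hxm : m <= x).
    { apply Rnot_lt_le. intro H. destruct (Hseq ((m - x) / 2) ltac:(lra))
        as [lam [x' [y' [H1 [H2 [_ [H3 _]]]]]]]. apply Rabs_lt_between in H2. lra. }
    assert (Hn' : nz (2 * m - x) y).
    { apply nz_nrm. apply Rlt_le_trans with (r0 / 2); [lra|]. apply Rnot_lt_le. intro H.
      destruct (Hseq (r0 / 8) ltac:(lra)) as [lam [x' [y' [H1 [H2 [H3 [H4 [H5 H6]]]]]]]].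
      assert (Hl : Rabs (lam - m) < r0 / 8) by (apply Rabs_lt_between; lra).
      assert (Hs := nrm_near (2 * m - x) y (2 * lam - x') y').
      apply Rabs_le_between in Hs.
      assert (Ht : Rabs (2 * lam - x' - (2 * m - x)) < 3 * r0 / 8).
      { replace (2 * lam - x' - (2 * m - x)) with (2 * (lam - m) - (x' - x)) by ring.
        eapply Rle_lt_trans; [apply Rabs_triang|].
        rewrite Rabs_Ropp, Rabs_mult, (Rabs_pos_eq 2) by lra. lra. }
      specialize (Hpole lam x' y' ltac:(lra) H5 ltac:(lra)). lra. }
    assert (Hn : nz x y) by (unfold nz; nra).
    destruct (Rle_lt_or_eq_dec _ _ Hxm) as [Hlt|Heq].
    + assert (Hz := Hstrict x y Hlt Hn').
      pose (e := (su s x y - su s (2 * m - x) y) / 2). assert (He : 0 < e) by (unfold e; lra).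
      destruct (su_continuity s x y Hn (mkposreal _ He)) as [d1 Hd1].
      destruct (su_continuity s _ _ Hn' (mkposreal _ He)) as [d2 Hd2].
      simpl in Hd1, Hd2. assert (P1 := cond_pos d1). assert (P2 := cond_pos d2).
      assert (M1 := Rmin_l d1 (d2 / 3)). assert (M2 := Rmin_r d1 (d2 / 3)).
      destruct (Hseq (Rmin d1 (d2 / 3))) as [lam [x' [y' [H1 [H2 [H3 [H4 [H5 H6]]]]]]]].
      { apply Rmin_glb_lt; lra. }
      assert (Hl : Rabs (lam - m) < Rmin d1 (d2 / 3)) by (apply Rabs_lt_between; lra).
      assert (Ht : Rabs (2 * lam - x' - (2 * m - x)) < d2).
      { replace (2 * lam - x' - (2 * m - x)) with (2 * (lam - m) - (x' - x)) by ring.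
        eapply Rle_lt_trans; [apply Rabs_triang|].
        rewrite Rabs_Ropp, Rabs_mult, (Rabs_pos_eq 2) by lra. lra. }
      specialize (Hd1 x' y' ltac:(lra) ltac:(lra)). specialize (Hd2 _ y' Ht ltac:(lra)).
      apply Rabs_lt_between in Hd1. apply Rabs_lt_between in Hd2. unfold e in *. lra.
    (* At the line a violating point and its reflection collapse together. By continuity [su1 > 0]
       on the whole segment joining them, which orders their values the other way. *)
    + assert (Exm : 2 * m - x = x) by lra.
      assert (Hpos : 0 < su1 s x y).
      { assert (H : 0 < su1 s x y + su1 s (2 * m - x) y).
        { apply (reflection_hopf s m x y (conj Hm Hxm) Hn'); [now rewrite Exm|].
          intros a b Ha Hb. apply Hstrict; auto. lra. }
        rewrite Exm in H. lra. }
      destruct (locally_2d_and _ _ _ _ (nz_locally _ _ Hn) (locally_2d_ge_of_continuity _ _ _ 0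
        (diff2_continuity _ _ _ _ _ (s_diff1 s x y Hn)) Hpos)) as [d Hd].
      assert (P := cond_pos d).
      destruct (Hseq (d / 3) ltac:(lra)) as [lam [x' [y' [H1 [H2 [H3 [H4 [H5 H6]]]]]]]].
      apply Rabs_lt_between in H2.
      assert (Hseg : forall t, 2 * lam - x' <= t <= x' -> nz t y' /\ 0 < su1 s t y').
      { intros t Ht. apply Hd; [|lra]. apply Rabs_lt_between. lra. }
      assert (H : 0 * (x' - (2 * lam - x')) <= su s x' y' - su s (2 * lam - x') y').
      { apply (mvt_ge (fun t => su s t y') (fun t => su1 s t y')); [lra| |].
        - intros t Ht. eapply diff2_fst, s_diff. now apply Hseg.
        - intros t Ht. now apply Rlt_le, Hseg. }
      lra.
Qed.

(** Let [m] be the supremum of the bad positions. All positions beyond [m] are good, [m] is good by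
    continuity, and then so are those slightly below it, which contradicts the choice of [m]. *)
Lemma reflection_le_all (s : stream) (lam : R) : 0 < lam -> reflection_le s lam.
Proof.
  intro Hlam. apply NNPP. intro Hbad.
  destruct (reflection_start s) as [R0 [HR0 Hstart]].
  destruct (completeness (fun l => ~ reflection_le s l)) as [m [Hub Hlub]].
  - exists R0. intros l Hl. apply Rnot_lt_le. intro H. apply Hl. intros x y Hx Hn.
    apply Rlt_le, Hstart; auto. lra.
  - now exists lam.
  - assert (Hm : lam <= m) by now apply Hub.
    assert (Hgood : forall l, m < l -> reflection_le s l).
    { intros l Hl. apply NNPP. intro H. specialize (Hub l H). lra. }
    assert (Hle : reflection_le s m).
    { intros x y Hx Hn. apply Rnot_lt_le. intro Hlt.
      destruct (su_continuity s _ _ Hn (mkposreal (su s (2 * m - x) y - su s x y) ltac:(lra))) as [d Hd].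
      destruct (nz_locally _ _ Hn) as [d' Hd'].
      simpl in Hd. assert (P := cond_pos d). assert (P' := cond_pos d').
      pose (e := Rmin (Rmin d d' / 4) ((x - m) / 2)).
      assert (He : 0 < e).
      { assert (0 < Rmin d d') by (now apply Rmin_glb_lt). apply Rmin_glb_lt; lra. }
      assert (M1 := Rmin_l (Rmin d d' / 4) ((x - m) / 2)). assert (M2 := Rmin_r (Rmin d d' / 4) ((x - m) / 2)).
      assert (M3 := Rmin_l d d'). assert (M4 := Rmin_r d d'). fold e in M1, M2.
      assert (Hdist : Rabs (2 * (m + e) - x - (2 * m - x)) < Rmin d d').
      { replace (2 * (m + e) - x - (2 * m - x)) with (2 * e) by ring. rewrite Rabs_pos_eq; lra. }
      assert (Hy : Rabs (y - y) < Rmin d d') by (rewrite Rminus_diag, Rabs_R0; lra).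
      specialize (Hd (2 * (m + e) - x) y ltac:(lra) ltac:(lra)).
      specialize (Hd' (2 * (m + e) - x) y ltac:(lra) ltac:(lra)).
      assert (G := Hgood (m + e) ltac:(lra) x y ltac:(lra) Hd').
      apply Rabs_lt_between in Hd. lra. }
    destruct (reflection_le_open s m ltac:(lra) Hle) as [d [Hd Hopen]].
    assert (m <= m - d); [|lra].
    apply Hlub. intros l Hl. apply Rnot_lt_le. intro H. apply Hl.
    destruct (Rle_dec l m); [apply Hopen|apply Hgood]; lra.
Qed.

(** On the line at [lam > 0] the difference vanishes and is nonnegative to the right, so its
    derivative [2 * su1] is nonnegative; then let [lam] tend to [0]. The condition on [y] keeps the
    horizontal line off the origin. *)
Lemma su1_axis_ge0 (s : stream) (y : R) : y <> 0 -> 0 <= su1 s 0 y.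
Proof.
  intro Hy. assert (Hnz : forall x, nz x y) by (intro x; unfold nz; assert (0 < y * y) by nra; nra).
  assert (Hpos : forall lam, 0 < lam -> 0 <= su1 s lam y).
  { intros lam Hlam. assert (H : 0 <= su1 s lam y - - su1 s lam y); [|lra].
    apply (is_derive_ge_right (fun t => su s t y - su s (2 * lam - t) y) lam).
    - apply (is_derive_minus (fun t => su s t y) (fun t => su s (2 * lam - t) y)).
      + eapply diff2_fst, s_diff, Hnz.
      + apply (is_derive_reflect (su s) lam lam y (su1 s lam y) (su2 s lam y)).
        replace (2 * lam - lam) with lam by ring. apply s_diff, Hnz.
    - exists 1. split; [lra|]. intros t Ht.
      assert (H := reflection_le_all s lam Hlam (lam + t) y ltac:(lra) (Hnz _)).
      replace (2 * lam - lam) with lam by ring. lra. }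
  apply Rnot_lt_le. intro Hlt.
  assert (Hneg : 0 < - su1 s 0 y) by lra.
  destruct (locally_2d_ge_of_continuity (fun a b => - su1 s a b) 0 y 0
    (continuity_2d_pt_opp _ _ _ (diff2_continuity _ _ _ _ _ (s_diff1 s 0 y (Hnz 0)))) Hneg) as [d Hd].
  assert (P := cond_pos d).
  specialize (Hd (d / 2) y). rewrite Rminus_0_r, Rminus_diag, Rabs_R0, Rabs_pos_eq in Hd by lra.
  specialize (Hpos (d / 2) ltac:(lra)). specialize (Hd ltac:(lra) P). lra.
Qed.

(** * Radial symmetry *)

Lemma diff2_linear (k l x y : R) : diff2 (fun u v => k * u + l * v) x y k l.
Proof.
  intro eps. exists eps. intros u v _ _.
  replace (k * u + l * v - (k * x + l * y) - (k * (u - x) + l * (v - y))) with 0 by ring.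
  rewrite Rabs_R0. apply Rmult_le_pos; [apply Rlt_le, cond_pos|].
  eapply Rle_trans; [apply Rabs_pos|apply Rmax_l].
Qed.

Lemma diff2_lincomb (f g : R -> R -> R) (k l x y a b c d : R) :
  diff2 f x y a b -> diff2 g x y c d ->
  diff2 (fun u v => k * f u v + l * g u v) x y (k * a + l * c) (k * b + l * d).
Proof.
  intros Hf Hg.
  exact (differentiable_pt_lim_comp (fun u v => k * u + l * v) f g x y _ _ _ _ _ _
    (diff2_linear k l _ _) Hf Hg).
Qed.

Lemma diff2_rotate (f : R -> R -> R) (c q x y a b : R) :
  diff2 f (c * x + - q * y) (q * x + c * y) a b ->
  diff2 (fun u v => f (c * u + - q * v) (q * u + c * v)) x y (c * a + q * b) (- q * a + c * b).
Proof.
  intro H.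
  replace (c * a + q * b) with (a * c + b * q) by ring.
  replace (- q * a + c * b) with (a * - q + b * c) by ring.
  exact (differentiable_pt_lim_comp f (fun u v => c * u + - q * v) (fun u v => q * u + c * v) x y
    _ _ _ _ _ _ H (diff2_linear c (- q) x y) (diff2_linear q c x y)).
Qed.

Lemma continuity_2d_rotate (f : R -> R -> R) (c q x y : R) :
  continuity_2d_pt f (c * x + - q * y) (q * x + c * y) ->
  continuity_2d_pt (fun u v => f (c * u + - q * v) (q * u + c * v)) x y.
Proof.
  intro H. apply continuity_2d_pt_filterlim. apply continuity_2d_pt_filterlim in H.
  assert (L1 := diff2_continuity _ _ _ _ _ (diff2_linear c (- q) x y)).
  assert (L2 := diff2_continuity _ _ _ _ _ (diff2_linear q c x y)).
  apply continuity_2d_pt_filterlim in L1. apply continuity_2d_pt_filterlim in L2.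
  apply (continuous_comp_2 (fun z : R * R => c * fst z + - q * snd z)
    (fun z : R * R => q * fst z + c * snd z) f (x, y)); auto.
Qed.

Lemma nrm_rotate (c q x y : R) :
  c ^ 2 + q ^ 2 = 1 -> nrm (c * x + - q * y) (q * x + c * y) = nrm x y.
Proof.
  intro H. unfold nrm. f_equal.
  transitivity ((c ^ 2 + q ^ 2) * (x ^ 2 + y ^ 2)); [ring|rewrite H; ring].
Qed.

(** Norm, Laplacian and the transport bracket are invariant under rotation. Only [su1] is described
    in the conclusion, as it is the quantity whose sign is known on the axis. *)
Lemma stream_rotate (s : stream) (c q : R) :
  c ^ 2 + q ^ 2 = 1 -> exists s', forall x y,
    su1 s' x y = c * su1 s (c * x + - q * y) (q * x + c * y) + q * su2 s (c * x + - q * y) (q * x + c * y).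
Proof.
  intro Hcq.
  pose (rot := fun (f : R -> R -> R) x y => f (c * x + - q * y) (q * x + c * y)).
  assert (Hnz : forall x y, nz x y -> nz (c * x + - q * y) (q * x + c * y)).
  { intros x y H. apply nz_nrm. rewrite nrm_rotate by auto. now apply nz_nrm. }
  assert (Hrot : forall (f : R -> R -> R) x y, continuity_2d_pt f (c * x + - q * y) (q * x + c * y) ->
    continuity_2d_pt (rot f) x y) by (intros f x y; exact (continuity_2d_rotate f c q x y)).
  assert (Hdrot : forall (f : R -> R -> R) x y a b, diff2 f (c * x + - q * y) (q * x + c * y) a b ->
    diff2 (rot f) x y (c * a + q * b) (- q * a + c * b)) by (intros f x y; exact (diff2_rotate f c q x y)).
  assert (Hlin : forall (f g : R -> R -> R) k l x y, continuity_2d_pt f x y -> continuity_2d_pt g x y ->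
    continuity_2d_pt (fun u v => k * f u v + l * g u v) x y).
  { intros f g k l x y Hf Hg. apply continuity_2d_pt_plus;
      (apply continuity_2d_pt_mult; [apply continuity_2d_pt_const|assumption]). }
  unshelve eexists (Stream (rot (su s))
    (fun x y => c * rot (su1 s) x y + q * rot (su2 s) x y)
    (fun x y => - q * rot (su1 s) x y + c * rot (su2 s) x y)
    (fun x y => c * (c * rot (su11 s) x y + q * rot (su12 s) x y) + q * (c * rot (su12 s) x y + q * rot (su22 s) x y))
    (fun x y => c * (- q * rot (su11 s) x y + c * rot (su12 s) x y) + q * (- q * rot (su12 s) x y + c * rot (su22 s) x y))
    (fun x y => - q * (- q * rot (su11 s) x y + c * rot (su12 s) x y) + c * (- q * rot (su12 s) x y + c * rot (su22 s) x y))
    (fun x y => c * rot (sw1 s) x y + q * rot (sw2 s) x y)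
    (fun x y => - q * rot (sw1 s) x y + c * rot (sw2 s) x y) _ _ _ _ _ _ _ _ _ _ _ _ _ _).
  - intros x y H. exact (Hdrot _ _ _ _ _ (s_diff s _ _ (Hnz x y H))).
  - intros x y H. apply (diff2_lincomb (rot (su1 s)) (rot (su2 s)));
      [exact (Hdrot _ _ _ _ _ (s_diff1 s _ _ (Hnz x y H)))|exact (Hdrot _ _ _ _ _ (s_diff2 s _ _ (Hnz x y H)))].
  - intros x y H.
    assert (D := diff2_lincomb _ _ (- q) c _ _ _ _ _ _
      (Hdrot _ _ _ _ _ (s_diff1 s _ _ (Hnz x y H))) (Hdrot _ _ _ _ _ (s_diff2 s _ _ (Hnz x y H)))).
    cbv beta. match type of D with diff2 _ _ _ ?p _ =>
      match goal with |- diff2 _ _ _ ?l _ => replace l with p by (unfold rot; ring) end end.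
    exact D.
  - intros x y H. apply differentiable_pt_lim_ext with (rot (vort s)).
    + apply locally_2d_forall. intros a b. unfold rot, vort.
      transitivity ((c ^ 2 + q ^ 2) * (su11 s (c * a + - q * b) (q * a + c * b) + su22 s (c * a + - q * b) (q * a + c * b)));
        [rewrite Hcq; ring|ring].
    + exact (Hdrot _ _ _ _ _ (s_diffw s _ _ (Hnz x y H))).
  - intros x y H. apply Hlin; apply (Hlin (rot _) (rot _)); apply Hrot;
      (apply s_cont11 || apply s_cont12 || apply s_cont22); apply Hnz, H.
  - intros x y H. apply Hlin; apply (Hlin (rot _) (rot _)); apply Hrot;
      (apply s_cont11 || apply s_cont12 || apply s_cont22); apply Hnz, H.
  - intros x y H. apply Hlin; apply (Hlin (rot _) (rot _)); apply Hrot;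
      (apply s_cont11 || apply s_cont12 || apply s_cont22); apply Hnz, H.
  - intros x y H. apply (Hlin (rot _) (rot _)); apply Hrot; [apply s_contw1|apply s_contw2]; apply Hnz, H.
  - intros x y H. apply (Hlin (rot _) (rot _)); apply Hrot; [apply s_contw1|apply s_contw2]; apply Hnz, H.
  - intros x y H. assert (E := s_transport s _ _ (Hnz x y H)). unfold rot.
    match goal with |- ?l = ?r => apply Rminus_diag_uniq; transitivity
      ((c ^ 2 + q ^ 2) * (su1 s (c * x + - q * y) (q * x + c * y) * sw2 s (c * x + - q * y) (q * x + c * y) -
       su2 s (c * x + - q * y) (q * x + c * y) * sw1 s (c * x + - q * y) (q * x + c * y))) end; [ring|].
    rewrite E. ring.
  - intros x y H. unfold rot.
    destruct (s_nonstag s _ _ (Hnz x y H)) as [N|N]; apply NNPP; intro Hno; apply N.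
    + assert (A1 : c * su1 s (c * x + - q * y) (q * x + c * y) + q * su2 s (c * x + - q * y) (q * x + c * y) = 0) by (apply NNPP; tauto).
      assert (A2 : - q * su1 s (c * x + - q * y) (q * x + c * y) + c * su2 s (c * x + - q * y) (q * x + c * y) = 0) by (apply NNPP; tauto).
      rewrite <- (Rmult_1_l (su1 s _ _)), <- Hcq.
      match type of A1 with ?p = 0 => match type of A2 with ?p' = 0 =>
        transitivity (c * p - q * p'); [ring|rewrite A1, A2; ring] end end.
    + assert (A1 : c * su1 s (c * x + - q * y) (q * x + c * y) + q * su2 s (c * x + - q * y) (q * x + c * y) = 0) by (apply NNPP; tauto).
      assert (A2 : - q * su1 s (c * x + - q * y) (q * x + c * y) + c * su2 s (c * x + - q * y) (q * x + c * y) = 0) by (apply NNPP; tauto).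
      rewrite <- (Rmult_1_l (su2 s _ _)), <- Hcq.
      match type of A1 with ?p = 0 => match type of A2 with ?p' = 0 =>
        transitivity (q * p + c * p'); [ring|rewrite A1, A2; ring] end end.
  - destruct (s_radial s) as [eta [R0 [He [HR H]]]]. exists eta, R0. repeat split; auto.
    intros x y Hxy. rewrite <- (nrm_rotate c q x y Hcq) in *.
    specialize (H _ _ Hxy). unfold rot. lra.
  - intros eps He. destruct (s_tangential s eps He) as [R0 [HR H]]. exists R0. split; auto.
    intros x y Hxy. rewrite <- (nrm_rotate c q x y Hcq) in Hxy. specialize (H _ _ Hxy). unfold rot.
    match goal with |- Rabs ?t <= _ => match type of H with Rabs ?t' <= _ => replace t with t' by ring end end.
    exact H.
  - intros eps d He Hd. destruct (s_origin s eps d He Hd) as [r [Hr H]]. exists r. split; auto.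
    intros x y x' y' E E'. apply H; rewrite nrm_rotate; auto.
  - intros x y. reflexivity.
Qed.

(** Two frames differing by a half turn place [(x, y)] on the vertical axis, at heights [r] and
    [- r]. The first derivative in these frames is the angular derivative up to opposite signs, so
    both inequalities together give equality. *)
Lemma stream_circular (s : stream) (x y : R) : nz x y -> x * su2 s x y = y * su1 s x y.
Proof.
  intro Hn. assert (Hr := proj1 (nz_nrm x y) Hn). pose (r := nrm x y). fold r in Hr.
  assert (Er := nrm_sqr x y). fold r in Er.
  assert (Hcq : (y / r) ^ 2 + (- (x / r)) ^ 2 = 1).
  { transitivity ((x ^ 2 + y ^ 2) / r ^ 2); [field; lra|rewrite <- Er; field; lra]. }
  assert (Hcq' : (- (y / r)) ^ 2 + (x / r) ^ 2 = 1) by (rewrite <- Hcq; ring).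
  destruct (stream_rotate s _ _ Hcq) as [s1 H1]. destruct (stream_rotate s _ _ Hcq') as [s2 H2].
  assert (P1 := su1_axis_ge0 s1 r ltac:(lra)). rewrite H1 in P1.
  assert (P2 := su1_axis_ge0 s2 (- r) ltac:(lra)). rewrite H2 in P2.
  replace (y / r * 0 + - - (x / r) * r) with x in P1 by (field; lra).
  replace (- (x / r) * 0 + y / r * r) with y in P1 by (field; lra).
  replace (- (y / r) * 0 + - (x / r) * - r) with x in P2 by (field; lra).
  replace (x / r * 0 + - (y / r) * - r) with y in P2 by (field; lra).
  assert (Q1 : 0 <= (y * su1 s x y - x * su2 s x y) / r).
  { eapply Rle_trans; [exact P1|]. apply Req_le. field. lra. }
  assert (Q2 : 0 <= - ((y * su1 s x y - x * su2 s x y) / r)).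
  { eapply Rle_trans; [exact P2|]. apply Req_le. field. lra. }
  assert (Q : (y * su1 s x y - x * su2 s x y) / r = 0) by lra.
  assert (E : y * su1 s x y - x * su2 s x y = (y * su1 s x y - x * su2 s x y) / r * r) by (field; lra).
  rewrite Q in E. lra.
Qed.

(** With zero angular derivative [su] depends on the radius alone, so the radial derivative along
    any ray equals the one along the positive horizontal axis. *)
Lemma stream_gradient_radial (s : stream) (x y : R) :
  nz x y -> su1 s x y = su1 s (nrm x y) 0 * (x / nrm x y) /\
            su2 s x y = su1 s (nrm x y) 0 * (y / nrm x y).
Proof.
  intro Hn. assert (Hr := proj1 (nz_nrm x y) Hn).
  destruct (polar x y Hn) as [t [_ [Ex Ey]]].
  assert (Er := nrm_sqr x y).
  set (r := nrm x y) in *.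
  assert (Hrad : forall q, 0 < q -> su s (q * cos t) (q * sin t) = su s q 0).
  { intros q Hq. transitivity (su s (q * cos 0) (q * sin 0)).
    2:{ rewrite cos_0, sin_0. f_equal; ring. }
    apply (derive_zero_const (fun p => su s (q * cos p) (q * sin p))). intros p _.
    assert (E := stream_circular s _ _ (nz_polar q p Hq)).
    replace 0 with (q * cos p * su2 s (q * cos p) (q * sin p) - q * sin p * su1 s (q * cos p) (q * sin p))
      by (rewrite E; ring).
    now apply is_derive_arc, s_diff, nz_polar. }
  assert (D1 : is_derive (fun q => su s (q * cos t) (q * sin t)) r
    (su1 s x y * cos t + su2 s x y * sin t)).
  { apply is_derive_ray. rewrite <- Ex, <- Ey. now apply s_diff. }
  assert (D2 : is_derive (fun q => su s (q * cos t) (q * sin t)) r (su1 s r 0)).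
  { apply (is_derive_ext_loc (fun q => su s q 0)).
    - apply (filter_imp (fun q => 0 < q)); [intros q Hq; symmetry; now apply Hrad|].
      now apply open_gt.
    - eapply diff2_fst, s_diff. unfold nz. nra. }
  apply is_derive_unique in D1. apply is_derive_unique in D2. rewrite D1 in D2.
  assert (E := stream_circular s x y Hn).
  assert (Ec : cos t = x / r) by (rewrite Ex; field; lra).
  assert (Es : sin t = y / r) by (rewrite Ey; field; lra).
  rewrite <- D2, Ec, Es.
  assert (Hone : (x * x + y * y) / (r * r) = 1) by (replace (x * x + y * y) with (r * r) by nra; field; lra).
  split.
  - transitivity (su1 s x y * ((x * x + y * y) / (r * r))); [rewrite Hone; ring|].
    transitivity ((su1 s x y * x * x + y * (y * su1 s x y)) / (r * r)); [field; lra|].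
    rewrite <- E. field. lra.
  - transitivity (su2 s x y * ((x * x + y * y) / (r * r))); [rewrite Hone; ring|].
    transitivity ((x * (x * su2 s x y) + su2 s x y * y * y) / (r * r)); [field; lra|].
    rewrite E. field. lra.
Qed.

(** * Constant signs and symmetry of second derivatives *)

Lemma no_sign_change (f : R -> R) (a b : R) :
  (forall t, Rmin a b <= t <= Rmax a b -> continuous f t /\ f t <> 0) -> 0 < f a -> 0 < f b.
Proof.
  intros H Ha. apply Rnot_le_lt. intro Hb.
  assert (Hfb : f b < 0).
  { destruct (Req_dec (f b) 0) as [E|]; [|lra]. exfalso. apply (H b); auto. apply Rmin_Rmax_r. }
  destruct (Rtotal_order a b) as [Hab|[->|Hab]]; [|lra|].
  - rewrite Rmin_left, Rmax_right in H by lra.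
    destruct (Ranalysis5.IVT_interv (fun t => - f t) a b) as [t [Ht E]]; try lra.
    + intros t Ht. apply continuity_pt_filterlim. apply (continuous_opp f), H, Ht.
    + apply (H t Ht). lra.
  - rewrite Rmin_right, Rmax_left in H by lra.
    destruct (Ranalysis5.IVT_interv f b a) as [t [Ht E]]; try lra.
    + intros t Ht. apply continuity_pt_filterlim, H, Ht.
    + now apply (H t Ht).
Qed.

Lemma exterior_sign (g : R -> R -> R) (R0 : R) :
  0 < R0 ->
  (forall x y, R0 <= nrm x y -> continuity_2d_pt g x y /\ g x y <> 0) ->
  (forall x y, R0 <= nrm x y -> 0 < g x y) \/ (forall x y, R0 <= nrm x y -> 0 < - g x y).
Proof.
  intros HR.
  assert (K : forall g : R -> R -> R, (forall x y, R0 <= nrm x y -> continuity_2d_pt g x y /\ g x y <> 0) ->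
    0 < g R0 0 -> forall x y, R0 <= nrm x y -> 0 < g x y).
  { clear g. intros g Hg H0 x y Hxy.
    destruct (polar x y) as [t [_ [Ex Ey]]]; [apply nz_nrm; lra|].
    set (r := nrm x y) in *.
    assert (Hk : forall k, 0 <= k <= 1 -> R0 <= R0 + k * (r - R0)) by (intros; nra).
    (* A spiral, with radius and angle both affine in [k], joins [(R0, 0)] to [(x, y)] without
       leaving the exterior region. *)
    assert (H := no_sign_change (fun k => g ((R0 + k * (r - R0)) * cos (k * t)) ((R0 + k * (r - R0)) * sin (k * t))) 0 1).
    cbv beta in H. rewrite !Rmult_1_l in H. replace (R0 + (r - R0)) with r in H by ring.
    rewrite <- Ex, <- Ey in H.
    apply H.
    - rewrite Rmin_left, Rmax_right by lra. intros k Hk1.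
      assert (Hn : R0 <= nrm ((R0 + k * (r - R0)) * cos (k * t)) ((R0 + k * (r - R0)) * sin (k * t))).
      { specialize (Hk k Hk1). rewrite nrm_polar; lra. }
      split; [|now apply Hg].
      apply (continuous_path g (fun k => (R0 + k * (r - R0)) * cos (k * t)) (fun k => (R0 + k * (r - R0)) * sin (k * t))).
      + now apply Hg.
      + apply (ex_derive_continuous (fun k => (R0 + k * (r - R0)) * cos (k * t))). auto_derive. exact I.
      + apply (ex_derive_continuous (fun k => (R0 + k * (r - R0)) * sin (k * t))). auto_derive. exact I.
    - rewrite !Rmult_0_l, cos_0, sin_0, Rplus_0_r, Rmult_1_r, Rmult_0_r. exact H0. }
  intro Hg. assert (HR0 : R0 <= nrm R0 0) by (rewrite nrm_zero_r; apply Rle_abs).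
  destruct (Rlt_dec 0 (g R0 0)) as [H|H].
  - left. now apply K.
  - right. apply (K (fun x y => - g x y)).
    + intros x y Hxy. destruct (Hg x y Hxy). split; [now apply continuity_2d_pt_opp|lra].
    + destruct (Hg R0 0 HR0). lra.
Qed.

Lemma schwarz_diff2 (f P Q A a b B : R -> R -> R) :
  (forall x y, nz x y -> diff2 f x y (P x y) (Q x y)) ->
  (forall x y, nz x y -> diff2 P x y (a x y) (A x y)) ->
  (forall x y, nz x y -> diff2 Q x y (B x y) (b x y)) ->
  (forall x y, nz x y -> continuity_2d_pt A x y) ->
  (forall x y, nz x y -> continuity_2d_pt B x y) ->
  forall x y, nz x y -> A x y = B x y.
Proof.
  intros Hf HP HQ cA cB x y Hn.
  assert (EP : forall u v, nz u v -> Derive (fun t => f t v) u = P u v).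
  { intros u v H. exact (proj1 (differentiable_pt_lim_unique _ _ _ _ _ (Hf u v H))). }
  assert (EQ : forall u v, nz u v -> Derive (fun t => f u t) v = Q u v).
  { intros u v H. exact (proj2 (differentiable_pt_lim_unique _ _ _ _ _ (Hf u v H))). }
  assert (DB : forall u v, nz u v -> is_derive (fun z => Derive (fun t => f z t) v) u (B u v)).
  { intros u v H. apply (is_derive_ext_loc (fun z => Q z v)).
    - destruct (nz_locally u v H) as [d Hd]. exists d. intros z Hz. symmetry. apply EQ, Hd; auto.
      rewrite Rminus_diag, Rabs_R0. apply cond_pos.
    - eapply diff2_fst, HQ, H. }
  assert (DA : forall u v, nz u v -> is_derive (fun z => Derive (fun t => f t z) u) v (A u v)).
  { intros u v H. apply (is_derive_ext_loc (fun z => P u z)).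
    - destruct (nz_locally u v H) as [d Hd]. exists d. intros z Hz. symmetry. apply EP, Hd; auto.
      rewrite Rminus_diag, Rabs_R0. apply cond_pos.
    - eapply diff2_snd, HP, H. }
  rewrite <- (is_derive_unique _ _ _ (DA x y Hn)), <- (is_derive_unique _ _ _ (DB x y Hn)).
  symmetry. apply Schwarz.
  - apply locally_2d_impl with (2 := nz_locally _ _ Hn). apply locally_2d_forall. intros u v H.
    repeat split.
    + eexists. eapply diff2_fst, Hf, H.
    + eexists. eapply diff2_snd, Hf, H.
    + eexists. now apply DB.
    + eexists. now apply DA.
  - apply continuity_2d_pt_ext_loc with B; [|now apply cB].
    apply locally_2d_impl with (2 := nz_locally _ _ Hn). apply locally_2d_forall. intros u v H.
    symmetry. now apply is_derive_unique, DB.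
  - apply continuity_2d_pt_ext_loc with A; [|now apply cA].
    apply locally_2d_impl with (2 := nz_locally _ _ Hn). apply locally_2d_forall. intros u v H.
    symmetry. now apply is_derive_unique, DA.
Qed.

Lemma ex_diff_1_diff2 (f : R -> R -> R) :
  (forall x y, nz x y -> ex_diff_n f 1 x y) ->
  forall x y, nz x y ->
    diff2 f x y (Derive (fun t => f t y) x) (Derive (fun t => f x t) y) /\
    continuity_2d_pt (fun x y => Derive (fun t => f t y) x) x y /\
    continuity_2d_pt (fun x y => Derive (fun t => f x t) y) x y.
Proof.
  intros H x y Hn. assert (Hxy := H x y Hn). simpl in Hxy.
  destruct Hxy as [_ [_ [_ [[C1 _] [C2 _]]]]].
  split; [|now split].
  apply (diff2_of_partials f (fun x y => Derive (fun t => f t y) x) (fun x y => Derive (fun t => f x t) y)); auto.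
  apply locally_2d_impl with (2 := nz_locally _ _ Hn). apply locally_2d_forall. intros u v Huv.
  assert (E := H u v Huv). simpl in E. destruct E as [_ [E1 [E2 _]]].
  split; now apply Derive_correct.
Qed.

Lemma ex_diff_2_diff2 (f : R -> R -> R) :
  (forall x y, nz x y -> ex_diff_n f 2 x y) ->
  exists f1 f2 f11 f12 f22 : R -> R -> R, forall x y, nz x y ->
    diff2 f x y (f1 x y) (f2 x y) /\ diff2 f1 x y (f11 x y) (f12 x y) /\
    diff2 f2 x y (f12 x y) (f22 x y) /\ continuity_2d_pt f11 x y /\
    continuity_2d_pt f12 x y /\ continuity_2d_pt f22 x y.
Proof.
  intros H.
  pose (f1 := fun x y => Derive (fun t => f t y) x). pose (f2 := fun x y => Derive (fun t => f x t) y).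
  assert (H0 : forall x y, nz x y -> ex_diff_n f 1 x y).
  { intros x y Hn. destruct (H x y Hn) as [A [B [C [[D _] [E _]]]]]. simpl. tauto. }
  assert (H1 : forall x y, nz x y -> ex_diff_n f1 1 x y) by (intros x y Hn; apply (H x y Hn)).
  assert (H2 : forall x y, nz x y -> ex_diff_n f2 1 x y) by (intros x y Hn; apply (H x y Hn)).
  assert (D0 := ex_diff_1_diff2 f H0). assert (D1 := ex_diff_1_diff2 f1 H1).
  assert (D2 := ex_diff_1_diff2 f2 H2).
  assert (S : forall x y, nz x y -> Derive (fun t => f1 x t) y = Derive (fun t => f2 t y) x).
  { apply (schwarz_diff2 f f1 f2 (fun x y => Derive (fun t => f1 x t) y)
      (fun x y => Derive (fun t => f1 t y) x) (fun x y => Derive (fun t => f2 x t) y)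
      (fun x y => Derive (fun t => f2 t y) x)).
    - intros; now apply D0.
    - intros; now apply D1.
    - intros; now apply D2.
    - intros; now apply D1.
    - intros; now apply D2. }
  exists f1, f2, (fun x y => Derive (fun t => f1 t y) x), (fun x y => Derive (fun t => f1 x t) y),
    (fun x y => Derive (fun t => f2 x t) y).
  intros x y Hn. destruct (D0 x y Hn) as [A0 _]. destruct (D1 x y Hn) as [A1 [B1 C1]].
  destruct (D2 x y Hn) as [A2 [B2 C2]]. repeat split; auto.
  cbv beta. rewrite S by auto. exact A2.
Qed.

(** * The stream function of an Euler flow *)

Lemma punctured_plane_nz (x y : R) : punctured_plane (x, y) <-> nz x y.
Proof.
  unfold punctured_plane, nz. split.
  - intro H. destruct (Req_dec x 0) as [->|Hx].
    + destruct (Req_dec y 0) as [->|Hy]; [now exfalso|]. assert (0 < y * y) by nra. nra.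
    + assert (0 < x * x) by nra. nra.
  - intros H E. injection E. intros -> ->. lra.
Qed.

Lemma enorm_nrm (x y : R) : enorm (x, y) = nrm x y.
Proof. reflexivity. Qed.

Lemma liminf_infinity_pos (f : R * R -> R) :
  Rbar_lt 0 (liminf_infinity f) -> exists c A, 0 < c /\ forall x, A < enorm x -> c <= f x.
Proof.
  intro H. apply NNPP. intro Hno.
  assert (Hle : Rbar_le (liminf_infinity f) 0).
  { unfold liminf_infinity, Rbar_lub.
    destruct (Rbar_ex_lub (fun l => exists A : R,
      l = Glb_Rbar (fun y => exists x, A < enorm x /\ y = f x))) as [L [HL0 HL]]. simpl.
    apply HL. intros l [A ->].
    destruct (Glb_Rbar_correct (fun y => exists x, A < enorm x /\ y = f x)) as [Hlb _].
    destruct (Glb_Rbar (fun y => exists x, A < enorm x /\ y = f x)) as [g| |] eqn:E; simpl; auto.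
    - apply Rnot_lt_le. intro Hg. apply Hno. exists g, A. split; auto.
      intros x Hx. apply (Hlb (f x)). eauto.
    (* An infimum equal to [+oo] would contradict any real value, so the region beyond [A] has no
       point and the claim is vacuous. *)
    - apply Hno. exists 1, A. split; [lra|]. intros x Hx. destruct (Hlb (f x)). eauto. }
  now apply (Rbar_lt_not_le _ _ H).
Qed.

Lemma dot_e_r (w : R * R) (x y : R) :
  nz x y -> dot w (e_r (x, y)) = (x * fst w + y * snd w) / nrm x y.
Proof.
  intro H. apply nz_nrm in H. unfold dot, e_r. simpl fst. simpl snd. rewrite enorm_nrm.
  field. lra.
Qed.

Lemma polar_2PI (x y : R) :
  nz x y -> exists t, 0 <= t <= 2 * PI /\ x = nrm x y * cos t /\ y = nrm x y * sin t.
Proof.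
  intro H. destruct (polar x y H) as [t [Ht [Ex Ey]]]. assert (HP := PI_RGT_0).
  destruct (Rle_dec 0 t).
  - exists t. repeat split; auto; lra.
  - exists (t + 2 * PI). rewrite cos_plus, sin_plus, cos_2PI, sin_2PI.
    repeat split; lra.
Qed.

Lemma circle_oscillation (h P Q : R -> R -> R) (r : R) :
  0 < r ->
  (forall x y, nz x y -> diff2 h x y (P x y) (Q x y)) ->
  (forall x y, nz x y -> continuity_2d_pt P x y) ->
  (forall x y, nz x y -> continuity_2d_pt Q x y) ->
  forall x y x' y', nrm x y = r -> nrm x' y' = r ->
    Rabs (h x y - h x' y') <= RInt (fun t => Rabs (r * cos t * Q (r * cos t) (r * sin t) -
                 r * sin t * P (r * cos t) (r * sin t))) 0 (2 * PI).
Proof.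
  intros Hr Hh cP cQ.
  pose (F := fun t => r * cos t * Q (r * cos t) (r * sin t) - r * sin t * P (r * cos t) (r * sin t)).
  assert (cF : forall t, continuous F t).
  { intro t. assert (N := nz_polar r t Hr).
    assert (Cc : continuous (fun s => r * cos s) t).
    { apply (ex_derive_continuous (fun s => r * cos s)). eexists. apply is_derive_cos_scal. }
    assert (Cs : continuous (fun s => r * sin s) t).
    { apply (ex_derive_continuous (fun s => r * sin s)). eexists. apply is_derive_sin_scal. }
    apply (continuous_minus (fun s => r * cos s * Q (r * cos s) (r * sin s))
                            (fun s => r * sin s * P (r * cos s) (r * sin s))).
    - apply (continuous_mult (fun s => r * cos s)); auto.
      apply (continuous_path Q (fun s => r * cos s) (fun s => r * sin s)); auto.
    - apply (continuous_mult (fun s => r * sin s)); auto.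
      apply (continuous_path P (fun s => r * cos s) (fun s => r * sin s)); auto. }
  assert (iF : forall a b, ex_RInt F a b) by (intros; apply (ex_RInt_continuous F); intros; apply cF).
  assert (iA : forall a b, ex_RInt (fun t => Rabs (F t)) a b).
  { intros. apply (ex_RInt_continuous (fun t => Rabs (F t))). intros.
    apply (continuous_comp F Rabs); [apply cF|apply continuous_Rabs]. }
  assert (pA : forall a b, a <= b -> 0 <= RInt (fun t => Rabs (F t)) a b).
  { intros a b Hab. apply RInt_ge_0; auto. intros; apply Rabs_pos. }
  change (forall x y x' y', nrm x y = r -> nrm x' y' = r ->
    Rabs (h x y - h x' y') <= RInt (fun t => Rabs (F t)) 0 (2 * PI)).
  assert (Key : forall a b, 0 <= a <= b -> b <= 2 * PI ->
    Rabs (h (r * cos b) (r * sin b) - h (r * cos a) (r * sin a)) <= RInt (fun t => Rabs (F t)) 0 (2 * PI)).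
  { intros a b Hab Hb.
    assert (HI : is_RInt F a b (h (r * cos b) (r * sin b) - h (r * cos a) (r * sin a))).
    { apply potential_arc. intros t _. assert (N := nz_polar r t Hr). auto. }
    rewrite <- (is_RInt_unique _ _ _ _ HI).
    eapply Rle_trans; [apply abs_RInt_le; [lra|apply iF]|].
    rewrite <- (RInt_Chasles (fun t => Rabs (F t)) 0 a (2 * PI)) by apply iA.
    rewrite <- (RInt_Chasles (fun t => Rabs (F t)) a b (2 * PI)) by apply iA.
    assert (P1 := pA 0 a ltac:(lra)). assert (P2 := pA b (2 * PI) Hb).
    unfold plus. simpl. lra. }
  intros x y x' y' E E'.
  destruct (polar_2PI x y) as [t [Ht [Ex Ey]]]; [apply nz_nrm; lra|].
  destruct (polar_2PI x' y') as [t' [Ht' [Ex' Ey']]]; [apply nz_nrm; lra|].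
  rewrite E in Ex, Ey. rewrite E' in Ex', Ey'. rewrite Ex, Ey, Ex', Ey'.
  destruct (Rle_dec t t').
  - rewrite Rabs_minus_sym. apply Key; lra.
  - apply Key; lra.
Qed.

(** The pressure is only assumed C^1, but the equations express its partial derivatives through [v]
    and its gradient, which are C^1. Equality of the mixed derivatives is then the vorticity
    equation, up to the product of divergence and vorticity, which vanishes. *)
Lemma euler_vorticity_transport (v : R * R -> R * R) (p : R * R -> R)
  (f1 f2 g1 g2 g11 g12 g22 k1 k2 k11 k12 k22 : R -> R -> R) :
  (forall x y, v (x, y) = (f1 x y, f2 x y)) ->
  steady_euler punctured_plane v p ->
  (forall x y, nz x y ->
    diff2 f1 x y (g1 x y) (g2 x y) /\ diff2 g1 x y (g11 x y) (g12 x y) /\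
    diff2 g2 x y (g12 x y) (g22 x y) /\ continuity_2d_pt g11 x y /\
    continuity_2d_pt g12 x y /\ continuity_2d_pt g22 x y) ->
  (forall x y, nz x y ->
    diff2 f2 x y (k1 x y) (k2 x y) /\ diff2 k1 x y (k11 x y) (k12 x y) /\
    diff2 k2 x y (k12 x y) (k22 x y) /\ continuity_2d_pt k11 x y /\
    continuity_2d_pt k12 x y /\ continuity_2d_pt k22 x y) ->
  forall x y, nz x y -> g1 x y + k2 x y = 0 /\
    f1 x y * (k11 x y - g12 x y) + f2 x y * (k12 x y - g22 x y) = 0.
Proof.
  intros Hv [_ [Hp He]] Hg Hk.
  assert (D1 : forall x y, nz x y -> Defs.d1 (comp1 v) (x, y) = g1 x y /\ Defs.d2 (comp1 v) (x, y) = g2 x y).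
  { intros x y H. destruct (Hg x y H) as [D _].
    destruct (differentiable_pt_lim_unique _ _ _ _ _ D) as [E1 E2].
    unfold Defs.d1, Defs.d2, comp1. simpl. split; [rewrite <- E1|rewrite <- E2]; apply Derive_ext; intro t; now rewrite Hv. }
  assert (D2 : forall x y, nz x y -> Defs.d1 (comp2 v) (x, y) = k1 x y /\ Defs.d2 (comp2 v) (x, y) = k2 x y).
  { intros x y H. destruct (Hk x y H) as [D _].
    destruct (differentiable_pt_lim_unique _ _ _ _ _ D) as [E1 E2].
    unfold Defs.d1, Defs.d2, comp2. simpl. split; [rewrite <- E1|rewrite <- E2]; apply Derive_ext; intro t; now rewrite Hv. }
  pose (pc := fun x y => p (x, y)).
  assert (Hpc : forall x y, nz x y -> ex_diff_n pc 1 x y).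
  { intros x y H. apply (Hp (x, y)). now apply punctured_plane_nz. }
  pose (P := fun x y => -1 * (f1 x y * g1 x y + f2 x y * g2 x y)).
  pose (Q := fun x y => -1 * (f1 x y * k1 x y + f2 x y * k2 x y)).
  assert (HE : forall x y, nz x y -> Derive (fun t => pc t y) x = P x y /\
    Derive (fun t => pc x t) y = Q x y /\ g1 x y + k2 x y = 0).
  { intros x y H. destruct (He (x, y)) as [E1 E2]; [now apply punctured_plane_nz|].
    destruct (D1 x y H) as [A1 A2]. destruct (D2 x y H) as [B1 B2].
    unfold div in E2. rewrite A1, B2 in E2.
    unfold convection, grad, dot in E1. rewrite A1, A2, B1, B2, Hv in E1. simpl in E1.
    unfold plus in E1. simpl in E1. unfold prod_plus, plus in E1. simpl in E1.
    injection E1. intros Eb Ea. change (Defs.d1 p (x, y)) with (Derive (fun t => pc t y) x) in Ea.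
    change (Defs.d2 p (x, y)) with (Derive (fun t => pc x t) y) in Eb. unfold P, Q. lra. }
  assert (Dp : forall x y, nz x y -> diff2 pc x y (P x y) (Q x y)).
  { intros x y H. destruct (HE x y H) as [E1 [E2 _]]. rewrite <- E1, <- E2.
    now apply (ex_diff_1_diff2 pc Hpc). }
  assert (Hlin0 : forall (f : R -> R -> R) x y a b, diff2 f x y a b -> diff2 (fun x y => -1 * f x y) x y (-1 * a) (-1 * b)).
  { intros f x y a b H. assert (L := diff2_lincomb f f (-1) 0 _ _ _ _ _ _ H H).
    replace (-1 * a) with (-1 * a + 0 * a) by ring. replace (-1 * b) with (-1 * b + 0 * b) by ring.
    apply differentiable_pt_lim_ext with (2 := L). apply locally_2d_forall. intros; ring. }
  assert (Hsum : forall (f g : R -> R -> R) x y a b c d, diff2 f x y a b -> diff2 g x y c d ->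
    diff2 (fun x y => f x y + g x y) x y (a + c) (b + d)).
  { intros f g x y a b c d Hf Hg'. assert (L := diff2_lincomb f g 1 1 _ _ _ _ _ _ Hf Hg').
    rewrite !Rmult_1_l in L.
    apply differentiable_pt_lim_ext with (2 := L). apply locally_2d_forall. intros; ring. }
  assert (HP : forall x y, nz x y -> diff2 P x y _ _) by
    (intros x y H; destruct (Hg x y H) as [Df [Dg1 [Dg2 _]]]; destruct (Hk x y H) as [Df' _];
     exact (Hlin0 _ _ _ _ _ (Hsum _ _ _ _ _ _ _ _ (diff2_mult _ _ _ _ _ _ _ _ Df Dg1) (diff2_mult _ _ _ _ _ _ _ _ Df' Dg2)))).
  assert (HQ : forall x y, nz x y -> diff2 Q x y _ _) by
    (intros x y H; destruct (Hk x y H) as [Df' [Dk1 [Dk2 _]]]; destruct (Hg x y H) as [Df _];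
     exact (Hlin0 _ _ _ _ _ (Hsum _ _ _ _ _ _ _ _ (diff2_mult _ _ _ _ _ _ _ _ Df Dk1) (diff2_mult _ _ _ _ _ _ _ _ Df' Dk2)))).
  cbv beta in HP, HQ.
  assert (Hmul : forall (f g : R -> R -> R) x y, continuity_2d_pt f x y -> continuity_2d_pt g x y ->
    continuity_2d_pt (fun x y => f x y * g x y) x y) by (intros; now apply continuity_2d_pt_mult).
  assert (Hadd : forall (f g : R -> R -> R) x y, continuity_2d_pt f x y -> continuity_2d_pt g x y ->
    continuity_2d_pt (fun x y => f x y + g x y) x y) by (intros; now apply continuity_2d_pt_plus).
  assert (S := schwarz_diff2 pc P Q _ _ _ _ Dp HP HQ). cbv beta in S.
  intros x y H. destruct (HE x y H) as [_ [_ Ediv]]. split; auto.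
  assert (Sxy : -1 * (g2 x y * g1 x y + f1 x y * g12 x y + (k2 x y * g2 x y + f2 x y * g22 x y)) =
                -1 * (g1 x y * k1 x y + f1 x y * k11 x y + (k1 x y * k2 x y + f2 x y * k12 x y))).
  { apply S; auto.
    - intros a b Hab. destruct (Hg a b Hab) as [Df [Dg1 [Dg2 [C11 [C12 C22]]]]].
      destruct (Hk a b Hab) as [Df' [Dk1 [Dk2 [C11' [C12' C22']]]]].
      apply diff2_continuity in Df, Dg1, Dg2, Df', Dk1, Dk2.
      apply (Hmul (fun _ _ => -1)); [apply continuity_2d_pt_const|].
      apply Hadd; (apply Hadd; [now apply (Hmul _ _)|now apply (Hmul _ _)]).
    - intros a b Hab. destruct (Hg a b Hab) as [Df [Dg1 [Dg2 [C11 [C12 C22]]]]].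
      destruct (Hk a b Hab) as [Df' [Dk1 [Dk2 [C11' [C12' C22']]]]].
      apply diff2_continuity in Df, Dg1, Dg2, Df', Dk1, Dk2.
      apply (Hmul (fun _ _ => -1)); [apply continuity_2d_pt_const|].
      apply Hadd; (apply Hadd; [now apply (Hmul _ _)|now apply (Hmul _ _)]). }
  assert (E0 : (g1 x y + k2 x y) * (g2 x y - k1 x y) = 0) by (rewrite Ediv; ring).
  lra.
Qed.

Lemma diff2_scal (f : R -> R -> R) (k x y a b : R) :
  diff2 f x y a b -> diff2 (fun u v => k * f u v) x y (k * a) (k * b).
Proof.
  intro H. assert (L := diff2_lincomb f f k 0 _ _ _ _ _ _ H H).
  replace (k * a) with (k * a + 0 * a) by ring. replace (k * b) with (k * b + 0 * b) by ring.
  apply differentiable_pt_lim_ext with (2 := L). apply locally_2d_forall. intros; ring.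
Qed.

(** The squares of [x . v] and of [x1 v2 - x2 v1] add up to [|x|^2 |v|^2]. Far away the first is at
    most [(c |x| / 2)^2], so the second is at least that; it cannot vanish, and the exterior region
    being connected, its root keeps one sign. *)
Lemma azimuthal_sign (v : R * R -> R * R) (f1 f2 : R -> R -> R) (c A : R) :
  (forall x y, v (x, y) = (f1 x y, f2 x y)) ->
  (forall x y, nz x y -> continuity_2d_pt f1 x y) ->
  (forall x y, nz x y -> continuity_2d_pt f2 x y) ->
  0 < c -> (forall x, A < enorm x -> c <= enorm (v x)) ->
  is_domin at_infinity (fun x => 1 / enorm x) (fun x => dot (v x) (e_r x)) ->
  exists sg eta R0, (sg = 1 \/ sg = -1) /\ 0 < eta /\ 0 < R0 /\ forall x y, R0 <= nrm x y ->
    eta * nrm x y <= sg * (x * f2 x y - y * f1 x y).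
Proof.
  intros Hv c1 c2 Hc HA Hinf.
  destruct (Hinf (mkposreal (c / 2) ltac:(lra))) as [A' HA']. simpl in HA'.
  (* Having [|x| >= 1] turns the bound [c / 2] on [x . v] into [c / 2 * |x|]. *)
  pose (R0 := Rmax (Rmax A A') 1 + 1).
  assert (M1 := Rmax_l (Rmax A A') 1). assert (M2 := Rmax_r (Rmax A A') 1).
  assert (M3 := Rmax_l A A'). assert (M4 := Rmax_r A A').
  assert (HT : forall x y, R0 <= nrm x y -> c / 2 * nrm x y <= Rabs (x * f2 x y - y * f1 x y)).
  { intros x y Hxy. unfold R0 in Hxy.
    assert (B1 := HA (x, y)). rewrite enorm_nrm, Hv, enorm_nrm in B1. specialize (B1 ltac:(lra)).
    assert (B2 := HA' (x, y)). rewrite enorm_nrm in B2. specialize (B2 ltac:(lra)).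
    assert (N : nz x y) by (apply nz_nrm; lra).
    rewrite Hv, dot_e_r in B2 by auto. simpl in B2.
    change (Rabs ((x * f1 x y + y * f2 x y) / nrm x y) <= c / 2 * Rabs (1 / nrm x y)) in B2.
    unfold Rdiv in B2. rewrite !Rabs_mult, Rabs_R1, Rmult_1_l in B2.
    rewrite (Rabs_pos_eq (/ nrm x y)) in B2 by (apply Rlt_le, Rinv_0_lt_compat; lra).
    apply Rmult_le_reg_r in B2; [|apply Rinv_0_lt_compat; lra].
    assert (B3 : Rabs (x * f1 x y + y * f2 x y) <= c / 2 * nrm x y).
    { eapply Rle_trans; [exact B2|]. assert (c / 2 * 1 <= c / 2 * nrm x y) by (apply Rmult_le_compat_l; lra). lra. }
    rewrite <- (Rabs_pos_eq (c / 2 * nrm x y)) by (apply Rmult_le_pos; lra).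
    apply Rsqr_le_abs_0.
    assert (B4 := Rsqr_le_abs_1 (x * f1 x y + y * f2 x y) (c / 2 * nrm x y)).
    rewrite (Rabs_pos_eq (c / 2 * nrm x y)) in B4 by (apply Rmult_le_pos; lra). specialize (B4 B3).
    assert (B5 : c ^ 2 <= nrm (f1 x y) (f2 x y) ^ 2) by (apply pow_incr; lra).
    assert (E1 := nrm_sqr (f1 x y) (f2 x y)). assert (E2 := nrm_sqr x y).
    assert (B6 : nrm x y ^ 2 * c ^ 2 <= nrm x y ^ 2 * nrm (f1 x y) (f2 x y) ^ 2).
    { apply Rmult_le_compat_l; [apply pow2_ge_0|exact B5]. }
    assert (B7 : 0 <= nrm x y ^ 2 * c ^ 2) by (apply Rmult_le_pos; apply pow2_ge_0).
    assert (E3 : (x * f2 x y - y * f1 x y) ^ 2 + (x * f1 x y + y * f2 x y) ^ 2 = nrm x y ^ 2 * nrm (f1 x y) (f2 x y) ^ 2).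
    { rewrite E1, E2. ring. }
    unfold Rsqr in *. nra. }
  destruct (exterior_sign (fun x y => x * f2 x y - y * f1 x y) R0) as [Hs|Hs].
  - unfold R0. lra.
  - intros x y Hxy. assert (N : nz x y) by (apply nz_nrm; unfold R0 in Hxy; lra). split.
    + apply continuity_2d_pt_minus; apply continuity_2d_pt_mult; auto;
        [apply continuity_2d_pt_id1|apply continuity_2d_pt_id2].
    + intro E. specialize (HT x y Hxy). rewrite E, Rabs_R0 in HT.
      assert (0 < c / 2 * nrm x y) by (apply Rmult_lt_0_compat; unfold R0 in Hxy; lra). lra.
  - exists 1, (c / 2), R0. repeat split; auto; try lra; [unfold R0; lra|].
    intros x y Hxy. specialize (HT x y Hxy). specialize (Hs x y Hxy).
    rewrite Rabs_pos_eq in HT by lra. lra.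
  - exists (-1), (c / 2), R0. repeat split; auto; try lra; [unfold R0; lra|].
    intros x y Hxy. specialize (HT x y Hxy). specialize (Hs x y Hxy).
    rewrite Rabs_left in HT by lra. lra.
Qed.

(** On circles the angular derivative of the potential is, up to sign, [r] times the radial
    velocity. The hypothesis on small circles therefore gives both the vanishing circulation, hence
    the potential, and [s_origin]; the decay at infinity gives [s_tangential]. *)
Lemma euler_stream (v : R * R -> R * R) (p : R * R -> R)
  (f1 f2 g1 g2 g11 g12 g22 k1 k2 k11 k12 k22 : R -> R -> R) :
  (forall x y, v (x, y) = (f1 x y, f2 x y)) ->
  steady_euler punctured_plane v p ->
  (forall x y, nz x y ->
    diff2 f1 x y (g1 x y) (g2 x y) /\ diff2 g1 x y (g11 x y) (g12 x y) /\
    diff2 g2 x y (g12 x y) (g22 x y) /\ continuity_2d_pt g11 x y /\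
    continuity_2d_pt g12 x y /\ continuity_2d_pt g22 x y) ->
  (forall x y, nz x y ->
    diff2 f2 x y (k1 x y) (k2 x y) /\ diff2 k1 x y (k11 x y) (k12 x y) /\
    diff2 k2 x y (k12 x y) (k22 x y) /\ continuity_2d_pt k11 x y /\
    continuity_2d_pt k12 x y /\ continuity_2d_pt k22 x y) ->
  (forall x, punctured_plane x -> 0 < enorm (v x)) ->
  Rbar_lt 0 (liminf_infinity (fun x => enorm (v x))) ->
  is_domin at_infinity (fun x => 1 / enorm x) (fun x => dot (v x) (e_r x)) ->
  filterlim (circle_integral (fun x => Rabs (dot (v x) (e_r x)))) (at_right 0) (locally 0) ->
  exists sg s, (sg = 1 \/ sg = -1) /\ forall x y, su1 s x y = sg * f2 x y /\ su2 s x y = - sg * f1 x y.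
Proof.
  intros Hv He Hg Hk Hnz Hlim Hinf Hor.
  assert (HT := euler_vorticity_transport v p _ _ _ _ _ _ _ _ _ _ _ _ Hv He Hg Hk).
  assert (cf1 : forall x y, nz x y -> continuity_2d_pt f1 x y).
  { intros x y H. eapply diff2_continuity. apply (Hg x y H). }
  assert (cf2 : forall x y, nz x y -> continuity_2d_pt f2 x y).
  { intros x y H. eapply diff2_continuity. apply (Hk x y H). }
  destruct (liminf_infinity_pos _ Hlim) as [c [A [Hc HA]]].
  destruct (azimuthal_sign v f1 f2 c A Hv cf1 cf2 Hc HA Hinf) as [sg [eta [R0 [Hsg [Heta [HR0 Hrad]]]]]].
  assert (Hsg1 : Rabs sg = 1).
  { destruct Hsg as [->| ->]; [apply Rabs_R1|rewrite Rabs_left; lra]. }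
  (* The form is exact up to circulation because [v] is divergence free; [sg] makes its potential
     increase radially at infinity. *)
  pose (P := fun x y => sg * f2 x y). pose (Q := fun x y => - sg * f1 x y).
  assert (DP : forall x y, nz x y -> diff2 P x y (sg * k1 x y) (sg * k2 x y)).
  { intros x y H. apply diff2_scal, (Hk x y H). }
  assert (DQ : forall x y, nz x y -> diff2 Q x y (sg * k2 x y) (- sg * g2 x y)).
  { intros x y H. replace (sg * k2 x y) with (- sg * g1 x y).
    - apply diff2_scal, (Hg x y H).
    - destruct (HT x y H) as [E _]. replace (k2 x y) with (- g1 x y) by lra. ring. }
  assert (cP : forall x y, nz x y -> continuity_2d_pt P x y).
  { intros x y H. eapply diff2_continuity, DP, H. }
  assert (cQ : forall x y, nz x y -> continuity_2d_pt Q x y).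
  { intros x y H. eapply diff2_continuity, DQ, H. }
  assert (Hsc : forall (f : R -> R -> R) k x y, continuity_2d_pt f x y -> continuity_2d_pt (fun x y => k * f x y) x y).
  { intros. apply continuity_2d_pt_mult; auto. apply continuity_2d_pt_const. }
  assert (HCI : forall r, 0 < r -> circle_integral (fun x => Rabs (dot (v x) (e_r x))) r =
    RInt (fun t => Rabs (r * cos t * Q (r * cos t) (r * sin t) - r * sin t * P (r * cos t) (r * sin t))) 0 (2 * PI)).
  { intros r Hr. unfold circle_integral. apply RInt_ext. intros t _.
    rewrite Hv, dot_e_r by now apply nz_polar. rewrite nrm_polar by lra. simpl fst. simpl snd.
    unfold P, Q.
    match goal with |- @eq _ ?l ?q => change (@eq R l q) end.
    set (a := f1 (r * cos t) (r * sin t)). set (b := f2 (r * cos t) (r * sin t)).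
    replace (r * cos t * (- sg * a) - r * sin t * (sg * b)) with (- (sg * (r * cos t * a + r * sin t * b))) by ring.
    rewrite Rabs_Ropp, (Rabs_mult sg), Hsg1, Rmult_1_l. unfold Rdiv.
    rewrite Rabs_mult, (Rabs_pos_eq (/ r)) by (apply Rlt_le, Rinv_0_lt_compat; lra). field. lra. }
  assert (Hsmall : forall eps d, 0 < eps -> 0 < d -> exists r, 0 < r < d /\
    RInt (fun t => Rabs (r * cos t * Q (r * cos t) (r * sin t) - r * sin t * P (r * cos t) (r * sin t))) 0 (2 * PI) <= eps).
  { intros eps d Heps Hd.
    assert (Hl := Hor (fun z => Rabs (z - 0) < eps)).
    destruct Hl as [e Hl]. { exists (mkposreal _ Heps). intros z Hz. exact Hz. }
    assert (He0 := cond_pos e). assert (Hm : 0 < Rmin d e) by (now apply Rmin_glb_lt).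
    assert (M1 := Rmin_l d e). assert (M2 := Rmin_r d e).
    exists (Rmin d e / 2). split; [lra|]. rewrite <- HCI by lra.
    assert (Hq : Rabs (circle_integral (fun x => Rabs (dot (v x) (e_r x))) (Rmin d e / 2) - 0) < eps).
    { apply Hl; [|lra]. change (Rabs (Rmin d e / 2 - 0) < e). rewrite Rabs_pos_eq; lra. }
    rewrite Rminus_0_r in Hq. apply Rabs_lt_between in Hq. lra. }
  destruct (potential P Q (fun x y => sg * k2 x y)) as [h Hh]; auto.
  { intros x y H. eapply diff2_snd, DP, H. }
  { intros x y H. eapply diff2_fst, DQ, H. }
  { intros x y H. apply Hsc. eapply diff2_continuity. apply (Hk x y H). }
  { intros eps Heps. destruct (Hsmall eps 1 Heps Rlt_0_1) as [r [Hr Hle]]. exists r. split; [lra|].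
    eapply Rle_trans; [|exact Hle]. unfold circulation. apply abs_RInt_le; [assert (HP := PI_RGT_0); lra|].
    apply (ex_RInt_continuous (fun t => r * cos t * Q (r * cos t) (r * sin t) - r * sin t * P (r * cos t) (r * sin t))).
    intros t _. assert (N := nz_polar r t ltac:(lra)).
    assert (Cc : continuous (fun s => r * cos s) t).
    { apply (ex_derive_continuous (fun s => r * cos s)). eexists. apply is_derive_cos_scal. }
    assert (Cs : continuous (fun s => r * sin s) t).
    { apply (ex_derive_continuous (fun s => r * sin s)). eexists. apply is_derive_sin_scal. }
    apply (continuous_minus (fun s => r * cos s * Q (r * cos s) (r * sin s))
                            (fun s => r * sin s * P (r * cos s) (r * sin s))).
    - apply (continuous_mult (fun s => r * cos s)); auto.
      apply (continuous_path Q (fun s => r * cos s) (fun s => r * sin s)); auto.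
    - apply (continuous_mult (fun s => r * sin s)); auto.
      apply (continuous_path P (fun s => r * cos s) (fun s => r * sin s)); auto. }
  exists sg.
  unshelve eexists (Stream h P Q (fun x y => sg * k1 x y) (fun x y => sg * k2 x y) (fun x y => - sg * g2 x y)
    (fun x y => sg * k11 x y + - sg * g12 x y) (fun x y => sg * k12 x y + - sg * g22 x y)
    Hh DP _ _ _ _ _ _ _ _ _ _ _ _); [..|split; [exact Hsg|intros; split; reflexivity]].
  - exact DQ.
  - intros x y H. apply (diff2_lincomb k1 g2 sg (- sg)); [apply (Hk x y H)|apply (Hg x y H)].
  - intros x y H. apply Hsc. eapply diff2_continuity. apply (Hk x y H).
  - intros x y H. apply Hsc. eapply diff2_continuity. apply (Hk x y H).
  - intros x y H. apply Hsc. eapply diff2_continuity. apply (Hg x y H).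
  - intros x y H. apply continuity_2d_pt_plus; apply Hsc; [apply (Hk x y H)|apply (Hg x y H)].
  - intros x y H. apply continuity_2d_pt_plus; apply Hsc; [apply (Hk x y H)|apply (Hg x y H)].
  - intros x y H. destruct (HT x y H) as [_ E]. unfold P, Q. apply Rminus_diag_uniq.
    transitivity (sg * sg * (f1 x y * (k11 x y - g12 x y) + f2 x y * (k12 x y - g22 x y))); [ring|rewrite E; ring].
  - intros x y H. assert (N := Hnz (x, y) (proj2 (punctured_plane_nz x y) H)).
    rewrite Hv, enorm_nrm in N. apply nz_nrm in N. unfold nz in N. unfold P, Q.
    destruct (Req_dec (f2 x y) 0) as [E|E].
    + right. destruct Hsg as [->| ->]; nra.
    + left. destruct Hsg as [->| ->]; lra.
  - exists eta, R0. repeat split; auto. intros x y Hxy. specialize (Hrad x y Hxy). unfold P, Q. lra.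
  - intros eps Heps. destruct (Hinf (mkposreal _ Heps)) as [A' HA']. simpl in HA'.
    assert (M1 := Rmax_l A' 0). assert (M2 := Rmax_r A' 0).
    exists (Rmax A' 0 + 1). split; [lra|]. intros x y Hxy.
    assert (B := HA' (x, y)). rewrite enorm_nrm in B. specialize (B ltac:(lra)).
    assert (N : nz x y) by (apply nz_nrm; lra).
    rewrite Hv, dot_e_r in B by auto. simpl in B.
    change (Rabs ((x * f1 x y + y * f2 x y) / nrm x y) <= eps * Rabs (1 / nrm x y)) in B.
    unfold Rdiv in B. rewrite !Rabs_mult, Rabs_R1, Rmult_1_l in B.
    rewrite (Rabs_pos_eq (/ nrm x y)) in B by (apply Rlt_le, Rinv_0_lt_compat; lra).
    apply Rmult_le_reg_r in B; [|apply Rinv_0_lt_compat; lra].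
    unfold P, Q. replace (x * (- sg * f1 x y) - y * (sg * f2 x y)) with (- (sg * (x * f1 x y + y * f2 x y))) by ring.
    rewrite Rabs_Ropp, Rabs_mult, Hsg1, Rmult_1_l. exact B.
  - intros eps d Heps Hd. destruct (Hsmall eps d Heps Hd) as [r [Hr Hle]]. exists r. split; auto.
    intros x y x' y' E E'. eapply Rle_trans; [|exact Hle].
    apply (circle_oscillation h P Q r); auto. lra.
Qed.

(* [is_domin F f g] is Coquelicot's [g = o(f)] along the filter [F]. *)
Theorem theorem1p8 (v : R * R -> R * R)
  (v_C2 : class_C_vec 2 punctured_plane v)
  (v_euler : exists p : R * R -> R, steady_euler punctured_plane v p)
  (v_nonzero : forall x, punctured_plane x -> 0 < enorm (v x))
  (v_liminf : Rbar_lt 0 (liminf_infinity (fun x => enorm (v x))))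
  (v_infinity : is_domin at_infinity (fun x => 1 / enorm x)
                  (fun x => dot (v x) (e_r x)))
  (v_origin : filterlim
                (circle_integral (fun x => Rabs (dot (v x) (e_r x))))
                (at_right 0) (locally 0)) :
  circular punctured_plane v /\
  exists V : R -> R,
    class_C_pos 2 V /\
    ((forall r, 0 < r -> 0 < V r) \/ (forall r, 0 < r -> V r < 0)) /\
    (forall x, punctured_plane x -> v x = scal (V (enorm x)) (e_theta x)).
Proof.
  destruct v_euler as [p He].
  pose (f1 := fun x y => fst (v (x, y))). pose (f2 := fun x y => snd (v (x, y))).
  assert (Hv : forall x y, v (x, y) = (f1 x y, f2 x y)) by (intros; apply surjective_pairing).
  destruct v_C2 as [HC1 HC2].
  destruct (ex_diff_2_diff2 f1) as [g1 [g2 [g11 [g12 [g22 Hg]]]]].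
  { intros x y H. apply (HC1 (x, y)). now apply punctured_plane_nz. }
  destruct (ex_diff_2_diff2 f2) as [k1 [k2 [k11 [k12 [k22 Hk]]]]].
  { intros x y H. apply (HC2 (x, y)). now apply punctured_plane_nz. }
  destruct (euler_stream v p _ _ _ _ _ _ _ _ _ _ _ _ Hv He Hg Hk v_nonzero v_liminf v_infinity v_origin)
    as [sg [s [Hsg Hs]]].
  (* On the positive horizontal axis [e_theta] is [(0, 1)], so the profile is read off from the
     second component of [v], and inherits its regularity. *)
  pose (V := fun r => f2 r 0).
  assert (Hform : forall x y, nz x y ->
    f1 x y = - (y / nrm x y) * V (nrm x y) /\ f2 x y = x / nrm x y * V (nrm x y)).
  { intros x y H. destruct (stream_gradient_radial s x y H) as [E1 E2].
    destruct (Hs x y) as [S1 S2]. destruct (Hs (nrm x y) 0) as [S3 _].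
    rewrite S1, S3 in E1. rewrite S2, S3 in E2. unfold V.
    destruct Hsg as [->| ->]; split; lra. }
  assert (Hpos : forall r, 0 < r -> nz r 0) by (intros; unfold nz; nra).
  assert (HV0 : forall r, 0 < r -> V r <> 0).
  { intros r Hr E. assert (N := v_nonzero (r, 0) (proj2 (punctured_plane_nz _ _) (Hpos r Hr))).
    rewrite Hv, enorm_nrm in N. destruct (Hform r 0 (Hpos r Hr)) as [E1 _].
    assert (E2 : f2 r 0 = 0) by exact E.
    rewrite E1, E2 in N. apply nz_nrm in N. unfold nz, Rdiv in N. nra. }
  assert (DV : forall r, 0 < r -> is_derive V r (k1 r 0)).
  { intros r Hr. destruct (Hk r 0 (Hpos r Hr)) as [D _]. exact (diff2_fst _ _ _ _ _ D). }
  assert (DV2 : forall r, 0 < r -> is_derive (Derive V) r (k11 r 0)).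
  { intros r Hr. apply (is_derive_ext_loc (fun q => k1 q 0)).
    - apply (filter_imp (fun q => 0 < q)); [|now apply open_gt].
      intros q Hq. symmetry. now apply is_derive_unique, DV.
    - destruct (Hk r 0 (Hpos r Hr)) as [_ [D _]]. exact (diff2_fst _ _ _ _ _ D). }
  split.
  - intros [x y] Hx. apply punctured_plane_nz in Hx. rewrite Hv, dot_e_r by auto. simpl.
    destruct (Hform x y Hx) as [-> ->]. apply nz_nrm in Hx. field. lra.
  - exists V. split; [|split].
    + intros r Hr. split.
      * intros [|[|[|k]]] Hk2; simpl; auto; [eexists; now apply DV|eexists; now apply DV2|lia].
      * simpl. apply (continuous_ext_loc _ (fun q => k11 q 0)).
        -- apply (filter_imp (fun q => 0 < q)); [|now apply open_gt].
           intros q Hq. symmetry. now apply is_derive_unique, DV2.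
        -- apply (continuous_path k11 (fun q => q) (fun _ => 0)).
           ++ apply (Hk r 0 (Hpos r Hr)).
           ++ apply continuous_id.
           ++ apply continuous_const.
    + assert (CV : forall r, 0 < r -> continuous V r).
      { intros r Hr. apply (ex_derive_continuous V). eexists. now apply DV. }
      destruct (Rlt_dec 0 (V 1)) as [H1|H1]; [left|right]; intros r Hr.
      (* The sign at radius [1] spreads to all radii, since [V] is continuous and has no zero. *)
      * apply (no_sign_change V 1 r); auto. intros t Ht.
        assert (0 < t) by (assert (0 < Rmin 1 r) by (apply Rmin_glb_lt; lra); lra). auto.
      * assert (0 < - V r); [|lra]. apply (no_sign_change (fun q => - V q) 1 r).
        -- intros t Ht.
           assert (H0 : 0 < t) by (assert (0 < Rmin 1 r) by (apply Rmin_glb_lt; lra); lra).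
           split; [now apply (continuous_opp V), CV|]. specialize (HV0 t H0). lra.
        -- specialize (HV0 1 Rlt_0_1). lra.
    + intros [x y] Hx. apply punctured_plane_nz in Hx. rewrite Hv. destruct (Hform x y Hx) as [E1 E2].
      rewrite enorm_nrm. unfold e_theta. simpl fst. simpl snd. rewrite enorm_nrm.
      unfold scal. simpl. unfold prod_scal, scal. simpl. unfold mult. simpl.
      rewrite E1, E2. apply nz_nrm in Hx. f_equal; field; lra.
Qed.
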